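(* Let $\overline{M}$ be a smooth manifold of dimension $n+1$ with boundary $\partial M$ and interior $M$. Let $g=g_{ij}$ be a pseudo-Riemannian metric on $M$ such that the projective structure determined by the Levi-Civita connection $\nabla$ of $g$ admits a smooth extension to all of $\overline{M}$. Let $\tau:=\mathrm{vol}(g)^{-\frac{2}{n+2}}\in\Gamma(\mathcal{E}(2)|_M)$, where $\mathrm{vol}(g)$ is the volume density of $g$. Then the sections $\tau^{-1}g^{ij}$ of $\mathcal{E}^{(ij)}(-2)$ and $L(\tau^{-1}g^{ij})$ of $S^2\mathcal{T}$ (both initially defined over $M$), as well as the scalar curvature $S$ of $g$, admit smooth extensions to all of $\overline{M}$.
   Context: Projective structures: torsion-free linear connections $\nabla,\hat\nabla$ on a tangent bundle are projectively equivalent if $\hat\nabla_\xi\eta=\nabla_\xi\eta+\Upsilon(\xi)\eta+\Upsilon(\eta)\xi$ for some one-form $\Upsilon$; a projective structure is an equivalence class. The projective structure of a torsion-free connection $\nabla$ on $TM$ admits a smooth extension to $\overline{M}$ if for every $x\in\partial M$ there is an open neighborhood $U$ of $x$ in $\overline{M}$ and $\Upsilon\in\Omega^1(U\cap M)$ such that for all vector fields $\xi,\eta$ on $U$ smooth up to the boundary, $\hat\nabla_\xi\eta=\nabla_\xi\eta+\Upsilon(\xi)\eta+\Upsilon(\eta)\xi$ admits a smooth extension from $U\cap M$ to $U$. This yields a projective structure on $\overline{M}$. Densities: on a manifold of dimension $n+1$, $\mathcal{E}(w)$ ($w\in\mathbb{R}$) is the natural line bundle with $\mathcal{E}(w)=\mathcal{E}(1)^w$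 and $\mathcal{E}(-n-2)$ the bundle of volume densities, i.e. $\mathcal{E}(w)$ is the $(-\frac{w}{n+2})$-th power of the bundle of volume densities. Abstract indices are used: $\mathcal{E}^i=T\overline{M}$, $\mathcal{E}_i=T^*\overline{M}$, $\mathcal{E}^{(ij)}=S^2T\overline{M}$, and appending $(w)$ means tensoring with $\mathcal{E}(w)$. The inverse of $g_{ij}$ is $g^{ij}$. Tractor bundles: the standard cotractor bundle is $\mathcal{T}^*=J^1\mathcal{E}(1)$ (first jets of sections of $\mathcal{E}(1)$ over $\overline{M}$), $\mathcal{T}$ is its dual (rank $n+2$), $S^2\mathcal{T}$ the symmetric square. A connection $\nabla$ in the projective class gives an isomorphism $\mathcal{T}^*\cong\mathcal{E}(1)\oplus\mathcal{E}_i(1)$, $j^1\sigma\mapsto(\sigma,\nabla_i\sigma)$, and dually $\mathcal{T}\cong\mathcal{E}^i(-1)\oplus\mathcal{E}(-1)$ with pairing $\langle(\nu^i,\rho),(\sigma,\mu_i)\rangle=\nu^i\mu_i+\rho\sigma$. Correspondingly $S^2\mathcal{T}\cong\mathcal{E}^{(ij)}(-2)\oplus\mathcal{E}^i(-2)\oplus\mathcal{E}(-2)$, where the triple $(\zeta^{ij},\lambda^i,\kappa)$, viewed as a symmetric bilinear form on $\mathcal{T}^*$, has quadratic form $(\sigma,\mu_i)\mapsto\zeta^{ij}\mu_i\mu_j+2\lambda^i\mu_i\sigma+\kappa\sigma^2$; the component $\zeta^{ij}$ is the image under the canonical projection $S^2\mathcal{T}\to\mathcal{E}^{(ij)}(-2)$.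 The section $L(\tau^{-1}g^{ij})$: over $M$, in the splitting determined by the Levi-Civita connection $\nabla$ of $g$, $L(\tau^{-1}g^{ij})=\big(\tau^{-1}g^{ij},\,0,\,\tfrac{1}{n+1}\tau^{-1}g^{ij}\mathsf{P}_{ij}\big)$, where $\mathsf{P}_{ij}=\frac1n\mathrm{Ric}_{ij}$ is the projective Schouten tensor of $g$, $\mathrm{Ric}_{ij}=R_{ki}{}^k{}_j$ is the Ricci curvature, and $S=g^{ij}\mathrm{Ric}_{ij}$ is the scalar curvature. *)

(* Defs.v *)
From HB Require Import structures.
From mathcomp Require Import all_boot all_order all_algebra.
From mathcomp Require Import all_classical all_reals all_analysis.
Set Implicit Arguments.
Unset Strict Implicit.
Unset Printing Implicit Defensive.
Import Order.TTheory GRing.Theory Num.Theory.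
Import numFieldNormedType.Exports.
Local Open Scope classical_set_scope.
Local Open Scope ring_scope.

(* Throughout, manifolds have dimension n+1 and are modelled on the closed
   half space {v | 0 <= v_0} of R^(n+1). *)

Section Calculus.
Variables (R : realType) (n : nat).
Local Notation V := 'rV[R]_n.+1.

Definition half_space : set V := [set v | 0 <= v 0 0].

Definition unit_vec (a : 'I_n.+1) : V := delta_mx 0 a.

Fixpoint Ck (k : nat) (O : set V) (f : V -> R) : Prop :=
  match k with
  | 0 => {in O, continuous f}
  | k'.+1 => forall a : 'I_n.+1,
      (forall u, O u -> derivable f u (unit_vec a)) /\
      Ck k' O (fun u => 'D_(unit_vec a) f u)
  end.

Definition Cinfty (O : set V) (f : V -> R) : Prop := forall k, Ck k O f.

(* Smoothness on an arbitrary set: near each point of A, f is the restriction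
   of a smooth function on an open subset of R^(n+1).  For A relatively open
   in the half space this is smoothness up to the boundary. *)
Definition smooth_on (A : set V) (f : V -> R) : Prop :=
  forall u, A u -> exists (O : set V) (h : V -> R),
    [/\ open O, O u, Cinfty O h & forall v, O v -> A v -> f v = h v].

Definition smooth_mx_on p q (A : set V) (f : V -> 'M[R]_(p, q)) : Prop :=
  forall i j, smooth_on A (fun u => f u i j).

(* Partial derivative as a limit over increments h > 0.  The half space is
   stable under v |-> v + h e_a for h > 0, so that this only involves values of
   f on the half space; for f smooth up to the boundary it is the usual partial
   derivative, also at boundary points. *)
Definition pd (a : 'I_n.+1) (f : V -> R) (u : V) : R :=
  lim ((fun h : R => h^-1 * (f (u + h *: unit_vec a) - f u)) @ at_right 0).

(* Jac F u k a = d_a F^k (u) *)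
Definition Jac (F : V -> V) (u : V) : 'M[R]_n.+1 :=
  \matrix_(k, a) pd a (fun v => F v 0 k) u.

End Calculus.

Section Manifold.
Variables (R : realType) (n : nat) (T : topologicalType).
Local Notation V := 'rV[R]_n.+1.

(* [par] is the inverse of [crd] on crd @` dom and is unspecified elsewhere. *)
Record chart := Chart {
  dom : set T;
  crd : T -> V;
  par : V -> T;
  dom_open : open dom;
  crd_img : exists2 O : set V, open O & crd @` dom = O `&` half_space (n := n);
  crdK : forall x, dom x -> par (crd x) = x;
  crd_continuous : {within dom, continuous crd};
  par_continuous : {within crd @` dom, continuous par} }.

Variables (I : Type) (phi : I -> chart).

Definition transition (i j : I) (u : V) : V := crd (phi j) (par (phi i) u).

Definition manifold_with_boundary : Prop :=
  [/\ hausdorff_space T,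
      second_countable (T := T),
      forall x, exists i, dom (phi i) x &
      forall i j, smooth_mx_on (crd (phi i) @` (dom (phi i) `&` dom (phi j)))
                               (transition i j)].

Definition interior_pts : set T :=
  [set x | exists2 i, dom (phi i) x & 0 < crd (phi i) x 0 0].

Definition boundary_pts : set T :=
  [set x | exists2 i, dom (phi i) x & crd (phi i) x 0 0 = 0].

(* A natural vector bundle is given by its fibre in a chart and by the action
   [act F u] of a change of coordinates F, at the point with old coordinates u,
   taking old fibre components to new ones. *)
Record bundle (p q : nat) := Bundle {
  fib : set 'M[R]_(p, q);
  act : (V -> V) -> V -> 'M[R]_(p, q) -> 'M[R]_(p, q) }.

(* Components of a section in the charts: s i u is the value at the point with
   coordinates u in the chart i. *)
Definition components (p q : nat) := I -> V -> 'M[R]_(p, q).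

Definition smooth_section p q (B : bundle p q) (A : set T)
    (s : components p q) : Prop :=
  [/\ forall i x, A x -> dom (phi i) x -> fib B (s i (crd (phi i) x)),
      forall i j x, A x -> dom (phi i) x -> dom (phi j) x ->
        s j (crd (phi j) x) =
        act B (transition i j) (crd (phi i) x) (s i (crd (phi i) x)) &
      forall i, smooth_mx_on (crd (phi i) @` (A `&` dom (phi i))) (s i)].

Definition extends_smoothly p q (B : bundle p q) (A : set T)
    (s : components p q) : Prop :=
  exists2 s' : components p q, smooth_section B A s' &
    forall i x, A x -> interior_pts x -> dom (phi i) x ->
      s' i (crd (phi i) x) = s i (crd (phi i) x).

Definition smooth_function (f : T -> R) : Prop :=
  forall i, smooth_on (crd (phi i) @` dom (phi i)) (fun u => f (par (phi i) u)).

Definition function_extends_smoothly (f : I -> V -> R) : Prop :=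
  exists2 f' : T -> R, smooth_function f' &
    forall i x, interior_pts x -> dom (phi i) x -> f' x = f i (crd (phi i) x).

(* E(-n-2) is the bundle of volume densities, whose components are multiplied
   by |det Jac|^-1 under a change of coordinates. *)
Definition density_factor (w : R) (F : V -> V) (u : V) : R :=
  `|\det (Jac F u)| `^ (w / n.+2%:R).

Definition symmetric_mx p : set 'M[R]_p := [set A | A^T = A].

Definition tangent : bundle n.+1 1 :=
  Bundle setT (fun F u X => Jac F u *m X).

Definition cotangent : bundle 1 n.+1 :=
  Bundle setT (fun F u a => a *m invmx (Jac F u)).

Definition sym2_cotangent : bundle n.+1 n.+1 :=
  Bundle (@symmetric_mx _)
    (fun F u h => (invmx (Jac F u))^T *m h *m invmx (Jac F u)).

Definition sym2_tangent (w : R) : bundle n.+1 n.+1 :=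
  Bundle (@symmetric_mx _)
    (fun F u z => density_factor w F u *: (Jac F u *m z *m (Jac F u)^T)).

(* A section sigma of E(1) has components sigma_old = d * (sigma_new \o F) with
   d = |det Jac F|^(-1/(n+2)).  Differentiating, its 1-jet in coordinates
   satisfies  (sigma, d_a sigma)_old = jet_change F u *m (sigma, d_a sigma)_new. *)
Definition jet_change (F : V -> V) (u : V) : 'M[R]_(1 + n.+1) :=
  let d := density_factor (- 1) F in
  block_mx (d u)%:M 0 (\col_a pd a d u) (d u *: (Jac F u)^T).

(* S^2 of the standard tractor bundle: symmetric bilinear forms on
   T^* = J^1 E(1), written in the jet coordinates (sigma, d_a sigma). *)
Definition sym2_tractor : bundle (1 + n.+1) (1 + n.+1) :=
  Bundle (@symmetric_mx _)
    (fun F u Q => (jet_change F u)^T *m Q *m jet_change F u).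

(* Connection coefficients: nabla_a e_b = sum_c (Gamma i c a b) e_c *)
Definition conn_coef := 'I_n.+1 -> 'I_n.+1 -> 'I_n.+1 -> V -> R.

Definition cov_deriv (Gam : conn_coef) (X Y : V -> 'cV[R]_n.+1) (u : V) :
    'cV[R]_n.+1 :=
  \col_c (\sum_a X u a 0 * pd a (fun v => Y v c 0) u +
          \sum_a \sum_b Gam c a b u * X u a 0 * Y u b 0).

Definition projective_change (Gam : conn_coef) (Ups : V -> 'rV[R]_n.+1)
    (X Y : V -> 'cV[R]_n.+1) (u : V) : 'cV[R]_n.+1 :=
  cov_deriv Gam X Y u + (Ups u *m X u) 0 0 *: Y u + (Ups u *m Y u) 0 0 *: X u.

Definition projective_structure_extends (Gam : I -> conn_coef) : Prop :=
  forall x, boundary_pts x ->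
    exists (U : set T) (Ups : components 1 n.+1),
      [/\ open U, U x, smooth_section cotangent (U `&` interior_pts) Ups &
          forall X Y : components n.+1 1,
            smooth_section tangent U X -> smooth_section tangent U Y ->
            extends_smoothly tangent U
              (fun i => projective_change (Gam i) (Ups i) (X i) (Y i))].

Definition pseudo_riemannian_metric (g : components n.+1 n.+1) : Prop :=
  smooth_section sym2_cotangent interior_pts g /\
  forall i x, interior_pts x -> dom (phi i) x ->
    g i (crd (phi i) x) \in unitmx.

End Manifold.

Section Metric.
Variables (R : realType) (n : nat).
Local Notation V := 'rV[R]_n.+1.

Definition christoffel (g : V -> 'M[R]_n.+1) : conn_coef R n := fun c a b u =>
  2^-1 * \sum_d invmx (g u) c d *
    (pd a (fun v => g v d b) u + pd b (fun v => g v a d) u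
     - pd d (fun v => g v a b) u).

(* R_{ab}^c_d, with (nabla_a nabla_b - nabla_b nabla_a) X^c = R_{ab}^c_d X^d *)
Definition riemann (Gam : conn_coef R n) (a b c d : 'I_n.+1) (u : V) : R :=
  pd a (Gam c b d) u - pd b (Gam c a d) u
  + \sum_e (Gam c a e u * Gam e b d u - Gam c b e u * Gam e a d u).

Definition ricci (Gam : conn_coef R n) (a b : 'I_n.+1) (u : V) : R :=
  \sum_k riemann Gam k a k b u.

Definition proj_schouten (Gam : conn_coef R n) (a b : 'I_n.+1) (u : V) : R :=
  n%:R^-1 * ricci Gam a b u.

Definition scalar_curvature (g : V -> 'M[R]_n.+1) (u : V) : R :=
  \sum_a \sum_b invmx (g u) a b * ricci (christoffel g) a b u.

Definition vol (g : V -> 'M[R]_n.+1) (u : V) : R := Num.sqrt `|\det (g u)|.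

Definition tau (g : V -> 'M[R]_n.+1) (u : V) : R := vol g u `^ (- (2 / n.+2%:R)).

Definition tau_inv_metric (g : V -> 'M[R]_n.+1) (u : V) : 'M[R]_n.+1 :=
  (tau g u)^-1 *: invmx (g u).

(* The isomorphism (sigma, d_a sigma) |-> (sigma, nabla_a sigma) given by a
   connection.  On volume densities nabla_a f = d_a f - Gamma^k_{ka} f, hence
   nabla_a sigma = d_a sigma + (n+2)^-1 Gamma^k_{ka} sigma on E(1). *)
Definition splitting (Gam : conn_coef R n) (u : V) : 'M[R]_(1 + n.+1) :=
  block_mx 1%:M 0 (\col_a (n.+2%:R^-1 * \sum_k Gam k k a u)) 1%:M.

(* The form with quadratic form zeta^{ab} mu_a mu_b + 2 lambda^a mu_a sigma
   + kappa sigma^2 at (sigma, mu_a = nabla_a sigma), in jet coordinates. *)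
Definition tractor_of_triple (Gam : conn_coef R n) (zeta : V -> 'M[R]_n.+1)
    (lambda : V -> 'cV[R]_n.+1) (kappa : V -> R) (u : V) : 'M[R]_(1 + n.+1) :=
  (splitting Gam u)^T
  *m block_mx (kappa u)%:M (lambda u)^T (lambda u) (zeta u)
  *m splitting Gam u.

Definition L_tau_inv_metric (g : V -> 'M[R]_n.+1) : V -> 'M[R]_(1 + n.+1) :=
  tractor_of_triple (christoffel g) (tau_inv_metric g) (fun=> 0)
    (fun u => n.+1%:R^-1 * \sum_a \sum_b
       tau_inv_metric g u a b * proj_schouten (christoffel g) a b u).

End Metric.

(* Main.v *)
(* Over the interior put zeta = tau^-1 g^-1, gamma_a = (n+2)^-1 Gamma^k_ka,
   lambda = zeta gamma, and let Pi be the trace-free part of Gamma.  Then Pi only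
   depends on the projective class, hence extends smoothly, and
     d_a zeta = - Pi_a zeta - zeta Pi_a^T - e_a lambda^T - lambda e_a^T.
   This system is of finite type: differentiating and contracting twice expresses
   all derivatives of zeta, lambda and nu = div lambda as linear combinations of
   these functions, with coefficients smooth up to the boundary.  In particular
   they solve a linear ODE in the direction transverse to the boundary, so that
   they extend smoothly across it.  In jet coordinates the entries of L are zeta,
   lambda and kappa = (n(n+1))^-1 zeta.Ric(Pi) - (n+1)^-1 nu, where
   Ric(Pi)_ab = d_k Pi^k_ab - Pi^k_ae Pi^e_kb, and
   S = n (n+1) sgn(det g) det L.  The local extensions glue because boundary
   values are limits from the interior, where everything is natural.  To obtain
   smooth Gamma-hat near a boundary point from its action on vector fields, apply
   it to coordinate fields multiplied by a bump function. *)

From HB Require Import structures.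
From mathcomp Require Import all_boot all_order all_algebra.
From mathcomp Require Import all_classical all_reals all_analysis.
From mathcomp Require Import perm ring lra.
Require Import Defs.
Set Implicit Arguments.
Unset Strict Implicit.
Unset Printing Implicit Defensive.
Import Order.TTheory GRing.Theory Num.Theory.
Import numFieldNormedType.Exports.
Local Open Scope classical_set_scope.
Local Open Scope ring_scope.

(** * Calculus on open sets *)

(** The metric and its Christoffel symbols may blow up or degenerate at the boundary, and a priori
    nothing is known there about [zeta] or [lambda]; only the coefficients of the linear system are
    controlled. As smoothness up to the boundary means being the restriction of a smooth function on
    an open set of R^(n+1), these coefficients live on both sides of the boundary. The system is
    solved anew with initial values on a slice at height eps > 0, where everything is smooth, and
    uniqueness identifies the new solution with the given one at positive heights. This requires
    smooth dependence on the coordinates along the slice. The form [gamma] need not have a limit, so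
    every quantity that is to extend must be rewritten until [gamma] occurs only inside [lambda] and
    [nu]. Its factor 1/(n+2) is forced by the trace of delta^c_a gamma_b + delta^c_b gamma_a, which
    is (n+2) gamma_b in dimension n+1. The second contraction yields n times the derivative of [nu],
    which determines it because 0 < n. The formula for S rests on tau^-(n+2) = |det g|, which
    cancels det g up to a sign that is constant on the interior half of a small ball. *)

Lemma sum_delta (R : pzSemiRingType) (I : finType) (a : I) (F : I -> R) :
  \sum_b (b == a)%:R * F b = F a.
Proof.
by rewrite (bigD1 a) //= eqxx mul1r big1 ?addr0 // => b /negPf ->; exact: mul0r.
Qed.

(** [pd] is a one-sided limit that makes sense on the half space; the rules of calculus are proved
    for this two-sided derivative, and the two agree for functions smooth up to the boundary. *)
Definition der (R : realType) (n : nat) (a : 'I_n.+1) (f : 'rV[R]_n.+1 -> R)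
  (u : 'rV[R]_n.+1) : R := 'D_(unit_vec R a) f u.

Section MxNorm.
Variable R : realType.

Lemma mx_norm_leP p q (M : 'M[R]_(p, q)) (e : R) : 0 <= e ->
  `|M| <= e <-> forall i j, `|M i j| <= e.
Proof.
move=> e0; rewrite [`|M|]/Num.Def.normr/= mx_normrE; split.
  by move=> /bigmax_leP[_ H] i j; have := H (i, j) isT.
by move=> H; apply/bigmax_leP; split=> // -[i j] _; exact: H.
Qed.

Lemma le_mx_norm p q (M : 'M[R]_(p, q)) i j : `|M i j| <= `|M|.
Proof. by apply: (mx_norm_leP M (normr_ge0 _)).1. Qed.

Lemma cvg_mxP p q (T : Type) (F : set_system T) (FF : Filter F)
    (M : T -> 'M[R]_(p, q)) (N : 'M[R]_(p, q)) :
  M @ F --> N <-> forall i j, (fun t => M t i j) @ F --> N i j.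
Proof.
split.
  move=> MN i j; apply: (cvg_comp M (fun A : 'M[R]_(p, q) => A i j) MN).
  exact: coord_continuous.
move=> H; apply/cvgrPdist_le => e e0.
have : \forall t \near F, forall ij : 'I_p * 'I_q, `|N ij.1 ij.2 - M t ij.1 ij.2| <= e.
  apply: filter_forall => -[i j] /=.
  by move/cvgrPdist_le: (H i j); apply.
apply: filterS => t Ht; apply/mx_norm_leP; first exact: ltW.
by move=> i j; rewrite !mxE; exact: (Ht (i, j)).
Qed.

Lemma cvg_sumr (T I : Type) (F : set_system T) (FF : Filter F) (r : seq I)
    (f : I -> T -> R) (l : I -> R) : (forall i, f i @ F --> l i) ->
  (fun t => \sum_(i <- r) f i t) @ F --> \sum_(i <- r) l i.
Proof.
move=> fl; elim: r => [|i r IH].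
  under eq_fun do rewrite big_nil; rewrite big_nil; exact: cvg_cst.
by under eq_fun do rewrite big_cons; rewrite big_cons; exact: cvgD.
Qed.

End MxNorm.

Section HasDer.
Variables (R : realType) (U W : normedModType R).
Implicit Types (f h : U -> W) (u v : U) (l k : W).

(* [is_derive] as a plain proposition instead of a type class. *)
Definition has_der f u v l := derivable f u v /\ 'D_v f u = l.

Lemma has_der_is_derive f u v l : has_der f u v l <-> is_derive u v f l.
Proof. by split=> -[]; split. Qed.

Lemma derivable_has_der f u v : derivable f u v -> has_der f u v ('D_v f u).
Proof. by split. Qed.

Lemma has_der_cst l u v : has_der (fun=> l) u v 0.
Proof. by apply/has_der_is_derive; exact: is_derive_cst. Qed.

Lemma has_derD f h u v l k : has_der f u v l -> has_der h u v k ->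
  has_der (fun x => f x + h x) u v (l + k).
Proof.
by move=> /has_der_is_derive ? /has_der_is_derive ?; apply/has_der_is_derive; exact: is_deriveD.
Qed.

Lemma has_derN f u v l : has_der f u v l -> has_der (fun x => - f x) u v (- l).
Proof. by move=> /has_der_is_derive ?; apply/has_der_is_derive; exact: is_deriveN. Qed.

Lemma has_derB f h u v l k : has_der f u v l -> has_der h u v k ->
  has_der (fun x => f x - h x) u v (l - k).
Proof. by move=> ? ?; apply: has_derD => //; exact: has_derN. Qed.

Lemma has_der_near f h u v l : (\forall x \near u, f x = h x) ->
  has_der f u v l -> has_der h u v l.
Proof.
by move=> fh /has_der_is_derive H; apply/has_der_is_derive; exact: near_eq_is_derive H.
Qed.

End HasDer.

Section HasDerR.
Variables (R : realType) (U : normedModType R).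
Implicit Types (f h : U -> R) (u v : U) (l k : R).

Lemma has_derM f h u v l k : has_der f u v l -> has_der h u v k ->
  has_der (fun x => f x * h x) u v (l * h u + f u * k).
Proof.
move=> /has_der_is_derive ? /has_der_is_derive ?; apply/has_der_is_derive.
have := is_deriveM (f := f) (g := h) (x := u) (v := v) (df := l) (dg := k).
by rewrite /GRing.scale /= addrC [l * _]mulrC; apply.
Qed.

Lemma has_derV f u v l : f u != 0 -> has_der f u v l ->
  has_der (fun x => (f x)^-1) u v (- ((f u)^-1 * (f u)^-1) * l).
Proof.
move=> f0 [D E]; split; first exact: derivableV.
by rewrite deriveV // E /GRing.scale /= expr2 invfM.
Qed.

Lemma has_der_sum (I : Type) (r : seq I) (f : I -> U -> R) u v (l : I -> R) :
  (forall i, has_der (f i) u v (l i)) ->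
  has_der (fun x => \sum_(i <- r) f i x) u v (\sum_(i <- r) l i).
Proof.
move=> fl; elim: r => [|i r IH].
  under eq_fun do rewrite big_nil; rewrite big_nil; exact: has_der_cst.
by under eq_fun do rewrite big_cons; rewrite big_cons; exact: has_derD.
Qed.

(** Both difference quotients are the same function of the increment, which makes the one-variable
    mean value theorem and chain rule available along lines. *)
Lemma has_der_line f u v (s : R) l :
  has_der f (u + s *: v) v l <-> has_der (fun t : R => f (u + t *: v)) s 1 l.
Proof.
have E : (fun h : R => h^-1 *: ((f \o shift (u + s *: v)) (h *: v) - f (u + s *: v))) =
  (fun h : R => h^-1 *: (((fun t : R => f (u + t *: v)) \o shift s) (h *: 1) - f (u + s *: v))).
  by apply/funext => h /=; rewrite addrCA -scalerDl [_ *: 1]mulr1.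
by split => -[D L]; (split; [by move: D; rewrite /derivable E|by move: L; rewrite /derive E]).
Qed.

Lemma has_der_line0 f u v l :
  has_der f u v l <-> has_der (fun t : R => f (u + t *: v)) 0 1 l.
Proof. by rewrite -{1}[u]addr0 -{1}(scale0r v); exact: has_der_line. Qed.

Lemma has_der_comp1 (f : R -> R) h u v l k : has_der f (h u) 1 l ->
  has_der h u v k -> has_der (fun x => f (h x)) u v (l * k).
Proof.
move=> fl hk.
apply/has_der_line0/has_der_is_derive.
apply: (is_derive1_comp (f := f)); apply/has_der_is_derive.
  by rewrite scale0r addr0.
exact/has_der_line0.
Qed.

End HasDerR.

Section Smooth.
Variables (R : realType) (n : nat).
Local Notation V := 'rV[R]_n.+1.
Implicit Types (O : set V) (f h : V -> R) (u v : V).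
Local Notation e_ := (unit_vec R).

Lemma near_ballP u (P : V -> Prop) :
  (\forall v \near u, P v) <->
  exists2 r : R, 0 < r & forall v, `|v - u| < r -> P v.
Proof.
rewrite -[X in X <-> _]/(nbhs u P) nbhs_ballP; split=> -[r r0 Hr]; exists r => // v.
  by move=> uv; apply: Hr; rewrite -ball_normE /= distrC.
by rewrite -ball_normE /= distrC; exact: Hr.
Qed.

Lemma unit_vecE (a i : 'I_n.+1) : (e_ a : V) 0 i = (i == a)%:R.
Proof. by rewrite /unit_vec mxE eqxx. Qed.

Lemma norm_unit_vec (a : 'I_n.+1) : `|e_ a : V| <= 1.
Proof.
apply/mx_norm_leP => // i j; rewrite ord1 unit_vecE.
by case: eqP => _; rewrite ?normr0 ?normr1.
Qed.

Lemma has_der_scale f u v (t l : R) :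
  has_der f u v l -> has_der f u (t *: v) (t * l).
Proof.
move=> df.
have /has_der_is_derive d2 : has_der (fun y : R => f (u + y *: v)) (t * 0) 1 l.
  by rewrite mulr0; apply/has_der_line; rewrite scale0r addr0.
have d3 : is_derive (0 : R) 1 ((fun y : R => f (u + y *: v)) \o (fun y : R => t * y)) (l * t).
  apply: is_derive1_comp.
  have := @is_deriveZ R R R id t 0 1 1 (is_derive_id _ _).
  by rewrite /GRing.scale /= mulr1.
suff : has_der f (u + (0 : R) *: (t *: v)) (t *: v) (t * l).
  by rewrite scale0r addr0.
apply/has_der_line; rewrite mulrC; apply/has_der_is_derive.
have -> : (fun s : R => f (u + s *: (t *: v))) =
    (fun y : R => f (u + y *: v)) \o (fun y : R => t * y) => //.
by apply/funext => y /=; rewrite scalerA mulrC.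
Qed.

(** The segment is rescaled to [0, 1], so that the sign of [t] does not matter. *)
Lemma MVT_line f (df : V -> R) u v (t : R) :
  (forall s : R, 0 <= s <= 1 ->
    has_der f (u + (s * t) *: v) v (df (u + (s * t) *: v))) ->
  exists2 s : R, 0 <= s <= 1 & f (u + t *: v) - f u = t * df (u + (s * t) *: v).
Proof.
move=> H.
have H' (s : R) : 0 <= s <= 1 ->
    has_der (fun s : R => f (u + s *: (t *: v))) s 1 (t * df (u + (s * t) *: v)).
  move=> /H Hs; apply/has_der_line.
  by rewrite (scalerA s t v); exact: has_der_scale Hs.
have [||c c01 /= E] := MVT_segment ler01 (f := fun s : R => f (u + s *: (t *: v)))
    (df := fun s => t * df (u + (s * t) *: v)).
- move=> x; rewrite in_itv /= => /andP[x0 x1]; apply/has_der_is_derive.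
  by apply: H'; rewrite !ltW.
- apply: derivable_within_continuous => x; rewrite in_itv /= => x01.
  by case: (H' x x01).
exists c; first by move: c01; rewrite in_itv.
by move: E; rewrite scale1r scale0r addr0 subr0 mulr1.
Qed.

(** The increment is telescoped coordinate by coordinate, and the mean value theorem turns each term
    into a partial derivative at a point close to [u]. *)
Lemma C1_differentiable f u :
  (\forall v \near u, forall a, derivable f v (e_ a)) ->
  (forall a, {for u, continuous (der a f)}) -> differentiable f u.
Proof.
move=> Dn Dc.
pose L (v : V) : R := \sum_a der a f u * v 0 a.
have Llin : linear L.
  move=> k v w; rewrite /L scaler_sumr -big_split /=; apply: eq_bigr => a _.
  by rewrite !mxE /GRing.scale /= mulrDr mulrCA.
pose LL : {linear V -> R} := HB.pack L (GRing.isLinear.Build _ _ _ _ _ Llin).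
have Lc : continuous LL.
  move=> v; apply: (@cvg_sumr R V _ (nbhs v) _ _ (fun a w => der a f u * w 0 a)) => a.
  by apply: cvgM; [exact: cvg_cst|exact: coord_continuous].
have dxf : f \o shift u = cst (f u) + LL +o_ (0 : V) id.
  apply/eqaddoP => e e0.
  have e1 : 0 < e / n.+1%:R by rewrite divr_gt0.
  have : \forall v \near u, forall a, `|der a f u - der a f v| <= e / n.+1%:R.
    apply: (@filter_forall V 'I_n.+1 (fun a v => `|der a f u - der a f v| <= e / n.+1%:R) (nbhs u) _) => a.
    by move/cvgrPdist_le: (Dc a) => /(_ _ e1).
  move=> Dc'; have [r r0 Hr] := (near_ballP _ _).1 (filterI Dn Dc').
  apply/near_ballP; exists r => //= v; rewrite subr0 => vr.
  (* [p j] keeps the first [j] coordinates of [v], so consecutive points differ in a single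
     coordinate. *)
  pose p j : V := \row_i if (i < j)%N then v 0 i else 0.
  have -> : (f \o shift u - (cst (f u) + LL)) v = \sum_(j < n.+1) (f (u + p j.+1) - f (u + p j) - der j f u * v 0 j).
    rewrite sumrB -(big_mkord predT (fun j => f (u + p j.+1) - f (u + p j))) telescope_sumr //.
    have -> : p 0%N = 0 by apply/rowP => i; rewrite !mxE.
    have -> : p n.+1 = v by apply/rowP => i; rewrite !mxE ltn_ord.
    by rewrite addr0 [RHS]addrAC !fctE /= [v + u]addrC opprD addrA /L addrAC.
  apply: (le_trans (ler_norm_sum _ _ _)).
  have -> : e * `|v| = \sum_(j < n.+1) e / n.+1%:R * `|v|.
    by rewrite sumr_const card_ord -[RHS]mulr_natr mulrAC divfK // pnatr_eq0.
  apply: ler_sum => j _.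
  have pj : p j.+1 = p j + v 0 j *: e_ j.
    apply/rowP => i; rewrite !mxE eqxx /= ltnS leq_eqVlt.
    case: (ltngtP i j) => ij /=.
    - by rewrite (_ : (i == j) = false) ?mulr0 ?addr0 //; apply/eqP => E; rewrite E ltnn in ij.
    - by rewrite (_ : (i == j) = false) ?mulr0 ?addr0 //; apply/eqP => E; rewrite E ltnn in ij.
    - by rewrite -(ord_inj ij) eqxx mulr1 add0r.
  have inr (s : R) : 0 <= s <= 1 -> `|u + p j + (s * v 0 j) *: e_ j - u| < r.
    move=> /andP[s0 s1]; apply: le_lt_trans vr.
    rewrite -(addrA u) [_ - u]addrC addKr; apply/mx_norm_leP => // k i; rewrite ord1 !mxE eqxx /=.
    have vi := le_mx_norm v 0 i.
    case: ltngtP => ij.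
    - by rewrite (_ : (i == j) = false) ?mulr0 ?addr0 //; apply/eqP => E; rewrite E ltnn in ij.
    - by rewrite (_ : (i == j) = false) ?mulr0 ?addr0 ?normr0 //; apply/eqP => E; rewrite E ltnn in ij.
    - rewrite -(ord_inj ij) eqxx mulr1 add0r normrM ger0_norm //.
      by apply: le_trans vi; rewrite ler_piMl.
  rewrite pj addrA.
  have [|s s01 ->] := @MVT_line f (der j f) (u + p j) (e_ j) (v 0 j).
    by move=> s /inr /Hr [H _]; constructor.
  have [_ /(_ j)] := Hr _ (inr s s01).
  rewrite [v 0 j * _]mulrC -mulrBl normrM distrC => H.
  by apply: ler_pM => //; exact: le_mx_norm.
have E := diff_unique Lc dxf.
by apply/diff_locallyP; rewrite E.
Qed.

Lemma diff_derE f u v : differentiable f u ->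
  'D_v f u = \sum_a v 0 a * der a f u.
Proof.
move=> df; rewrite deriveE // [in LHS](row_sum_delta v) linear_sum; apply: eq_bigr => a _.
by rewrite linearZ /= /der deriveE.
Qed.

Lemma chain_rule f (F : R -> V) (t : R) (dF : V) :
  differentiable f (F t) -> (forall a, has_der (fun s => F s 0 a) t 1 (dF 0 a)) ->
  has_der (fun s => f (F s)) t 1 (\sum_a der a f (F t) * dF 0 a).
Proof.
move=> df dFt.
have DF : derivable F t 1.
  by apply/derivable_mxP => i j; rewrite ord1; case: (dFt j).
have dF' : differentiable F t by apply/derivable1_diffP.
have E : 'D_1 F t = dF.
  rewrite derive_mx //; apply/rowP => j; rewrite mxE; by case: (dFt j).
have d := differentiable_comp dF' df.
split; first exact/derivable1_diffP.
rewrite deriveE // diff_comp //= -deriveE // -deriveE // E.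
by rewrite diff_derE //; apply: eq_bigr => a _; rewrite mulrC.
Qed.


Lemma near_open O u : open O -> O u -> \forall v \near u, O v.
Proof. by move=> Oo Ou; apply: open_nbhs_nbhs; split. Qed.

Lemma near_open_imp O u (P : V -> Prop) : open O -> O u ->
  (forall x, O x -> P x) -> \forall x \near u, P x.
Proof. move=> Oo Ou H; exact (filterS H (near_open Oo Ou)). Qed.

Lemma has_der_eq f h O u v l : open O -> O u -> (forall x, O x -> f x = h x) ->
  has_der f u v l -> has_der h u v l.
Proof.
move=> Oo Ou fh; apply: has_der_near; exact (filterS fh (near_open Oo Ou)).
Qed.

Lemma derive_eq f h O u v : open O -> O u -> (forall x, O x -> f x = h x) ->
  'D_v f u = 'D_v h u.
Proof.
move=> Oo Ou fh; apply: near_eq_derive; exact (filterS fh (near_open Oo Ou)).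
Qed.

Lemma der_eq f h O u a : open O -> O u -> (forall x, O x -> f x = h x) ->
  der a f u = der a h u.
Proof. exact: derive_eq. Qed.

Lemma has_der_derE f u a l : has_der f u (e_ a) l -> der a f u = l.
Proof. by case. Qed.

Lemma Ck_eq k O f h : open O -> (forall u, O u -> f u = h u) ->
  Ck k O f -> Ck k O h.
Proof.
move=> Oo; elim: k f h => [|k IH] f h fh /=.
  move=> fc u uO; have Ou : O u by rewrite inE in uO.
  move: (fc u uO); rewrite /continuous_at -(fh u Ou); apply: cvg_trans.
  exact (@near_eq_cvg _ _ (nbhs u) (nbhs_filter u) _ _ (near_open_imp Oo Ou fh)).
move=> H a; have [H1 H2] := H a; split.
  move=> u Ou; have := H1 u Ou => /derivable_has_der Hd.
  by case: (has_der_eq Oo Ou fh Hd).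
by apply: IH H2 => u Ou; exact: (derive_eq _ Oo).
Qed.

Lemma Ck_sub k O O' f : O' `<=` O -> Ck k O f -> Ck k O' f.
Proof.
move=> OO; elim: k f => [|k IH] f /=.
  by move=> fc u; rewrite inE => /OO Ou; apply: fc; rewrite inE.
by move=> H a; have [H1 H2] := H a; split; [move=> u /OO; exact: H1|exact: IH].
Qed.

Lemma Ck_local k O f :
  (forall u, O u -> exists O', [/\ open O', O' u & Ck k O' f]) -> Ck k O f.
Proof.
elim: k f => [|k IH] f /= H.
  move=> u; rewrite inE => /H[W [_ Wu HW]].
  by apply: HW; rewrite inE.
move=> a; split=> [u /H[W [_ Wu HW]]|]; first by have [H1 _] := HW a; exact: H1.
by apply: IH => u /H[W [Wo Wu HW]]; exists W; have [_ ?] := HW a.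
Qed.

Lemma C1_diff O f u : open O -> O u -> Ck 1 O f -> differentiable f u.
Proof.
move=> Oo Ou H; apply: C1_differentiable.
  apply: (near_open_imp Oo Ou) => v Ov a; by have [H1 _] := H a; exact: H1.
by move=> a; have [_ H2] := H a; apply: H2; rewrite inE.
Qed.

(** [Ck] asks for continuity of the derivatives of top order only; in lower orders continuity comes
    from differentiability. *)
Lemma Ck_pred k O f : open O -> Ck k.+1 O f -> Ck k O f.
Proof.
move=> Oo; elim: k f => [|k IH] f.
  move=> H u; rewrite inE => Ou; apply: differentiable_continuous.
  exact: (C1_diff Oo).
by move=> H a; have [H1 H2] := H a; split => //; exact: IH.
Qed.

Lemma Ck_le k m O f : open O -> (k <= m)%N -> Ck m O f -> Ck k O f.
Proof.
move=> Oo /subnK <-; elim: (m - k)%N => // d IH; rewrite addSn => /(Ck_pred Oo).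
exact: IH.
Qed.

Lemma Ck_diff k O f u : open O -> O u -> Ck k.+1 O f -> differentiable f u.
Proof. by move=> Oo Ou /(Ck_le (k := 1) Oo (ltn0Sn k)); exact: C1_diff. Qed.

Lemma Ck0_cont k O f u : open O -> O u -> Ck k O f -> f @ u --> f u.
Proof. by move=> Oo Ou /(Ck_le Oo (leq0n k)) H; apply: H; rewrite inE. Qed.

(** Closure properties of [Ck] are obtained by induction through this criterion, with the
    derivatives given by explicit formulas. *)
Lemma CkS k O f (df : 'I_n.+1 -> V -> R) : open O ->
  (forall a u, O u -> has_der f u (e_ a) (df a u)) ->
  (forall a, Ck k O (df a)) -> Ck k.+1 O f.
Proof.
move=> Oo H Hk a; split=> [u /(H a)[]//|].
by apply: Ck_eq (Hk a) => // u /(H a)[_ ->].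
Qed.

Lemma Ck_has_der k O f a u : O u -> Ck k.+1 O f -> has_der f u (e_ a) (der a f u).
Proof. by move=> Ou /(_ a)[H _]; split=> //; exact: H. Qed.

Lemma Ck_der k O f a : Ck k.+1 O f -> Ck k O (der a f).
Proof. by move=> /(_ a)[]. Qed.

Lemma Ck_cst k O (c : R) : open O -> Ck k O (fun=> c).
Proof.
move=> Oo; elim: k c => [|k IH] c; first by move=> u _; exact: cst_continuous.
by apply: (CkS (df := fun _ _ => 0)) => // a u _; exact: has_der_cst.
Qed.

Lemma CkD k O f h : open O -> Ck k O f -> Ck k O h -> Ck k O (fun u => f u + h u).
Proof.
move=> Oo; elim: k f h => [|k IH] f h Hf Hh.
  by move=> u uO; exact: (@cvgD _ _ _ (nbhs u) _ f h _ _ (Hf u uO) (Hh u uO)).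
apply: (CkS (df := fun a u => der a f u + der a h u)) => // [a u Ou|a].
  by apply: has_derD; [exact: (Ck_has_der _ Ou Hf)|exact: (Ck_has_der _ Ou Hh)].
by apply: IH; exact: Ck_der.
Qed.

Lemma CkM k O f h : open O -> Ck k O f -> Ck k O h -> Ck k O (fun u => f u * h u).
Proof.
move=> Oo; elim: k f h => [|k IH] f h Hf Hh.
  by move=> u uO; exact: (@cvgM _ _ (nbhs u) _ f h _ _ (Hf u uO) (Hh u uO)).
apply: (CkS (df := fun a u => der a f u * h u + f u * der a h u)) => // [a u Ou|a].
  by apply: has_derM; [exact: (Ck_has_der _ Ou Hf)|exact: (Ck_has_der _ Ou Hh)].
by apply: CkD => //; apply: IH; by [exact: Ck_der|exact: Ck_pred].
Qed.

Lemma CkN k O f : open O -> Ck k O f -> Ck k O (fun u => - f u).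
Proof.
move=> Oo Hf; apply: (@Ck_eq k O (fun u => -1 * f u)) => //.
  by move=> u _; rewrite mulN1r.
by apply: CkM => //; exact: Ck_cst.
Qed.

Lemma Ck_sum k O (I : Type) (r : seq I) (f : I -> V -> R) : open O ->
  (forall i, Ck k O (f i)) -> Ck k O (fun u => \sum_(i <- r) f i u).
Proof.
move=> Oo Hf; elim: r => [|i r IH].
  by under eq_fun do rewrite big_nil; exact: Ck_cst.
by under eq_fun do rewrite big_cons; exact: CkD.
Qed.

Lemma has_der_coord (a : 'I_n.+1) u v : has_der (fun w : V => w 0 a) u v (v 0 a).
Proof.
apply/has_der_line0.
have -> : (fun t : R => (u + t *: v) 0 a) = (fun t => u 0 a + v 0 a * t).
  by apply/funext => t; rewrite !mxE mulrC.
rewrite -[X in has_der _ _ _ X](_ : 0 + (0 * (0 : R) + v 0 a * 1) = _); last first.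
  by rewrite mul0r mulr1 !add0r.
apply: has_derD; first exact: has_der_cst.
by apply: has_derM; [exact: has_der_cst|apply/has_der_is_derive; exact: is_derive_id].
Qed.

Lemma Ck_coord k O (a : 'I_n.+1) : open O -> Ck k O (fun u : V => u 0 a).
Proof.
move=> Oo; case: k => [|k]; first by move=> u _; exact: coord_continuous.
apply: (CkS (df := fun b _ => (e_ b : V) 0 a)) => // [b u _|b]; last exact: Ck_cst.
exact: has_der_coord.
Qed.

Lemma has_der_compV f (F : V -> V) u v (dF : V) :
  differentiable f (F u) -> (forall a, has_der (fun w => F w 0 a) u v (dF 0 a)) ->
  has_der (fun w => f (F w)) u v (\sum_a der a f (F u) * dF 0 a).
Proof.
move=> df dF'; apply/has_der_line0.
have -> : F u = F (u + (0 : R) *: v) by rewrite scale0r addr0.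
apply: (chain_rule (F := fun s : R => F (u + s *: v))).
  by rewrite scale0r addr0.
by move=> a; exact: (has_der_line0 (fun w : V => F w 0 a) u v (dF 0 a)).1 (dF' a).
Qed.

Lemma Ck_comp k O O' f (F : V -> V) : open O -> open O' ->
  (forall a, Cinfty O (fun u => F u 0 a)) -> (forall u, O u -> O' (F u)) ->
  Ck k O' f -> Ck k O (fun u => f (F u)).
Proof.
move=> Oo O'o HF FO; elim: k f => [|k IH] f Hf.
  move=> u; rewrite inE => Ou.
  have FF : F @ u --> F u.
    apply: (cvg_mxP (nbhs_filter u) F (F u)).2 => i a; rewrite ord1.
    exact: (Ck0_cont Oo Ou (HF a 0%N)).
  apply: (cvg_comp F f FF).
  by apply: Hf; rewrite inE; exact: FO.
apply: (CkS (df := fun a u => \sum_b der b f (F u) * der a (fun u => F u 0 b) u)) => //.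
  move=> a u Ou.
  have [||D E] := has_der_compV (f := f) (F := F) (u := u) (v := e_ a)
     (dF := \row_b der a (fun u => F u 0 b) u).
  - by apply: (Ck_diff O'o _ Hf); exact: FO.
  - by move=> b; rewrite mxE; apply: (Ck_has_der _ Ou (HF b 1%N)).
  - by split=> //; rewrite E; apply: eq_bigr => b _; rewrite mxE.
move=> a; apply: Ck_sum => // b; apply: CkM => //.
  by apply: (IH (der b f)); exact: Ck_der.
exact: (Ck_der _ (HF b k.+1)).
Qed.

Lemma Cinfty_der O f a : Cinfty O f -> Cinfty O (der a f).
Proof. by move=> H k; exact: (Ck_der _ (H k.+1)). Qed.

Lemma Cinfty_has_der O f a u : Cinfty O f -> O u -> has_der f u (e_ a) (der a f u).
Proof. by move=> H Ou; exact: (Ck_has_der _ Ou (H 1%N)). Qed.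

Lemma Cinfty_diff O f u : open O -> O u -> Cinfty O f -> differentiable f u.
Proof. by move=> Oo Ou H; exact: (Ck_diff Oo Ou (H 1%N)). Qed.

Lemma Cinfty_cont O f u : open O -> O u -> Cinfty O f -> f @ u --> f u.
Proof. by move=> Oo Ou H; exact: (Ck0_cont Oo Ou (H 0%N)). Qed.

Lemma Cinfty_eq O f h : open O -> (forall u, O u -> f u = h u) ->
  Cinfty O f -> Cinfty O h.
Proof. by move=> Oo fh H k; exact: Ck_eq (H k). Qed.

Lemma Cinfty_sub O O' f : O' `<=` O -> Cinfty O f -> Cinfty O' f.
Proof. by move=> OO H k; exact: Ck_sub (H k). Qed.

Lemma Cinfty_cst O (c : R) : open O -> Cinfty O (fun=> c).
Proof. by move=> Oo k; exact: Ck_cst. Qed.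

Lemma CinftyD O f h : open O -> Cinfty O f -> Cinfty O h -> Cinfty O (fun u => f u + h u).
Proof. by move=> Oo Hf Hh k; exact: CkD. Qed.

Lemma CinftyB O f h : open O -> Cinfty O f -> Cinfty O h -> Cinfty O (fun u => f u - h u).
Proof. by move=> Oo Hf Hh k; apply: CkD => //; exact: CkN. Qed.

Lemma CinftyM O f h : open O -> Cinfty O f -> Cinfty O h -> Cinfty O (fun u => f u * h u).
Proof. by move=> Oo Hf Hh k; exact: CkM. Qed.

Lemma Cinfty_sum O (I : Type) (r : seq I) (f : I -> V -> R) : open O ->
  (forall i, Cinfty O (f i)) -> Cinfty O (fun u => \sum_(i <- r) f i u).
Proof. by move=> Oo Hf k; apply: Ck_sum => // i; exact: Hf. Qed.

Lemma Cinfty_prod O (I : Type) (r : seq I) (f : I -> V -> R) : open O ->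
  (forall i, Cinfty O (f i)) -> Cinfty O (fun u => \prod_(i <- r) f i u).
Proof.
move=> Oo Hf; elim: r => [|i r IH].
  by under eq_fun do rewrite big_nil; exact: Cinfty_cst.
by under eq_fun do rewrite big_cons; exact: CinftyM.
Qed.

Lemma Cinfty_coord O (a : 'I_n.+1) : open O -> Cinfty O (fun u : V => u 0 a).
Proof. by move=> Oo k; exact: Ck_coord. Qed.

Lemma Cinfty_comp O O' f (F : V -> V) : open O -> open O' ->
  (forall a, Cinfty O (fun u => F u 0 a)) -> (forall u, O u -> O' (F u)) ->
  Cinfty O' f -> Cinfty O (fun u => f (F u)).
Proof. by move=> Oo O'o HF FO Hf k; apply: Ck_comp (Hf k). Qed.

Lemma der_comp O O' f (F : V -> V) a u : open O -> open O' ->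
  (forall b, Cinfty O (fun u => F u 0 b)) -> O u -> O' (F u) ->
  Cinfty O' f ->
  der a (fun u => f (F u)) u = \sum_b der b f (F u) * der a (fun u => F u 0 b) u.
Proof.
move=> Oo O'o HF Ou O'u Hf.
rewrite /der; have [||_ ->] := has_der_compV (f := f) (F := F) (u := u) (v := e_ a)
   (dF := \row_b der a (fun u => F u 0 b) u).
- exact: Cinfty_diff Hf.
- by move=> b; rewrite mxE; apply: (Ck_has_der _ Ou (HF b 1%N)).
- by apply: eq_bigr => b _; rewrite mxE.
Qed.

Lemma Cinfty_inv O f : open O -> (forall u, O u -> f u != 0) ->
  Cinfty O f -> Cinfty O (fun u => (f u)^-1).
Proof.
move=> Oo f0 Hf; elim=> [|k IH].
  move=> u; rewrite inE => Ou.
  exact: (@cvgV _ _ (nbhs u) _ f _ (f0 u Ou) (Cinfty_cont Oo Ou Hf)).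
apply: (CkS (df := fun a u => - ((f u)^-1 * (f u)^-1) * der a f u)) => // [a u Ou|a].
  by apply: has_derV; [exact: f0|exact: (Cinfty_has_der _ Hf Ou)].
apply: CkM => //; last exact: Cinfty_der.
by apply: CkN => //; exact: CkM.
Qed.

(** The derivative is a smooth factor times the same power, so the induction on the order keeps the
    exponent [p] fixed. *)
Lemma Cinfty_powR O f (p : R) : open O -> (forall u, O u -> 0 < f u) ->
  Cinfty O f -> Cinfty O (fun u => f u `^ p).
Proof.
move=> Oo f0 Hf.
have H a u : O u ->
    has_der (fun u => f u `^ p) u (e_ a) (p * (f u)^-1 * der a f u * (f u `^ p)).
  move=> Ou; have := has_der_comp1 (f := fun x => x `^ p) (h := f) (u := u)
    (v := e_ a) (l := p * f u `^ (p - 1)) (k := der a f u).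
  have fu := f0 u Ou; have fu0 : f u != 0 by rewrite gt_eqF.
  have -> : p * f u `^ (p - 1) * der a f u = p * (f u)^-1 * der a f u * (f u `^ p).
    by rewrite powRB ?fu0 ?implybT // powRr1 ?ltW //; ring.
  apply; last exact: (Cinfty_has_der _ Hf Ou).
  by apply/has_der_is_derive; exact: is_derive1_powR.
have w a : Cinfty O (fun u => p * (f u)^-1 * der a f u).
  apply: CinftyM => //; last exact: Cinfty_der.
  apply: CinftyM => //; first exact: Cinfty_cst.
  by apply: Cinfty_inv => // u /f0 /gt_eqF ->.
elim=> [|k IH].
  move=> u; rewrite inE => Ou.
  have C : {for f u, continuous (fun x : R => x `^ p)}.
    apply/differentiable_continuous/derivable1_diffP.
    by case: (is_derive1_powR p (f0 u Ou)).
  exact: (cvg_comp f (fun x => x `^ p) (Cinfty_cont Oo Ou Hf) C).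
by apply: (CkS _ (H)) => // a; apply: CkM => //; exact: w.
Qed.

Lemma has_der_shift f u v w l : has_der f (u + w) v l ->
  has_der (fun x => f (x + w)) u v l.
Proof.
move=> /has_der_line0 H; apply/has_der_line0.
have -> : (fun t : R => f (u + t *: v + w)) = (fun t : R => f (u + w + t *: v)) => //.
by apply/funext => t; rewrite addrAC.
Qed.

Lemma subrrACA (x y z w : R) : x - y - (z - w) = x - z - (y - w).
Proof. ring. Qed.

(** The second difference of [f] over a small square is symmetric in the two directions; two
    applications of the mean value theorem make it t^2 times either mixed derivative at a point near
    [u]. *)
Lemma schwarz O f a b u : open O -> O u -> Ck 2 O f ->
  der a (der b f) u = der b (der a f) u.
Proof.
move=> Oo Ou H.
have [r0 r0_gt0 Hr0] := (near_ballP _ _).1 (near_open Oo Ou).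
have ball2 (c d : 'I_n.+1) (t r s s' : R) : 0 < t -> 0 < r -> t < r / 2 ->
    0 <= s <= 1 -> 0 <= s' <= 1 ->
    `|u + (s * t) *: e_ c + (s' * t) *: e_ d - u| < r.
  move=> t0 r_gt0 tr /andP[s0 s1] /andP[s'0 s'1].
  rewrite -(addrA u) [_ - u]addrC addKr; apply: le_lt_trans (ler_normD _ _) _.
  have B (x : R) (q : 'I_n.+1) : 0 <= x <= 1 -> `|(x * t) *: (e_ q : V)| <= t.
    move=> /andP[x0 x1]; rewrite normrZ normrM (ger0_norm x0) (gtr0_norm t0).
    rewrite -[leRHS]mulr1; apply: ler_pM => //; first by rewrite mulr_ge0 // ltW.
      by rewrite ler_piMl // ltW.
    exact: norm_unit_vec.
  have := B s c; have := B s' d; rewrite s0 s1 s'0 s'1 => /(_ isT) ? /(_ isT) ?.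
  lra.
have key (c d : 'I_n.+1) (t : R) : 0 < t -> t < r0 / 2 -> exists s s' : R,
    [/\ 0 <= s <= 1, 0 <= s' <= 1 &
     f (u + t *: e_ c + t *: e_ d) - f (u + t *: e_ c) - (f (u + t *: e_ d) - f u) =
     t * t * der d (der c f) (u + (s * t) *: e_ c + (s' * t) *: e_ d)].
  move=> t0 tr.
  have [|s s01 E] := MVT_line (f := fun v => f (v + t *: e_ d) - f v)
      (df := fun v => der c f (v + t *: e_ d) - der c f v) (u := u) (v := e_ c) (t := t).
    move=> s s01; apply: has_derB.
      apply: has_der_shift; apply: (Ck_has_der _ _ H); apply: Hr0.
      have := ball2 c d t r0 s 1 t0 r0_gt0 tr s01.
      by rewrite mul1r; apply; rewrite ler01 lexx.
    apply: (Ck_has_der _ _ H); apply: Hr0.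
    have := ball2 c d t r0 s 0 t0 r0_gt0 tr s01.
    by rewrite mul0r scale0r addr0; apply; rewrite ler01 lexx.
  have [|s' s'01 E'] := MVT_line (f := der c f) (df := der d (der c f))
      (u := u + (s * t) *: e_ c) (v := e_ d) (t := t).
    move=> s' s'01; apply: (Ck_has_der (k := 0%N)) (Ck_der _ H).
    by apply: Hr0; exact: ball2.
  exists s, s'; split=> //.
  by rewrite -mulrA -E' -E.
have C2 (c d : 'I_n.+1) : der d (der c f) @ u --> der d (der c f) u.
  by apply: (Ck0_cont (k := 0%N) Oo Ou); do 2 apply: Ck_der.
apply/eqP; rewrite -subr_eq0 -normr_le0; apply/ler_addgt0Pr => e e0; rewrite add0r.
have e2 : 0 < e / 2 by lra.
have /cvgrPdist_le/(_ _ e2) N1 := C2 b a.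
have /cvgrPdist_le/(_ _ e2) N2 := C2 a b.
have [r r_gt0 Hr] := (near_ballP _ _).1 (filterI N1 N2).
pose t := Num.min r r0 / 4.
have m0 : 0 < Num.min r r0 by rewrite lt_min r_gt0.
have mr : Num.min r r0 <= r by rewrite ge_min lexx.
have mr0 : Num.min r r0 <= r0 by rewrite ge_min lexx orbT.
have t0 : 0 < t by rewrite /t; lra.
have tr : t < r / 2 by rewrite /t; lra.
have tr0 : t < r0 / 2 by rewrite /t; lra.
have [s1 [s2 [h1 h2 E1]]] := key b a t t0 tr0.
have [s3 [s4 [h3 h4 E2]]] := key a b t t0 tr0.
have E : der a (der b f) (u + (s1 * t) *: e_ b + (s2 * t) *: e_ a) =
         der b (der a f) (u + (s3 * t) *: e_ a + (s4 * t) *: e_ b).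
  have tt : t * t != 0 by rewrite mulf_neq0 // gt_eqF.
  move: E1; rewrite (addrAC u) subrrACA E2 => E1.
  exact: (mulfI tt (esym E1)).
have [A1 _] := Hr _ (ball2 b a t r s1 s2 t0 r_gt0 tr h1 h2).
have [_ A2] := Hr _ (ball2 a b t r s3 s4 t0 r_gt0 tr h3 h4).
rewrite -E in A2; rewrite distrC in A2.
apply: le_trans (ler_distD (der a (der b f) (u + (s1 * t) *: e_ b + (s2 * t) *: e_ a)) _ _) _.
by rewrite (splitr e); exact: lerD A1 A2.
Qed.

Lemma smooth_on_open O f : open O -> smooth_on O f -> Cinfty O f.
Proof.
move=> Oo H k; apply: Ck_local => u Ou.
have [W [h [Wo Wu Hh fh]]] := H u Ou.
exists (W `&` O); split; [exact: openI|by []|].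
apply: (@Ck_eq k _ h); first exact: openI.
  by move=> v [Wv Ov]; rewrite fh.
by apply: Ck_sub (Hh k) => v [].
Qed.

Lemma Cinfty_smooth_on O A f : open O -> A `<=` O -> Cinfty O f -> smooth_on A f.
Proof. by move=> Oo AO Hf u Au; exists O, f; split=> //; exact: AO. Qed.

Lemma cvg_line_right u v : (fun t : R => u + t *: v) @ 0^'+ --> u.
Proof.
rewrite -[X in _ --> X](addr0 u) -(scale0r v).
apply: cvgD; first exact: cvg_cst.
by apply: cvgZr_tmp; apply: cvg_at_right_filter; exact: cvg_id.
Qed.

(** For t > 0 the point u + t e_a stays in the half space, where [f] and [h] agree, and the
    two-sided limit for [h] restricts to a one-sided one. *)
Lemma pd_der O f h a u : open O -> O u -> half_space u ->
  derivable h u (e_ a) -> (forall v, O v -> half_space v -> f v = h v) ->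
  pd a f u = der a h u.
Proof.
move=> Oo Ou uH dh fh; rewrite /pd /derive; apply: cvg_lim => //.
have H : (fun t : R => t^-1 *: ((h \o shift u) (t *: e_ a) - h u)) @ 0^'+ -->
    lim ((fun t : R => t^-1 *: ((h \o shift u) (t *: e_ a) - h u)) @ 0^').
  exact: (cvg_dnbhs_at_right dh).
have N : \forall t \near 0^'+, O (u + t *: e_ a) := @cvg_line_right u (e_ a) _ (near_open Oo Ou).
apply: cvg_trans H; apply: near_eq_cvg; near=> t.
have t0 : 0 < t by near: t; exact: nbhs_right_gt.
have Ht : half_space (u + t *: e_ a).
  rewrite /half_space /= !mxE; apply: addr_ge0 => //; apply: mulr_ge0; first exact: ltW.
  by case: (_ && _).
have Ot : O (u + t *: e_ a).
  by near: t; exact: N.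
by rewrite /= (fh _ Ou uH) (fh _ Ot Ht) [_ + u]addrC.
Unshelve. all: by end_near. Qed.

End Smooth.

(** * Linear ordinary differential equations with smooth parameters *)

Section LinearODE1.
Variable R : realType.
Implicit Types (f g : R -> R) (s t x y : R).

Lemma mvt_bound f (df : R -> R) x y (K : R) :
  (forall s, x <= s <= y \/ y <= s <= x -> has_der f s 1 (df s) /\ `|df s| <= K) ->
  `|f y - f x| <= K * `|y - x|.
Proof.
wlog xy : x y / x <= y => [W H|H].
  have [xy|/ltW yx] := leP x y; first exact: W.
  rewrite distrC [X in _ * X]distrC; apply: W => // s [?|?]; apply: H; by [right|left].
have [|||c + ->] := @MVT_segment _ f df x y.
- exact: xy.
- move=> s; rewrite in_itv /= => /andP[xs sy]; apply/has_der_is_derive.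
  by case: (H s) => //; left; rewrite !ltW.
- apply: derivable_within_continuous => s; rewrite in_itv /= => xsy.
  by case: (H s) => [|[]//]; left.
by rewrite in_itv /= => xcy; rewrite normrM ler_wpM2r //; case: (H c) => //; left.
Qed.

Lemma primitive_on f (e d : R) : 0 < d -> continuous f ->
  exists2 g, g e = 0 & forall s, `|s - e| <= d -> has_der g s 1 (f s).
Proof.
move=> d0 fc.
(* The integral starts strictly below e - d, so that every point of the closed interval is interior
   and the fundamental theorem gives two-sided derivatives there. *)
pose a := e - d - 1; pose F x := \int[lebesgue_measure]_(t in `[a, x]) f t.
exists (fun x => F x - F e); first by rewrite subrr.
move=> x; rewrite ler_norml => /andP[h1 h2].
have xu : x < e + d + 1 by lra.
have ax : a < x by rewrite /a; lra.
have fi : lebesgue_measure.-integrable `[a, e + d + 1] (EFin \o f).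
  apply: continuous_compact_integrable; first exact: segment_compact.
  by apply: continuous_subspaceT => z; exact: fc.
have [D1 D2] := continuous_FTC1_closed xu fi ax (fc x).
rewrite -[f x]subr0; apply: has_derB; last exact: has_der_cst.
split; [exact: D1|by rewrite -derive1E].
Qed.

(** The retraction of the line onto [e - d, e + d]. Composing with it turns data controlled on the
    interval only into globally continuous and bounded data. *)
Definition clamp (e d x : R) := Num.max (e - d) (Num.min (e + d) x).

Lemma clamp_continuous e d : continuous (clamp e d).
Proof.
move=> x; apply: (@continuous_max _ _ (fun=> e - d) (fun x => Num.min (e + d) x)).
  exact: cvg_cst.
by apply: (@continuous_min _ _ (fun=> e + d) id); [exact: cvg_cst|exact: cvg_id].
Qed.

Lemma clamp_in e d x : 0 <= d -> `|clamp e d x - e| <= d.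
Proof.
move=> d0; have : e - d <= clamp e d x <= e + d.
  by rewrite /clamp le_max lexx /= ge_max ge_min lexx /= andbT; lra.
by move: (clamp _ _ _) => w /andP[h1 h2]; rewrite ler_norml; apply/andP; split; lra.
Qed.

Lemma clamp_id e d x : `|x - e| <= d -> clamp e d x = x.
Proof.
rewrite ler_norml => /andP[h1 h2]; rewrite /clamp min_r; last by lra.
by rewrite max_r //; lra.
Qed.

Lemma geometric_limit (z : nat -> R) (C : R) : 0 <= C ->
  (forall k, `|z k.+1 - z k| <= C * 2^-1 ^+ k) ->
  exists l, forall k, `|l - z k| <= 2 * C * 2^-1 ^+ k.
Proof.
move=> C0 H.
(* The factor 1 - 2^-m is the exact partial sum of the geometric series; a plain bound would not
   survive the induction. *)
have H2 k m : `|z (k + m)%N - z k| <= 2 * C * 2^-1 ^+ k * (1 - 2^-1 ^+ m).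
  elim: m => [|m IH]; first by rewrite addn0 subrr normr0 expr0 subrr mulr0.
  rewrite addnS -(subrKA (z (k + m)%N)).
  apply: le_trans (ler_normD _ _) _.
  apply: le_trans (lerD (H _) IH) _.
  rewrite exprD exprS; move: (2^-1 ^+ k) (2^-1 ^+ m) => X Y; lra.
have H3 k m : (k <= m)%N -> `|z m - z k| <= 2 * C * 2^-1 ^+ k.
  move=> km; rewrite -(subnKC km); apply: le_trans (H2 _ _) _.
  apply: ler_piMr; last by rewrite gerBl exprn_ge0.
  by rewrite !mulr_ge0 // exprn_ge0.
have half0 : (fun k => 2 * C * 2^-1 ^+ k) @ \oo --> (0 : R).
  rewrite -(mulr0 (2 * C)); apply: (@cvgM _ _ _ _ (fun=> 2 * C)); first exact: cvg_cst.
  apply: cvg_expr; by rewrite ger0_norm // invf_lt1 // ltr1n.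
have zc : cvg (z @ \oo).
  apply/cauchy_cvgP/cauchy_exP => e e0.
  have /cvgrPdist_lt/(_ _ e0) [k _ Hk] := half0.
  exists (z k); exists k => // m /= km; rewrite /ball /= distrC.
  apply: le_lt_trans (H3 _ _ km) _.
  by have := Hk k (leqnn k); rewrite /= sub0r normrN; apply: le_lt_trans; exact: ler_norm.
exists (lim (z @ \oo)) => k.
have L : (fun m => `|z m - z k|) @ \oo --> `|lim (z @ \oo) - z k|.
  by apply: cvg_norm; apply: cvgB => //; exact: cvg_cst.
rewrite -(cvg_lim _ L) //; apply: limr_le; first exact: cvgP L.
by exists k => // m /= km; exact: H3.
Qed.

Lemma le_thirds (r : R) : r / 3 + r / 3 + r / 3 <= r.
Proof. lra. Qed.

Lemma half_double_le (w r : R) : 0 < r -> w <= r / 2 -> 2^-1 * w + w * 2^-1 <= r.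
Proof. lra. Qed.

Section System.
Variables (p : nat) (M d : R).
Hypotheses (M0 : 0 <= M) (d0 : 0 < d) (pMd : p%:R * M * d <= 2^-1).
Implicit Types (A : 'I_p -> 'I_p -> R -> R) (h z : 'I_p -> R -> R).

Lemma sum_mul_le A (y : 'I_p -> R) (s K : R) i : 0 <= K ->
  (forall i j, `|A i j s| <= M) -> (forall j, `|y j| <= K) ->
  `|\sum_j A i j s * y j| <= p%:R * M * K.
Proof.
move=> K0 AM yK; apply: le_trans (ler_norm_sum _ _ _) _.
have -> : p%:R * M * K = \sum_(j < p) M * K.
  by rewrite sumr_const card_ord -[RHS]mulr_natl mulrA.
by apply: ler_sum => j _; rewrite normrM ler_pM.
Qed.

(* The bound on [p * M * d] turns the integral equation into a contraction. *)
Lemma linear_ode_stable A h z (e a b eta eta0 : R) :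
  b - a <= d -> a < e < b -> 0 <= eta -> 0 <= eta0 ->
  (forall s, a < s < b -> forall i j, `|A i j s| <= M) ->
  (forall s, a < s < b -> forall i, `|h i s| <= eta) ->
  (forall s, a < s < b -> forall i,
     has_der (z i) s 1 (\sum_j A i j s * z j s + h i s)) ->
  (forall i, `|z i e| <= eta0) ->
  forall s, a < s < b -> forall i, `|z i s| <= 2 * (eta0 + d * eta).
Proof.
move=> bad /andP[ae eb] eta_ge0 eta0_ge0 AM heta zD ze s /andP[as_ sb] i.
pose l := Num.min e s; pose u := Num.max e s.
have lI : a < l by rewrite lt_min ae as_.
have uI : u < b by rewrite gt_max eb sb.
have lu : l <= u by rewrite ge_min le_max lexx.
have eI : l <= e <= u by rewrite ge_min le_max lexx.
have sI : l <= s <= u by rewrite ge_min le_max lexx !orbT.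
have inab t : l <= t <= u -> a < t < b.
  by move=> /andP[lt tu]; rewrite (lt_le_trans lI lt) (le_lt_trans tu uI).
have zc j : {within `[l, u], continuous (fun t => `|z j t|)}.
  have : {within `[l, u], continuous (z j)}.
    apply: derivable_within_continuous => t; rewrite in_itv /= => /inab tI.
    by case: (zD t tI j).
  by move=> C t; apply: cvg_norm; exact: C.
have {}zc j : exists2 c, l <= c <= u & forall t, l <= t <= u -> `|z j t| <= `|z j c|.
  have [c cI cM] := EVT_max lu (zc j); exists c; first by rewrite in_itv in cI.
  by move=> t tI; apply: cM; rewrite in_itv.
pose c j := sval (cid2 (zc j)).
have cI j : l <= c j <= u by rewrite /c; case: cid2.
have cM j t : l <= t <= u -> `|z j t| <= `|z j (c j)| by rewrite /c; case: cid2 => /= ? ?; apply.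
have [k _ kM] := @arg_maxP _ _ _ i predT (fun j => `|z j (c j)|) isT.
set K := `|z k (c k)| in kM *.
have zK j t : l <= t <= u -> `|z j t| <= K.
  by move=> tI; apply: le_trans (cM j t tI) _; exact: kM.
suff KK : K <= 2 * (eta0 + d * eta) by apply: le_trans KK; exact: zK.
have K0 : 0 <= K by exact: normr_ge0.
have Kd : `|z k (c k) - z k e| <= (p%:R * M * K + eta) * `|c k - e|.
  apply: (mvt_bound (df := fun t => \sum_j A k j t * z j t + h k t)) => t tI.
  have {}tI : l <= t <= u.
    have /andP[? ?] := cI k; have /andP[? ?] := eI.
    case: tI => /andP[t1 t2]; apply/andP; split; by [apply: le_trans t1|apply: le_trans t2 _].
  split; first by apply: zD; exact: inab.
  apply: le_trans (ler_normD _ _) _; apply: lerD; last by apply: heta; exact: inab.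
  by apply: sum_mul_le => // [|j]; [apply: AM; exact: inab|exact: zK].
have cd : `|c k - e| <= d.
  have /andP[] := inab _ (cI k); have /andP[] := inab _ eI.
  by move: bad; rewrite ler_norml; move: (c k) => w; clear; lra.
have Kd2 : K <= eta0 + (p%:R * M * K + eta) * d.
  have KE : K <= `|z k e| + `|z k (c k) - z k e|.
    by apply: le_trans (ler_normD _ _); rewrite addrC subrK.
  apply: le_trans KE _; apply: lerD; first exact: ze.
  apply: le_trans Kd _; apply: ler_wpM2l => //.
  by rewrite addr_ge0 // !mulr_ge0.
have : p%:R * M * K * d <= 2^-1 * K by rewrite mulrAC ler_wpM2r.
move: Kd2; rewrite mulrDl mulrC [eta * d]mulrC.
by move: (p%:R * M * K * d) (d * eta) => X Y; rewrite [d * _]mulrC; clear; lra.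
Qed.

(** Picard iteration. The primitives are frozen outside [e - d, e + d], so that all estimates are
    uniform on the whole line, and the bound on p M d makes each iteration contract by 1/2. *)
Lemma linear_ode_exists_global A h (e C : R) (b : 'I_p -> R) :
  (forall i j, continuous (A i j)) -> (forall i, continuous (h i)) ->
  (forall i j s, `|A i j s| <= M) -> (forall i s, `|h i s| <= C) ->
  exists z, [/\ forall i, z i e = b i, forall i, continuous (z i) &
   forall i s, `|s - e| < d -> has_der (z i) s 1 (\sum_j A i j s * z j s + h i s)].
Proof.
move=> Ac hc AM hC.
have [P0 | p0] := leqP p 0.
  move: A h b Ac hc AM hC; rewrite leqn0 in P0; move/eqP: P0 => -> A h b *.
  by exists (fun _ _ => 0); split=> -[].
have C0 : 0 <= C by apply: le_trans (normr_ge0 (h (Ordinal p0) 0)) _.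
(* Stated conditionally, so that a primitive can be chosen for every function at once; for a
   discontinuous [f] the choice is arbitrary. *)
have Pex f : exists g, continuous f ->
    g e = 0 /\ forall s, `|s - e| <= d -> has_der g s 1 (f s).
  have [fc|] := pselect (continuous f); last by exists f.
  by have [g g0 Hg] := primitive_on e d0 fc; exists g.
pose P f x := sval (cid (Pex f)) (clamp e d x).
have Pe f : continuous f -> P f e = 0.
  move=> fc; rewrite /P clamp_id; last by rewrite subrr normr0 ltW.
  by case: cid => g /= /(_ fc)[].
have Pc f : continuous f -> continuous (P f).
  move=> fc x; rewrite /P; case: cid => g /= /(_ fc)[_ Hg].
  have gc : {for clamp e d x, continuous g}.
    apply/differentiable_continuous/derivable1_diffP.
    by case: (Hg (clamp e d x)) => //; apply: clamp_in; exact: ltW.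
  exact: (cvg_comp (clamp e d) g (@clamp_continuous e d x) gc).
have PD f s : continuous f -> `|s - e| < d -> has_der (P f) s 1 (f s).
  move=> fc sd; rewrite /P; case: cid => g /= /(_ fc)[_ Hg].
  apply: (@has_der_near _ _ _ g); last by apply: Hg; exact: ltW.
  have : \forall x \near s, `|x - e| < d.
    have nC : (fun x => `|x - e|) @ s --> `|s - e|.
      by apply: cvg_norm; apply: cvgB; [exact: cvg_id|exact: cvg_cst].
    by apply: (nC [set y | y < d]); exact: open_nbhs_nbhs.
  by apply: filterS => x xd; rewrite clamp_id // ltW.
have PB f1 f2 K : continuous f1 -> continuous f2 -> (forall s, `|f1 s - f2 s| <= K) ->
    forall x, `|P f1 x - P f2 x| <= K * d.
  move=> c1 c2 fK x; rewrite /P.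
  case: cid => g1 /= /(_ c1)[g1e Hg1]; case: cid => g2 /= /(_ c2)[g2e Hg2].
  have -> : g1 (clamp e d x) - g2 (clamp e d x) =
      (g1 (clamp e d x) - g2 (clamp e d x)) - (g1 e - g2 e).
    by rewrite g1e g2e !subr0.
  have cx := clamp_in e x (ltW d0).
  have K0 : 0 <= K by apply: le_trans (fK 0).
  apply: le_trans (ler_wpM2l K0 cx).
  apply: (mvt_bound (f := fun x => g1 x - g2 x) (df := fun t => f1 t - f2 t)) => s sI.
  have sd : `|s - e| <= d.
    move: sI cx; move: (clamp e d x) => w sI /ler_normlP[w1 w2].
    by rewrite ler_norml; clear -sI w1 w2; case: sI => /andP[? ?]; apply/andP; split; lra.
  by split=> //; apply: has_derB; [exact: Hg1|exact: Hg2].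
pose rhs (z : 'I_p -> R -> R) i s := \sum_j A i j s * z j s + h i s.
have rc (z : 'I_p -> R -> R) i : (forall j, continuous (z j)) -> continuous (rhs z i).
  move=> zc s; apply: cvgD; last exact: hc.
  by apply: cvg_sumr => j; apply: cvgM; [exact: Ac|exact: zc].
pose T (z : 'I_p -> R -> R) i s := b i + P (rhs z i) s.
have Tc (z : 'I_p -> R -> R) i : (forall j, continuous (z j)) -> continuous (T z i).
  by move=> zc s; apply: cvgD; [exact: cvg_cst|apply: Pc; exact: rc].
have TB (z1 z2 : 'I_p -> R -> R) K : (forall j, continuous (z1 j)) ->
    (forall j, continuous (z2 j)) -> 0 <= K ->
    (forall j s, `|z1 j s - z2 j s| <= K) ->
    forall i s, `|T z1 i s - T z2 i s| <= K * 2^-1.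
  move=> c1 c2 K0 zK i s; rewrite /T opprD addrACA subrr add0r.
  apply: le_trans (PB _ _ (p%:R * M * K) _ _ _ _) _; try exact: rc.
    move=> t; rewrite /rhs opprD addrACA subrr addr0 -sumrB.
    under eq_bigr do rewrite -mulrBr.
    exact: sum_mul_le.
  by rewrite mulrAC [leRHS]mulrC ler_wpM2r.
pose Z k := iter k T (fun i _ => b i).
have Zc k i : continuous (Z k i).
  by elim: k i => [|k IH] i; [move=> s; exact: cvg_cst|exact: Tc].
pose B := \sum_i `|b i|.
have bB i : `|b i| <= B.
  by rewrite /B (bigD1 i) //= lerDl sumr_ge0.
have B0 : 0 <= B by exact: sumr_ge0.
pose D := (p%:R * M * B + C) * d.
have D0 : 0 <= D by rewrite mulr_ge0 ?(ltW d0) // addr_ge0 // !mulr_ge0.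
have step k i s : `|Z k.+1 i s - Z k i s| <= D * 2^-1 ^+ k.
  elim: k i s => [|k IH] i s.
    rewrite expr0 mulr1 /Z /= /T addrAC subrr add0r.
    have P0 x : P (fun=> 0) x = 0.
      have c0 : continuous (fun _ : R => 0 : R) by move=> t; exact: cvg_cst.
      rewrite /P; case: cid => g /= /(_ c0)[ge Hg].
      have := clamp_in e x (ltW d0); move: (clamp e d x) => w /ler_normlP[w1 w2].
      have : `|g w - g e| <= 0 * `|w - e|.
        apply: (mvt_bound (df := fun=> 0)) => t tI; split; last by rewrite normr0.
        by apply: Hg; rewrite ler_norml; clear -tI w1 w2; case: tI => /andP[? ?]; apply/andP; split; lra.
      by rewrite mul0r ge subr0 normr_le0 => /eqP.
    rewrite -[P _ _]subr0 -(P0 s).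
    apply: PB; [by apply: rc => j t; exact: cvg_cst|by move=> t; exact: cvg_cst|].
    move=> t; rewrite subr0; apply: le_trans (ler_normD _ _) _.
    by apply: lerD => //; exact: sum_mul_le.
  have KK : 0 <= D * 2^-1 ^+ k by rewrite mulr_ge0 // exprn_ge0.
  rewrite exprSr mulrA; exact: (TB (Z k.+1) (Z k) _ (Zc k.+1) (Zc k) KK IH i s).
have lim_ex i s : exists l, forall k, `|l - Z k i s| <= 2 * D * 2^-1 ^+ k.
  exact: geometric_limit.
pose z i s := sval (cid (lim_ex i s)).
have zZ i s k : `|z i s - Z k i s| <= 2 * D * 2^-1 ^+ k.
  by rewrite /z; case: cid.
have half0 : (fun k => 2 * D * 2^-1 ^+ k) @ \oo --> (0 : R).
  rewrite -(mulr0 (2 * D)); apply: (@cvgM _ _ _ _ (fun=> 2 * D)); first exact: cvg_cst.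
  by apply: cvg_expr; rewrite ger0_norm // invf_lt1 // ltr1n.
have small (r : R) : 0 < r -> exists k, 2 * D * 2^-1 ^+ k <= r.
  move=> r0; have /cvgrPdist_le/(_ _ r0)[k _ Hk] := half0.
  by exists k; have := Hk k (leqnn k); rewrite /= sub0r normrN; apply: le_trans; exact: ler_norm.
have zc i : continuous (z i).
  move=> s; apply/cvgrPdist_le => r r0.
  have [k Hk] := small (r / 3) ltac:(by rewrite divr_gt0).
  have /cvgrPdist_le/(_ (r / 3)) := @Zc k i s; rewrite divr_gt0 // => /(_ isT).
  apply: filterS => t Ht.
  have h1 := le_trans (zZ i s k) Hk; have h2 := le_trans (zZ i t k) Hk.
  rewrite distrC in h2.
  have -> : z i s - z i t = (z i s - Z k i s) + (Z k i s - Z k i t) + (Z k i t - z i t).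
    by rewrite subrKA subrKA.
  apply: le_trans (ler_normD _ _) _.
  apply: le_trans (lerD (ler_normD _ _) (lexx _)) _.
  exact: le_trans (lerD (lerD h1 Ht) h2) (le_thirds r).
have zT i s : z i s = T z i s.
  apply/eqP; rewrite -subr_eq0 -normr_le0; apply/ler_addgt0Pr => r r0; rewrite add0r.
  have [k Hk] := small (r / 2) ltac:(by rewrite divr_gt0).
  have h1 := zZ i s k.+1.
  have KK : 0 <= 2 * D * 2^-1 ^+ k.
    by apply: mulr_ge0; [exact: mulr_ge0|exact: exprn_ge0].
  have h2 := TB z (Z k) _ zc (Zc k) KK (fun j t => zZ j t k) i s.
  rewrite distrC in h2.
  have -> : z i s - T z i s = (z i s - Z k.+1 i s) + (T (Z k) i s - T z i s) by rewrite subrKA.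
  apply: le_trans (ler_normD _ _) _.
  apply: le_trans (lerD h1 h2) _.
  by rewrite exprS mulrCA; exact: half_double_le.
exists z; split=> // [i|i s sd].
  by rewrite zT /T Pe ?addr0 //; exact: rc.
have -> : z i = T z i by apply/funext.
rewrite -/(rhs z i s) -[rhs z i s]add0r.
by apply: has_derD; [exact: has_der_cst|apply: PD => //; exact: rc].
Qed.

End System.
End LinearODE1.

Lemma continuous_bounded (R : realType) (g : R -> R) (r rho : R) : rho < r ->
  (forall s : R, `|s| < r -> {for s, continuous g}) ->
  exists K, forall s, `|s| < rho -> `|g s| <= K.
Proof.
move=> rr gc; have [rho0|rho0] := ltP 0 rho; last first.
  exists 0 => s sr; have := le_lt_trans (normr_ge0 s) sr.
  by rewrite ltNge rho0.
have C : {within `[- rho, rho], continuous (fun s => `|g s|)}.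
  apply: continuous_in_subspaceT => s; rewrite inE /= in_itv /= -ler_norml => sr.
  exact: (cvg_norm (gc s (le_lt_trans sr rr))).
have [|c _ cM] := EVT_max _ C; first by rewrite ge0_cp // ltW.
by exists `|g c| => s sr; apply: cM; rewrite in_itv /= -ler_norml; exact: ltW.
Qed.

(** * Uniform convergence on an interval along a filter of parameters *)

Section UniformConvergence.
Variables (R : realType) (Lam : Type) (rho : R).
Implicit Types (G H : Lam -> R -> R) (g h : R -> R).

(** The parameter is left abstract because two filters occur: base points v tending to u, and
    increments h tending to 0. *)
Definition unif (F : set_system Lam) G g :=
  forall eta : R, 0 < eta ->
    F [set l | forall s, `|s| < rho -> `|G l s - g s| <= eta].

Context (F : set_system Lam) {FF : Filter F}.

Lemma unif_cst g : unif F (fun=> g) g.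
Proof. by move=> eta e0; apply: nearW => l s _; rewrite subrr normr0 ltW. Qed.

Lemma unifD G H g h : unif F G g -> unif F H h ->
  unif F (fun l s => G l s + H l s) (fun s => g s + h s).
Proof.
move=> Gg Hh eta e0; have e2 : 0 < eta / 2 by rewrite divr_gt0.
apply: filterS2 (Gg _ e2) (Hh _ e2) => l h1 h2 s sr.
rewrite opprD addrACA (splitr eta); apply: le_trans (ler_normD _ _) _.
by apply: lerD; [exact: h1|exact: h2].
Qed.

Lemma unifM G H g h K : (forall s : R, `|s| < rho -> `|g s| <= K) ->
  (forall s : R, `|s| < rho -> `|h s| <= K) -> unif F G g -> unif F H h ->
  unif F (fun l s => G l s * H l s) (fun s => g s * h s).
Proof.
move=> gK hK Gg Hh eta e0.
pose L := `|K| + 1; have L0 : 0 < L by rewrite ltr_wpDl.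
pose d := Num.min 1 (eta / (2 * L)).
have d0 : 0 < d by rewrite lt_min ltr01 divr_gt0 // mulr_gt0.
apply: filterS2 (Gg _ d0) (Hh _ d0) => l h1 h2 s sr.
have {}h1 := h1 s sr; have {}h2 := h2 s sr.
have -> : G l s * H l s - g s * h s =
  G l s * (H l s - h s) + (G l s - g s) * h s by ring.
have gL : `|G l s| <= L.
  rewrite -(subrK (g s) (G l s)) addrC; apply: le_trans (ler_normD _ _) _.
  apply: lerD; first by apply: le_trans (gK s sr) (ler_norm _).
  by apply: le_trans h1 _; rewrite ge_min lexx.
have hL : `|h s| <= L.
  by apply: le_trans (hK s sr) _; apply: le_trans (ler_norm _) _; rewrite lerDl.
apply: le_trans (ler_normD _ _) _; rewrite !normrM.
have dL : L * d <= eta / 2.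
  have : L * d <= L * (eta / (2 * L)) by rewrite ler_wpM2l ?(ltW L0) // ge_min lexx orbT.
  move/le_trans; apply; rewrite le_eqVlt; apply/orP; left; apply/eqP; field.
  by rewrite gt_eqF.
rewrite (splitr eta); apply: lerD; apply: le_trans dL.
  exact: ler_pM.
by rewrite mulrC; exact: ler_pM.
Qed.

Lemma unif_pt G g s : unif F G g -> `|s| < rho -> (fun l => G l s) @ F --> g s.
Proof.
move=> Gg sr; apply/cvgrPdist_le => eta e0; apply: filterS (Gg _ e0) => l Hl.
by rewrite distrC; exact: Hl.
Qed.

Lemma unifM_bounded G H g h :
  (exists K, forall s, `|s| < rho -> `|g s| <= K) ->
  (exists K, forall s, `|s| < rho -> `|h s| <= K) -> unif F G g -> unif F H h ->
  unif F (fun l s => G l s * H l s) (fun s => g s * h s).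
Proof.
move=> [K gK] [K' hK]; apply: (@unifM _ _ _ _ (Num.max K K')) => s sr.
  by rewrite le_max gK.
by rewrite le_max hK ?orbT.
Qed.

Lemma unif_sum (I : Type) (r : seq I) (G : I -> Lam -> R -> R) (g : I -> R -> R) :
  (forall i, unif F (G i) (g i)) ->
  unif F (fun l s => \sum_(i <- r) G i l s) (fun s => \sum_(i <- r) g i s).
Proof.
move=> Gg; elim: r => [|i r IH].
  move=> eta e0; apply: nearW => l s _.
  by rewrite !big_nil subrr normr0 ltW.
move=> eta e0; apply: filterS (unifD (Gg i) IH e0) => l Hl s sr.
by rewrite !big_cons; exact: Hl.
Qed.

End UniformConvergence.

Lemma unif_comp (R : realType) (Lam Lam' : Type) (rho : R) (F : set_system Lam)
    (F' : set_system Lam') (phi : Lam' -> Lam) G g :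
  phi @ F' --> F -> unif rho F G g -> unif rho F' (fun l => G (phi l)) g.
Proof. by move=> pF Gg eta e0; exact: (pF _ (Gg eta e0)). Qed.

(** The functions [z] stand for errors: their initial values tend to 0, and so does, uniformly, the
    forcing term of the linear system that they solve. The stability estimate then applies to each
    parameter separately. *)
Lemma unif_stable (R : realType) (p : nat) (M d rho e : R) (Lam : Type)
    (F : set_system Lam) {FF : Filter F} (A : Lam -> 'I_p -> 'I_p -> R -> R)
    (H z : 'I_p -> Lam -> R -> R) (h : 'I_p -> R -> R) :
  0 <= M -> 0 < d -> p%:R * M * d <= 2^-1 -> 2 * rho <= d -> `|e| < rho ->
  (\forall l \near F, forall s, `|s| < rho -> forall i,
     (forall j, `|A l i j s| <= M) /\
     has_der (z i l) s 1 (\sum_j A l i j s * z j l s + (H i l s - h i s))) ->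
  (forall i, unif rho F (H i) (h i)) ->
  (forall i, (fun l => z i l e) @ F --> (0 : R)) ->
  forall i, unif rho F (z i) (fun=> 0).
Proof.
move=> M0 d0 pMd rd er zD Hh ze i eta e0.
(* Chosen so that the bound 2 (eta' + d eta') of the stability estimate equals eta. *)
pose eta' := eta / (2 * (1 + d)).
have d1 : 0 < 2 * (1 + d) by rewrite mulr_gt0 // addr_gt0.
have e'0 : 0 < eta' by rewrite divr_gt0.
have N1 : F [set l | forall i (s : R), `|s| < rho -> `|H i l s - h i s| <= eta'].
  by apply: filter_forall => j; exact: Hh.
have N2 : F [set l | forall i, `|z i l e| <= eta'].
  apply: filter_forall => j; have /cvgrPdist_le/(_ _ e'0) := ze j.
  by apply: filterS => l; rewrite sub0r normrN.
apply: filterS3 zD N1 N2 => l h1 h2 h3 s; rewrite ltr_norml => sr.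
have srr (t : R) : - rho < t < rho -> `|t| < rho by rewrite ltr_norml.
rewrite subr0.
have -> : eta = 2 * (eta' + d * eta').
  rewrite /eta'; field.
  by rewrite gt_eqF // addr_gt0.
apply: (linear_ode_stable (p := p) M0 pMd (A := A l)
  (h := fun i s => H i l s - h i s) (z := fun i => z i l) (e := e) (a := - rho) (b := rho)).
- by rewrite opprK -mulr2n -mulr_natl.
- by rewrite -ltr_norml.
- exact: ltW.
- exact: ltW.
- by move=> t tr j k; case: (h1 t (srr t tr) j).
- by move=> t tr j; apply: h2; exact: srr.
- by move=> t tr j; case: (h1 t (srr t tr) j).
- by move=> j; exact: h3.
- exact: sr.
Qed.

(** The difference solves the homogeneous system with zero initial value, and the stability estimate
    with both error bounds equal to 0 makes it vanish. *)
Lemma linear_ode_unique (R : realType) (p : nat) (M d e a b : R)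
    (A : 'I_p -> 'I_p -> R -> R) (h z1 z2 : 'I_p -> R -> R) :
  0 <= M -> p%:R * M * d <= 2^-1 ->
  b - a <= d -> a < e < b ->
  (forall s, a < s < b -> forall i j, `|A i j s| <= M) ->
  (forall s, a < s < b -> forall i,
     has_der (z1 i) s 1 (\sum_j A i j s * z1 j s + h i s)) ->
  (forall s, a < s < b -> forall i,
     has_der (z2 i) s 1 (\sum_j A i j s * z2 j s + h i s)) ->
  (forall i, z1 i e = z2 i e) ->
  forall s, a < s < b -> forall i, z1 i s = z2 i s.
Proof.
move=> M0 pMd bad aeb AM D1 D2 E s sI i.
apply/eqP; rewrite -subr_eq0 -normr_le0.
have -> : 0 = 2 * (0 + d * 0) :> R by rewrite mulr0 addr0 mulr0.
apply: (linear_ode_stable (p := p) M0 pMd (A := A)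
  (h := fun _ _ => 0) (z := fun i s => z1 i s - z2 i s) (e := e) (a := a) (b := b)) => //.
- by move=> *; rewrite normr0.
- move=> t tI j; rewrite addr0.
  under eq_bigr do rewrite mulrBr.
  rewrite sumrB.
  have -> : \sum_k A j k t * z1 k t - \sum_k A j k t * z2 k t =
    (\sum_k A j k t * z1 k t + h j t) - (\sum_k A j k t * z2 k t + h j t).
    by rewrite opprD addrACA subrr addr0.
  by apply: has_derB; [exact: D1|exact: D2].
- by move=> j; rewrite E subrr normr0.
Qed.

(** The data are controlled on the open interval only. For each rho < r they are clamped to
    [-rho, rho] and the global result applies; by uniqueness the solutions for different rho agree
    and glue. Two points of the interval are less than 2 r apart, whence the 2 r in the
    hypothesis. *)
Lemma linear_ode_exists (R : realType) (p : nat) (M r e : R)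
    (A : 'I_p -> 'I_p -> R -> R) (h : 'I_p -> R -> R) (b : 'I_p -> R) :
  0 <= M -> p%:R * M * (2 * r) <= 2^-1 -> `|e| < r ->
  (forall i j (s : R), `|s| < r -> {for s, continuous (A i j)}) ->
  (forall i (s : R), `|s| < r -> {for s, continuous (h i)}) ->
  (forall i j (s : R), `|s| < r -> `|A i j s| <= M) ->
  exists z, (forall i, z i e = b i) /\
    forall i (s : R), `|s| < r -> has_der (z i) s 1 (\sum_j A i j s * z j s + h i s).
Proof.
move=> M0 pMr er Ac hc AM.
have r0 : 0 < r by apply: le_lt_trans er.
have d0 : 0 < 2 * r by rewrite mulr_gt0.
have ex (rho : R) : `|e| < rho < r -> exists z, (forall i, z i e = b i) /\
    forall i (s : R), `|s| < rho -> has_der (z i) s 1 (\sum_j A i j s * z j s + h i s).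
  move=> /andP[erho rhor].
  have rho0 : 0 <= rho by apply: le_trans (ltW erho).
  have cr (s : R) : `|clamp 0 rho s| < r.
    by have := clamp_in 0 s rho0; rewrite subr0 => /le_lt_trans; apply.
  have cc (f : R -> R) : (forall s : R, `|s| < r -> {for s, continuous f}) ->
      continuous (fun s => f (clamp 0 rho s)).
    move=> fc s; exact: (cvg_comp (clamp 0 rho) f (@clamp_continuous _ 0 rho s) (fc _ (cr s))).
  have hB i : exists C : R, forall s : R, `|h i (clamp 0 rho s)| <= C.
    have [c cI cM] : exists2 c : R, c \in `[- rho, rho] &
        forall t : R, t \in `[- rho, rho] -> `|h i (clamp 0 rho t)| <= `|h i (clamp 0 rho c)|.
      apply: (EVT_max (f := fun t => `|h i (clamp 0 rho t)|)); first by rewrite ge0_cp.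
      have C1 : continuous (fun t => `|h i (clamp 0 rho t)|).
        move=> t; have C2 := cc (h i) (hc i) t.
        exact: (cvg_norm C2).
      exact: (continuous_subspaceT C1).
    exists `|h i (clamp 0 rho c)| => s.
    have := cM (clamp 0 rho s); rewrite (clamp_id (clamp_in 0 s rho0)).
    by apply; rewrite in_itv /= -ler_norml -[clamp _ _ _]subr0; exact: clamp_in.
  pose C := \sum_i `|sval (cid (hB i))|.
  have hC i (s : R) : `|h i (clamp 0 rho s)| <= C.
    apply: (@le_trans _ _ `|sval (cid (hB i))|).
      by case: cid => c /= Hc; apply: le_trans (Hc s) (ler_norm _).
    by rewrite /C (bigD1 i) //= lerDl sumr_ge0.
  have [z [ze zc zD]] := linear_ode_exists_global M0 d0 pMr e b
    (fun i j => cc _ (Ac i j)) (fun i => cc _ (hc i)) (fun i j s => AM i j _ (cr s)) hC.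
  exists z; split=> // i s sr.
  have cs : clamp 0 rho s = s by apply: clamp_id; rewrite subr0 ltW.
  have := zD i s; rewrite cs; apply.
  apply: le_lt_trans (ler_normB _ _) _; rewrite mulr_natl mulr2n ltrD //.
  exact: lt_trans rhor.
(* A radius strictly between max(|s|, |e|) and r, from which the value at [s] is read off. *)
pose rh (s : R) := (Num.max `|s| `|e| + r) / 2.
have rhI (s : R) : `|s| < r -> [/\ `|e| < rh s, `|s| < rh s & rh s < r].
  move=> sr; have : Num.max `|s| `|e| < r by rewrite gt_max sr er.
  have : `|s| <= Num.max `|s| `|e| by rewrite le_max lexx.
  have : `|e| <= Num.max `|s| `|e| by rewrite le_max lexx orbT.
  by rewrite /rh; move: (Num.max _ _) => m *; split; lra.
have ex' (rho : R) : exists z, `|e| < rho < r -> (forall i, z i e = b i) /\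
    forall i (s : R), `|s| < rho -> has_der (z i) s 1 (\sum_j A i j s * z j s + h i s).
  by have [/ex[z Hz]|] := boolP (`|e| < rho < r); [exists z|exists (fun _ _ => 0)].
pose Z rho := sval (cid (ex' rho)).
have ZP (rho : R) : `|e| < rho < r -> (forall i, Z rho i e = b i) /\
    forall i (s : R), `|s| < rho -> has_der (Z rho i) s 1 (\sum_j A i j s * Z rho j s + h i s).
  by rewrite /Z; case: cid.
have agree (r1 r2 s : R) i : `|e| < r1 < r -> `|e| < r2 < r -> `|s| < r1 -> `|s| < r2 ->
    Z r1 i s = Z r2 i s.
  move=> h1 h2 s1 s2; have [/andP[er1 r1r] /andP[er2 r2r]] := (h1, h2).
  pose m := Num.min r1 r2.
  have inI (t : R) : (- m < t < m) = (`|t| < r1) && (`|t| < r2).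
    by rewrite -ltr_norml lt_min.
  apply: (linear_ode_unique (p := p) M0 pMr (A := A) (h := h)
    (z1 := Z r1) (z2 := Z r2) (e := e) (a := - m) (b := m)).
  - have : m <= r by rewrite ge_min (ltW r1r).
    by move: m {inI} => m; clear -R; lra.
  - by rewrite inI er1 er2.
  - by move=> t; rewrite inI => /andP[t1 t2] j k; apply: AM; exact: lt_trans r1r.
  - by move=> t; rewrite inI => /andP[t1 t2] j; apply: (ZP _ h1).2.
  - by move=> t; rewrite inI => /andP[t1 t2] j; apply: (ZP _ h2).2.
  - by move=> j; rewrite (ZP _ h1).1 (ZP _ h2).1.
  - by rewrite inI s1 s2.
exists (fun i s => Z (rh s) i s); split=> [i|i s sr].
  by apply: (ZP _ _).1; have [-> _ ->] := rhI e er.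
have [h1 h2 h3] := rhI s sr.
have h13 : `|e| < rh s < r by rewrite h1 h3.
have := (ZP _ h13).2 i s h2.
apply: has_der_near.
have N : \forall x \near s, `|x| < rh s.
  have nC : (fun x : R => `|x|) @ s --> `|s| by apply: cvg_norm; exact: cvg_id.
  by apply: (nC [set y | y < rh s]); exact: open_nbhs_nbhs.
apply: filterS N => x xs.
have [k1 k2 k3] := rhI x (lt_trans xs h3).
by apply: agree => //; rewrite k1 k3.
Qed.

(** * Smooth dependence of solutions on the coordinates along the boundary *)

Section Slices.
Variables (R : realType) (n : nat).
Local Notation V := 'rV[R]_n.+1.
Local Notation e_ := (unit_vec R).
Implicit Types (u v : V) (s t : R) (f : V -> R).

(** The point with 0-th coordinate [s] and the other coordinates of [u]: s parametrises the line
    through [u] transverse to the boundary. *)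
Definition slice u s : V := u + (s - u 0 0) *: e_ 0.

Lemma slice0 u s : slice u s 0 0 = s.
Proof. by rewrite !mxE eqxx mulr1 addrC subrK. Qed.

Lemma slice_neq u s i : i != 0 -> slice u s 0 i = u 0 i.
Proof. by move=> i0; rewrite !mxE (negPf i0) andbF mulr0 addr0. Qed.

Lemma slice_id u : slice u (u 0 0) = u.
Proof. by rewrite /slice subrr scale0r addr0. Qed.

Lemma sliceDl u s t : slice u s = slice u t + (s - t) *: e_ 0.
Proof.
have E : s - u 0 0 = (t - u 0 0) + (s - t) by rewrite [RHS]addrC subrKA.
by rewrite {1}/slice E scalerDl addrA.
Qed.

Lemma slice_slice u s t : slice (slice u s) t = slice u t.
Proof. by rewrite {1}/slice slice0 -sliceDl. Qed.

Lemma slice_shift u s t a : a != 0 -> slice (u + t *: e_ a) s = slice u s + t *: e_ a.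
Proof.
move=> a0; rewrite /slice !mxE eq_sym (negPf a0) /= mulr0 addr0.
by rewrite addrAC.
Qed.

Lemma has_der_slice f u s l :
  has_der f (slice u s) (e_ 0) l <-> has_der (fun t => f (slice u t)) s 1 l.
Proof.
have -> : slice u s = slice u 0 + s *: e_ 0 by rewrite [LHS](sliceDl _ _ 0) subr0.
have -> : (fun t => f (slice u t)) = (fun t : R => f (slice u 0 + t *: e_ 0)).
  by apply/funext => t; rewrite [in LHS](sliceDl _ _ 0) subr0.
exact: has_der_line.
Qed.

Lemma continuous_leP f u : {for u, continuous f} <->
  (forall eta : R, 0 < eta -> \forall v \near u, `|f u - f v| <= eta).
Proof. exact: (@cvgrPdist_le _ _ _ (nbhs u) (nbhs_filter u) f (f u)). Qed.

Lemma has_der_dq f u v l :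
  (fun h : R => h^-1 * (f (u + h *: v) - f u)) @ 0^' --> l -> has_der f u v l.
Proof.
have -> : (fun h : R => h^-1 * (f (u + h *: v) - f u)) =
  (fun h : R => h^-1 *: ((f \o shift u) (h *: v) - f u)).
  by apply/funext => h /=; rewrite [u + _]addrC.
by move=> H; split; [exact: cvgP H|exact: cvg_lim H].
Qed.

Lemma slice_dist u v s t : `|slice v t - slice u s| <= Num.max `|t - s| `|v - u|.
Proof.
apply/mx_norm_leP => [|i j]; first by rewrite le_max normr_ge0.
rewrite ord1 mxE [(- slice u s) _ _]mxE; have [->|j0] := eqVneq j 0.
  by rewrite !slice0 le_max lexx.
rewrite !slice_neq //; have := le_mx_norm (v - u) 0 j; rewrite !mxE => h.
by rewrite le_max h orbT.
Qed.

Section Ball.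
Variables (u0 : V) (r : R).
Hypotheses (u00 : u0 0 0 = 0) (r0 : 0 < r).
Let O : set V := [set u | `|u - u0| < r].

Lemma ballO_open : open O.
Proof.
rewrite openE => u Ou; apply/near_ballP; exists (r - `|u - u0|); first by rewrite subr_gt0.
move=> v; rewrite ltrBrDr => h; apply: le_lt_trans h.
by rewrite -(subrKA u); exact: ler_normD.
Qed.
Let Oo := ballO_open.

Lemma ball_coord u : O u -> `|u 0 0| < r.
Proof.
by move=> Ou; apply: le_lt_trans Ou; have := le_mx_norm (u - u0) 0 0; rewrite !mxE u00 subr0.
Qed.

(** The norm is the maximum norm and [u0] has height 0, so the ball is a product of an interval of
    heights and a box. *)
Lemma ball_slice u s : O u -> `|s| < r -> O (slice u s).
Proof.
move=> Ou sr; rewrite /O /=.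
have h : forall i j, `|(slice u s - u0) i j| <= Num.max `|s| `|u - u0|.
  move=> i j; rewrite ord1 mxE [(- u0) _ _]mxE; have [->|j0] := eqVneq j 0.
    by rewrite slice0 u00 subr0 le_max lexx.
  rewrite slice_neq //; have := le_mx_norm (u - u0) 0 j; rewrite !mxE => h.
  by rewrite le_max h orbT.
have h0 : 0 <= Num.max `|s| `|u - u0| by rewrite le_max normr_ge0.
apply: le_lt_trans ((mx_norm_leP _ h0).2 h) _.
by rewrite gt_max sr.
Qed.

Lemma slice_continuous f u s : O u -> `|s| < r -> {in O, continuous f} ->
  {for s, continuous (fun t => f (slice u t))}.
Proof.
move=> Ou sr fc.
have C1 : (fun t => slice u t) @ s --> slice u s.
  apply: (cvgD (cvg_cst _)); apply: cvgZr_tmp; apply: cvgB; [exact: cvg_id|exact: cvg_cst].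
apply: (cvg_comp (fun t => slice u t) f C1).
by apply: fc; rewrite inE; exact: ball_slice.
Qed.

Lemma slice_bound f u rho : O u -> rho < r -> {in O, continuous f} ->
  exists K, forall s, `|s| < rho -> `|f (slice u s)| <= K.
Proof.
move=> Ou rr fc; apply: (continuous_bounded rr) => s sr.
exact: slice_continuous.
Qed.

(** Compactness of [-rho, rho] makes continuity uniform along the slice; this is why rho has to be
    strictly smaller than r. *)
Lemma slice_unif f u rho : O u -> rho < r -> {in O, continuous f} ->
  unif rho (nbhs u) (fun v s => f (slice v s)) (fun s => f (slice u s)).
Proof.
move=> Ou rr fc eta e0.
have cpt : compact `[- rho, rho]%classic by exact: segment_compact.
have e2 : 0 < eta / 2 by rewrite divr_gt0.
have H (s : R) : `[- rho, rho]%classic s ->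
    \forall t \near s & v \near nbhs u, `|f (slice v t) - f (slice u t)| <= eta.
  rewrite /= in_itv /= -ler_norml => sr.
  have wO : O (slice u s) by apply: ball_slice => //; exact: le_lt_trans rr.
  have /cvgrPdist_le/(_ _ e2) := fc _ (mem_set wO).
  move=> /near_ballP[d d0 Hd].
  have Ns : \forall t \near s, `|t - s| < d.
    by apply/nbhs_ballP; exists d => // t; rewrite /ball /= distrC.
  have Nu : \forall v \near u, `|v - u| < d by apply/near_ballP; exists d.
  exists ([set t | `|t - s| < d], [set v | `|v - u| < d]) => //= -[t v] /= [td vd].
  have h w : `|w - u| < d -> `|f (slice u s) - f (slice w t)| <= eta / 2.
    move=> wd; apply: Hd; apply: le_lt_trans (slice_dist _ _ _ _) _.
    by rewrite gt_max td.
  apply: le_trans (ler_distD (f (slice u s)) _ _) _.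
  rewrite (splitr eta); apply: lerD; first by rewrite distrC; exact: h.
  by apply: h; rewrite subrr normr0.
have := (compact_near_coveringP _).1 cpt V (nbhs u)
  (fun v s => `|f (slice v s) - f (slice u s)| <= eta) (nbhs_filter u) H.
apply: filterS => v Hv s sr; apply: Hv; rewrite /= in_itv /= -ler_norml; exact: ltW.
Qed.

(** By the mean value theorem the quotient is the derivative at an intermediate point. As a is not
    0, that point lies at the same height on a nearby slice, where uniform continuity along slices
    applies. *)
Lemma dq_unif f u rho a : a != 0 -> O u -> rho < r -> Ck 1 O f ->
  unif rho (0 : R)^' (fun h s : R => h^-1 * (f (slice u s + h *: e_ a) - f (slice u s)))
               (fun s => der a f (slice u s)).
Proof.
move=> a0 Ou rr fc eta e0.
have [_ dc] := fc a.
have /near_ballP[d d0 Hd] := slice_unif Ou rr dc e0.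
have /near_ballP[d' d'0 Hd'] := near_open Oo Ou.
pose m := Num.min d d'.
have m0 : 0 < m by rewrite lt_min d0 d'0.
have N : \forall h \near (0 : R)^', `|h| < m.
  have : \forall h \near (0 : R), `|h| < m.
    by apply/nbhs_ballP; exists m => // h; rewrite /ball /= sub0r normrN.
  by apply: filterS => h.
have N' : \forall h \near (0 : R)^', h != 0 by exact: nbhs_dnbhs_neq.
apply: filterS2 N N' => h; rewrite lt_min => /andP[hd hd'] h0 s sr.
have un (t : R) : 0 <= t <= 1 -> `|u + (t * h) *: e_ a - u| <= `|h|.
  move=> /andP[t0 t1]; rewrite [_ - u]addrC addKr normrZ normrM (ger0_norm t0).
  rewrite -[leRHS]mulr1; apply: ler_pM (norm_unit_vec _ _) => //.
    by rewrite mulr_ge0.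
  by rewrite ler_piMl.
have [t t01|t t01 E] := MVT_line (f := f) (df := der a f) (u := slice u s) (v := e_ a) (t := h).
  apply: (Ck_has_der _ _ fc); rewrite -slice_shift //.
  apply: ball_slice; last exact: lt_trans rr.
  by apply: Hd'; apply: le_lt_trans (un t t01) _.
rewrite E mulKf // -slice_shift //; apply: Hd => //.
by apply: le_lt_trans (un t t01) _.
Qed.

Section System.
Variables (p : nat) (M eps : R) (A : 'I_p -> 'I_p -> V -> R).
Hypotheses (M0 : 0 <= M) (pMr : p%:R * M * (2 * r) <= 2^-1) (epsr : `|eps| < r)
  (Asm : forall i j, Cinfty O (A i j)) (AM : forall i j u, O u -> `|A i j u| <= M).

(** A radius that contains both the initial height and the height of [u], yet is smaller than r, as
    compactness along slices demands. *)
Let mid u : exists2 rho, rho < r & `|eps| < rho /\ (O u -> `|u 0 0| < rho).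
Proof.
have [Ou|] := pselect (O u); last first.
  by exists ((`|eps| + r) / 2); [|split=> //]; move: epsr; lra.
have m : Num.max `|u 0 0| `|eps| < r by rewrite gt_max epsr ball_coord.
exists ((Num.max `|u 0 0| `|eps| + r) / 2); first by move: m; lra.
have : `|u 0 0| <= Num.max `|u 0 0| `|eps| by rewrite le_max lexx.
have : `|eps| <= Num.max `|u 0 0| `|eps| by rewrite le_max lexx orbT.
by move: (Num.max _ _) m => w *; split; [|move=> _]; lra.
Qed.

Let rhs (f z : 'I_p -> V -> R) i u := \sum_j A i j u * z j u + f i u.

Let cO f : Cinfty O f -> {in O, continuous f}.
Proof. by move=> H; exact: (H 0%N). Qed.

(** Nothing is assumed on how [z] varies from slice to slice. The difference of its values on the
    slices through v and u solves a linear system whose forcing comes from the variation of the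
    coefficients and tends to 0 uniformly as v tends to u. *)
Lemma ode_continuous (f b z : 'I_p -> V -> R) :
  (forall i, {in O, continuous (f i)}) -> (forall i, Cinfty O (b i)) ->
  (forall i u, O u -> has_der (z i) u (e_ 0) (rhs f z i u)) ->
  (forall i u, O u -> z i (slice u eps) = b i (slice u eps)) ->
  forall i, {in O, continuous (z i)}.
Proof.
move=> fc bs zD ze i u; rewrite inE => Ou.
have [rho rr [er ur]] := mid u; have {}ur := ur Ou.
have zl w j s : O w -> `|s| < r ->
    has_der (fun t => z j (slice w t)) s 1 (rhs f z j (slice w s)).
  by move=> Ow sr; apply/has_der_slice; apply: zD; exact: ball_slice.
have zlc w j s : O w -> `|s| < r -> {for s, continuous (fun t => z j (slice w t))}.
  move=> Ow sr; apply/differentiable_continuous/derivable1_diffP.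
  by case: (zl w j s Ow sr).
have NO := near_open Oo Ou.
have zK j : exists K, forall s, `|s| < rho -> `|z j (slice u s)| <= K.
  by apply: (continuous_bounded rr) => s sr; exact: zlc.
have zu : forall i, unif rho (nbhs u) (fun v s => z i (slice v s) - z i (slice u s)) (fun=> 0).
  apply: (unif_stable (p := p) (M := M) (d := 2 * r) (e := eps)
    (A := fun v i j s => A i j (slice v s))
    (H := fun i v s => \sum_j A i j (slice v s) * z j (slice u s) + f i (slice v s))
    (h := fun i s => rhs f z i (slice u s))) => //.
  - by rewrite mulr_gt0.
  - by rewrite ler_pM2l // ltW.
  - apply: filterS NO => v Ov s sr j; have {}sr := lt_trans sr rr.
    split=> [k|]; first by apply: AM; exact: ball_slice.
    have -> : \sum_k A j k (slice v s) * (z k (slice v s) - z k (slice u s)) +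
        (\sum_k A j k (slice v s) * z k (slice u s) + f j (slice v s) -
         rhs f z j (slice u s)) = rhs f z j (slice v s) - rhs f z j (slice u s).
      rewrite /rhs; under eq_bigr do rewrite mulrBr.
      by rewrite sumrB addrA addrA subrK.
    by apply: has_derB; [exact: (zl v j s)|exact: (zl u j s)].
  - move=> j; apply: unifD; last exact: slice_unif.
    apply: unif_sum => k; apply: unifM_bounded; last exact: unif_cst.
    + exact: (slice_bound Ou rr (cO (Asm j k))).
    + exact: zK.
    + exact: (slice_unif Ou rr (cO (Asm j k))).
  - move=> j; rewrite -[X in _ --> X](subrr (b j (slice u eps))).
    have C : (fun v => b j (slice v eps) - b j (slice u eps)) @ nbhs u -->
        b j (slice u eps) - b j (slice u eps).
      apply: cvgB; last exact: cvg_cst.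
      exact: (unif_pt (slice_unif Ou rr (cO (bs j))) er).
    apply: cvg_trans C; apply: (@near_eq_cvg _ _ (nbhs u) (nbhs_filter u)).
    apply: filterS NO => v Ov; by rewrite !ze.
apply/continuous_leP => eta e0; have e2 : 0 < eta / 2 by rewrite divr_gt0.
have N1 := zu i _ e2.
have cc : (fun v : V => v 0 0) @ u --> u 0 0 by exact: coord_continuous.
have N2 : nbhs u [set v : V | `|v 0 0| < rho].
  have : \forall x \near u 0 0, `|x| < rho.
    have nC : (fun x : R => `|x|) @ (u 0 0) --> `|u 0 0| by apply: cvg_norm; exact: cvg_id.
    by apply: (nC [set y | y < rho]); exact: open_nbhs_nbhs.
  exact: cc.
have N3 : nbhs u [set v : V | `|z i (slice u (u 0 0)) - z i (slice u (v 0 0))| <= eta / 2].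
  have C2 := zlc u i _ Ou (ball_coord Ou).
  have C3 : {for u, continuous (fun v : V => z i (slice u (v 0 0)))}.
    exact: (cvg_comp (fun v : V => v 0 0) (fun t : R => z i (slice u t)) cc C2).
  by move/continuous_leP: C3 => /(_ _ e2).
apply: filterS3 N1 N2 N3 => v h1 h2 h3.
rewrite -(slice_id u) -(slice_id v).
apply: le_trans (ler_distD (z i (slice u (v 0 0))) _ _) _.
rewrite (splitr eta); apply: lerD; first exact: h3.
by have := h1 _ h2; rewrite subr0 distrC.
Qed.

(** [w] solves the formally differentiated system. The difference quotient of [z] minus [w]
    satisfies a linear system with forcing and initial values tending to 0, hence tends to 0
    itself. *)
Lemma ode_der (f b z w : 'I_p -> V -> R) a : a != 0 ->
  (forall i, Ck 1 O (f i)) -> (forall i, Cinfty O (b i)) ->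
  (forall i, {in O, continuous (z i)}) ->
  (forall i u, O u -> has_der (z i) u (e_ 0) (rhs f z i u)) ->
  (forall i u, O u -> z i (slice u eps) = b i (slice u eps)) ->
  (forall i u, O u -> has_der (w i) u (e_ 0)
     (rhs (fun i u => \sum_j der a (A i j) u * z j u + der a (f i) u) w i u)) ->
  (forall i u, O u -> w i (slice u eps) = der a (b i) (slice u eps)) ->
  forall i u, O u -> has_der (z i) u (e_ a) (w i u).
Proof.
move=> a0 f1 bs zc zD ze wD we i u Ou.
have [rho rr [er ur]] := mid u; have {}ur := ur Ou.
have fl (g q : 'I_p -> V -> R) : (forall i u, O u -> has_der (g i) u (e_ 0) (q i u)) ->
    forall v j s, O v -> `|s| < r -> has_der (fun t => g j (slice v t)) s 1 (q j (slice v s)).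
  by move=> gD v j s Ov sr; apply/has_der_slice; apply: gD; exact: ball_slice.
have uh : (fun h : R => u + h *: e_ a) @ (0 : R)^' --> u.
  rewrite -[X in _ --> X](addr0 u) -(scale0r (e_ a)).
  apply: cvgD; first exact: cvg_cst.
  by apply: cvgZr_tmp; apply: cvg_within_filter; exact: cvg_id.
have NO : \forall h \near (0 : R)^', O (u + h *: e_ a) by exact: (uh _ (near_open Oo Ou)).
have N0 : \forall h \near (0 : R)^', h != 0 by exact: nbhs_dnbhs_neq.
have A1 j k : Ck 1 O (A j k) by exact: Asm.
have dAc j k : {in O, continuous (der a (A j k))} by have [] := A1 j k a.
have dfc j : {in O, continuous (der a (f j))} by have [] := f1 j a.
have U : forall i, unif rho (0 : R)^'
    (fun h s => h^-1 * (z i (slice u s + h *: e_ a) - z i (slice u s)) - w i (slice u s))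
    (fun=> 0).
  (* Discrete product rule: the quotient of A z is A times the quotient of z plus the quotient of A
     times the shifted z. The second part goes into the forcing, and converges because [z] is
     already known to be continuous. *)
  apply: (unif_stable (p := p) (M := M) (d := 2 * r) (e := eps)
    (A := fun h i j s => A i j (slice u s))
    (H := fun i h s => \sum_j h^-1 * (A i j (slice u s + h *: e_ a) - A i j (slice u s))
             * z j (slice u s + h *: e_ a) + h^-1 * (f i (slice u s + h *: e_ a) - f i (slice u s)))
    (h := fun i s => \sum_j der a (A i j) (slice u s) * z j (slice u s) + der a (f i) (slice u s))) => //.
  - by rewrite mulr_gt0.
  - by rewrite ler_pM2l // ltW.
  - apply: filterS2 NO N0 => h Oh h0 s sr j; have {}sr := lt_trans sr rr.
    split=> [k|]; first by apply: AM; exact: ball_slice.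
    have zh k : z k (slice u s + h *: e_ a) = z k (slice (u + h *: e_ a) s) by rewrite slice_shift.
    have D1 := fl _ _ zD _ j _ Oh sr; have D2 := fl _ _ zD _ j _ Ou sr.
    have D3 := fl _ _ wD _ j _ Ou sr.
    have D4 := has_derB (has_derM (has_der_cst h^-1 s 1) (has_derB D1 D2)) D3.
    rewrite mul0r add0r in D4.
    have -> : (fun s => h^-1 * (z j (slice u s + h *: e_ a) - z j (slice u s)) - w j (slice u s)) =
       (fun s => h^-1 * (z j (slice (u + h *: e_ a) s) - z j (slice u s)) - w j (slice u s)).
      by apply/funext => t; rewrite slice_shift.
    suff -> : \sum_k A j k (slice u s) *
          (h^-1 * (z k (slice u s + h *: e_ a) - z k (slice u s)) - w k (slice u s)) +
        (\sum_k h^-1 * (A j k (slice u s + h *: e_ a) - A j k (slice u s)) *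
            z k (slice u s + h *: e_ a) +
          h^-1 * (f j (slice u s + h *: e_ a) - f j (slice u s)) -
         (\sum_k der a (A j k) (slice u s) * z k (slice u s) + der a (f j) (slice u s))) =
      h^-1 * (rhs f z j (slice (u + h *: e_ a) s) - rhs f z j (slice u s)) -
         rhs (fun i u => \sum_j der a (A i j) u * z j u + der a (f i) u) w j (slice u s) by [].
    rewrite slice_shift // /rhs.
    have -> : \sum_k A j k (slice u s) *
          (h^-1 * (z k (slice u s + h *: e_ a) - z k (slice u s)) - w k (slice u s)) =
       h^-1 * \sum_k A j k (slice u s) * (z k (slice u s + h *: e_ a) - z k (slice u s))
       - \sum_k A j k (slice u s) * w k (slice u s).
      by rewrite mulr_sumr -sumrB; apply: eq_bigr => k _; ring.
    have -> : \sum_k h^-1 * (A j k (slice u s + h *: e_ a) - A j k (slice u s)) *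
            z k (slice u s + h *: e_ a) =
        h^-1 * (\sum_k A j k (slice u s + h *: e_ a) * z k (slice u s + h *: e_ a) -
         \sum_k A j k (slice u s) * z k (slice u s) -
         \sum_k A j k (slice u s) * (z k (slice u s + h *: e_ a) - z k (slice u s))).
      by rewrite -!sumrB mulr_sumr; apply: eq_bigr => k _; ring.
    by ring.
  - move=> j; apply: unifD; last exact: dq_unif.
    apply: unif_sum => k; apply: unifM_bounded.
    + exact: (slice_bound Ou rr (dAc j k)).
    + exact: (slice_bound Ou rr (zc k)).
    + exact: dq_unif.
    + have := unif_comp uh (slice_unif Ou rr (zc k)).
      by under eq_fun do under eq_fun do rewrite slice_shift //.
  - move=> j.
    have C : (fun h : R => h^-1 * (b j (slice u eps + h *: e_ a) - b j (slice u eps))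
        - w j (slice u eps)) @ (0 : R)^' --> w j (slice u eps) - w j (slice u eps).
      rewrite {2}we //; apply: cvgB; last exact: cvg_cst.
      exact: (unif_pt (dq_unif a0 Ou rr (bs j 1%N)) er).
    rewrite subrr in C; apply: cvg_trans C; apply: near_eq_cvg.
    apply: filterS NO => h Oh.
    by rewrite -slice_shift // ze // ze.
apply: has_der_dq.
have C := unif_pt (U i) ur; rewrite /= slice_id in C.
rewrite -[X in _ --> X]add0r.
have -> : (fun h : R => h^-1 * (z i (u + h *: e_ a) - z i u)) =
  (fun h : R => (h^-1 * (z i (u + h *: e_ a) - z i u) - w i u) + w i u).
  by apply/funext => h; rewrite subrK.
by apply: cvgD; [exact: C|exact: cvg_cst].
Qed.

Lemma ode_exists (g : 'I_p -> V -> R) (b : 'I_p -> V -> R) :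
  (forall i, {in O, continuous (g i)}) -> exists w : 'I_p -> V -> R,
    (forall i u, O u -> has_der (w i) u (e_ 0) (rhs g w i u)) /\
    (forall i u, O u -> w i (slice u eps) = b i (slice u eps)).
Proof.
move=> gc.
have ex v : exists z : 'I_p -> R -> R, O v -> (forall i, z i eps = b i (slice v eps)) /\
    forall i s, `|s| < r -> has_der (z i) s 1
      (\sum_j A i j (slice v s) * z j s + g i (slice v s)).
  have [Ov|] := pselect (O v); last by exists (fun _ _ => 0).
  have [||i j s sr|z Hz] := linear_ode_exists (p := p) (A := fun i j s => A i j (slice v s))
    (h := fun i s => g i (slice v s)) (fun i => b i (slice v eps)) M0 pMr epsr.
  - by move=> i j s sr; apply: (slice_continuous Ov sr); exact: cO.
  - by move=> i s sr; apply: (slice_continuous Ov sr); exact: gc.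
  - by apply: AM; exact: ball_slice.
  - by exists z.
pose zeta v := sval (cid (ex v)).
have zP v : O v -> (forall i, zeta v i eps = b i (slice v eps)) /\
    forall i s, `|s| < r -> has_der (zeta v i) s 1
      (\sum_j A i j (slice v s) * zeta v j s + g i (slice v s)).
  by rewrite /zeta; case: cid.
(* Base points are normalised to height 0, so that all points of a line use the same chosen
   solution. *)
pose w i u := zeta (slice u 0) i (u 0 0).
have ws i u s : w i (slice u s) = zeta (slice u 0) i s.
  by rewrite /w slice_slice slice0.
have O0 u : O u -> O (slice u 0) by move=> Ou; apply: ball_slice; rewrite ?normr0.
exists w; split=> i u Ou; last first.
  by rewrite ws (zP _ (O0 u Ou)).1 slice_slice.
rewrite -{1}(slice_id u); apply/has_der_slice.
have -> : (fun t => w i (slice u t)) = zeta (slice u 0) i by apply/funext => t; exact: ws.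
have := (zP _ (O0 u Ou)).2 i _ (ball_coord Ou).
by rewrite slice_slice slice_id.
Qed.

(** Induction on the order. The derivative in the direction 0 is given by the equation; a derivative
    in another direction solves the differentiated system, which has the same matrix [A], so the
    induction hypothesis applies to it. *)
Lemma ode_smooth k (f b z : 'I_p -> V -> R) :
  (forall i, Ck k O (f i)) -> (forall i, Cinfty O (b i)) ->
  (forall i u, O u -> has_der (z i) u (e_ 0) (rhs f z i u)) ->
  (forall i u, O u -> z i (slice u eps) = b i (slice u eps)) ->
  forall i, Ck k O (z i).
Proof.
elim: k f b z => [|k IH] f b z fk bs zD ze; first exact: (ode_continuous fk bs).
have zk := IH f b z (fun i => Ck_pred Oo (fk i)) bs zD ze.
have zc i : {in O, continuous (z i)} by exact: (Ck_le Oo (leq0n k) (zk i)).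
have [df ddf] : exists d : 'I_n.+1 -> 'I_p -> V -> R, forall a i,
    Ck k O (d a i) /\ forall u, O u -> has_der (z i) u (e_ a) (d a i u).
  suff H a : exists d : 'I_p -> V -> R, forall i,
      Ck k O (d i) /\ forall u, O u -> has_der (z i) u (e_ a) (d i u).
    by exists (fun a => sval (cid (H a))) => a; case: cid.
  have [->|a0] := eqVneq a 0.
    exists (rhs f z) => i; split=> [|u]; last exact: zD.
    apply: CkD => //; last exact: Ck_pred.
    by apply: Ck_sum => // j; apply: CkM => //; exact: Asm.
  pose g i u := \sum_j der a (A i j) u * z j u + der a (f i) u.
  have gk i : Ck k O (g i).
    apply: CkD => //; last exact: Ck_der.
    apply: Ck_sum => // j; apply: CkM => //; exact: (Ck_der _ (Asm i j k.+1)).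
  have [w [wD we]] := ode_exists (fun i => der a (b i)) (fun i => Ck_le Oo (leq0n k) (gk i)).
  exists w => i; split.
    exact: (IH g (fun i => der a (b i)) w gk (fun i => Cinfty_der a (bs i)) wD we).
  apply: (ode_der a0 _ bs zc zD ze wD we) => j.
  exact: (Ck_le Oo _ (fk j)).
move=> i; apply: (CkS (df := fun a => df a i)) => // [a u Ou|a].
  by case: (ddf a i) => _; apply.
by case: (ddf a i).
Qed.

End System.

End Ball.
End Slices.

(** * Extension of solutions across the boundary *)

Section ODEExtend.
Variables (R : realType) (n : nat).
Local Notation V := 'rV[R]_n.+1.
Local Notation e_ := (unit_vec R).
Implicit Types (u v : V) (f : V -> R) (W : set V).

Definition upper W : set V := W `&` [set u | 0 < u 0 0].

Lemma upper_open W : open W -> open (upper W).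
Proof.
move=> Wo; have H : open ((fun u : V => u 0 0) @^-1` [set x | 0 < x]).
  by apply: open_comp => [v _|]; [exact: coord_continuous|exact: open_gt].
exact: openI Wo H.
Qed.

(** The problem with initial values at height eps > 0 is solved on a full ball around the boundary
    point, on both sides of the boundary. On heights in (0, r) the new solution agrees with [Y] by
    uniqueness, so no bound on [Y] near the boundary is required. *)
Theorem ode_extend (u0 : V) W (p : nat) (A : 'I_p -> 'I_p -> V -> R) (Y : 'I_p -> V -> R) :
  u0 0 0 = 0 -> open W -> W u0 -> (forall i j, Cinfty W (A i j)) ->
  (forall i, Cinfty (upper W) (Y i)) ->
  (forall i u, upper W u -> der 0 (Y i) u = \sum_j A i j u * Y j u) ->
  exists (O : set V) (h : 'I_p -> V -> R),
    [/\ open O, O u0, O `<=` W, forall i, Cinfty O (h i) &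
     forall i u, upper O u -> h i u = Y i u].
Proof.
move=> u00 Wo Wu0 As Ys YD.
pose M := \sum_(ij : 'I_p * 'I_p) `|A ij.1 ij.2 u0| + 1.
have M0 : 0 <= M by rewrite addr_ge0 // sumr_ge0.
have NA : nbhs u0 [set u | forall ij : 'I_p * 'I_p, `|A ij.1 ij.2 u0 - A ij.1 ij.2 u| <= 1].
  apply: (@filter_forall _ _ (fun ij u => `|A ij.1 ij.2 u0 - A ij.1 ij.2 u| <= 1) _
    (nbhs_filter u0)) => ij.
  have C : {for u0, continuous (A ij.1 ij.2)} by exact: (Cinfty_cont Wo Wu0 (As _ _)).
  by move/continuous_leP: C => /(_ _ ltr01).
have [r1 r1_gt0 Hr1] := (near_ballP _ _).1 (filterI NA (near_open Wo Wu0)).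
(* The second term ensures p M (2 r) <= 1/2; the added 1 avoids dividing by 0 when p M vanishes. *)
pose r := Num.min r1 (4 * (p%:R * M + 1))^-1.
have q0 : 0 < 4 * (p%:R * M + 1) by rewrite mulr_gt0 // ltr_wpDl // mulr_ge0.
have r0 : 0 < r by rewrite lt_min r1_gt0 invr_gt0.
have rr1 : r <= r1 by rewrite ge_min lexx.
have pMr : p%:R * M * (2 * r) <= 2^-1.
  have rq : r <= (4 * (p%:R * M + 1))^-1 by rewrite ge_min lexx orbT.
  have pM0 : 0 <= p%:R * M by rewrite mulr_ge0.
  apply: (@le_trans _ _ ((p%:R * M + 1) * (2 * (4 * (p%:R * M + 1))^-1))).
    by apply: ler_pM; rewrite ?mulr_ge0 ?(ltW r0) // ?lerDl // ler_pM2l.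
  rewrite le_eqVlt; apply/orP; left; apply/eqP; field.
  by rewrite gt_eqF // ltr_wpDl.
pose O : set V := [set u | `|u - u0| < r].
have Oo : open O := @ballO_open R n u0 r.
have OW : O `<=` W.
  by move=> u Ou; have [] := Hr1 u (lt_le_trans Ou rr1).
have AM i j u : O u -> `|A i j u| <= M.
  move=> Ou; have [Hij _] := Hr1 u (lt_le_trans Ou rr1); have /= h := Hij (i, j).
  rewrite -(subrK (A i j u0) (A i j u)) addrC; apply: le_trans (ler_normD _ _) _.
  apply: lerD; last by rewrite distrC.
  by rewrite (bigD1 (i, j)) //= lerDl sumr_ge0.
have AsO i j : Cinfty O (A i j) := Cinfty_sub OW (As i j).
pose eps := r / 2.
have eps0 : 0 < eps by rewrite divr_gt0.
have epsr : eps < r by rewrite /eps ltr_pdivrMr // ltr_pMr // ltr1n.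
have epsr' : `|eps| < r by rewrite gtr0_norm.
have SW u (s : R) : O u -> 0 < s -> s < r -> upper W (slice u s).
  move=> Ou s0 sr; split; last by rewrite /= slice0.
  by apply: OW; apply: ball_slice => //; rewrite gtr0_norm.
pose b i u := Y i (slice u eps).
have bs i : Cinfty O (b i).
  apply: (Cinfty_comp (O' := upper W)) => //; [exact: upper_open| |].
    move=> a; have [->|a0] := eqVneq a 0.
      apply: (@Cinfty_eq _ _ _ (fun=> eps)) => // [u _|]; first by rewrite slice0.
      exact: Cinfty_cst.
    apply: (@Cinfty_eq _ _ _ (fun u => u 0 a)) => // [u _|]; first by rewrite slice_neq.
    exact: Cinfty_coord.
  by move=> u Ou; exact: SW.
have zc (i : 'I_p) : {in O, continuous (fun _ : V => 0 : R)} by move=> u _; exact: cst_continuous.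
have [w [wD we]] := ode_exists u00 r0 M0 pMr epsr' AsO AM b zc.
have O0 : O u0 by rewrite /O /= subrr normr0.
have bE i u : O u -> w i (slice u eps) = b i (slice u eps).
  by move=> Ou; rewrite we.
exists O, w; split=> // [i k|i u [Ou u_gt0]].
  apply: (ode_smooth u00 r0 M0 pMr epsr' AsO AM (k := k) (f := fun _ _ => 0) (b := b)) => // j.
  exact: Ck_cst.
have ur := ball_coord u00 Ou; rewrite gtr0_norm // in ur.
rewrite -(slice_id u).
apply: (linear_ode_unique (p := p) M0 pMr (e := eps) (a := 0) (b := r)
  (A := fun i j s => A i j (slice u s)) (h := fun _ _ => 0)
  (z1 := fun i s => w i (slice u s)) (z2 := fun i s => Y i (slice u s))).
- by rewrite subr0 mulr_natl mulr2n lerDl ltW.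
- by rewrite eps0.
- by move=> s /andP[s0 sr] j k; apply: AM; apply: ball_slice => //; rewrite gtr0_norm.
- move=> s /andP[s0 sr] j; apply/has_der_slice; apply: wD.
  by apply: ball_slice => //; rewrite gtr0_norm.
- move=> s /andP[s0 sr] j; apply/has_der_slice; rewrite addr0 -YD; last exact: SW.
  by apply: (Cinfty_has_der _ (Ys j)); exact: SW.
- by move=> j; rewrite bE // /b slice_slice.
- by rewrite u_gt0.
Qed.

(** * Linear combinations with coefficients smooth across the boundary *)

Section Span.
Variables (W : set V) (K : finType) (Y : K -> V -> R).
Hypotheses (Wo : open W) (Ys : forall k, Cinfty (upper W) (Y k)).
Implicit Types (P Q : pred K).

(** The generators [Y] are smooth at positive heights only, while the coefficients are smooth on all
    of [W]. The predicate [P] selects the generators that may occur. *)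
Definition in_span P f := exists2 c : K -> V -> R, forall k, Cinfty W (c k) &
  forall u, upper W u -> f u = \sum_(k | P k) c k u * Y k u.

Lemma span_eq P f h : (forall u, upper W u -> f u = h u) -> in_span P f -> in_span P h.
Proof. by move=> fh [c cs cE]; exists c => // u Wu; rewrite -fh // cE. Qed.

Lemma span_gen P k : P k -> in_span P (Y k).
Proof.
move=> Pk; exists (fun j _ => (j == k)%:R) => [j|u _]; first exact: Cinfty_cst.
by rewrite (bigD1 k) //= eqxx mul1r big1 ?addr0 // => j /andP[_ /negPf ->]; rewrite mul0r.
Qed.

Lemma span0 P : in_span P (fun=> 0).
Proof.
exists (fun _ _ => 0) => [k|u _]; first exact: Cinfty_cst.
by rewrite big1 // => k _; rewrite mul0r.
Qed.

Lemma spanD P f h : in_span P f -> in_span P h -> in_span P (fun u => f u + h u).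
Proof.
move=> [c cs cE] [d ds dE]; exists (fun k u => c k u + d k u) => [k|u Wu].
  exact: CinftyD.
by rewrite cE // dE // -big_split; apply: eq_bigr => k _; rewrite mulrDl.
Qed.

Lemma spanM P f h : Cinfty W h -> in_span P f -> in_span P (fun u => h u * f u).
Proof.
move=> hs [c cs cE]; exists (fun k u => h u * c k u) => [k|u Wu]; first exact: CinftyM.
by rewrite cE // mulr_sumr; apply: eq_bigr => k _; rewrite mulrA.
Qed.

Lemma spanZ P f (x : R) : in_span P f -> in_span P (fun u => x * f u).
Proof. by apply: spanM; exact: Cinfty_cst. Qed.

Lemma spanN P f : in_span P f -> in_span P (fun u => - f u).
Proof. by move=> /(spanZ (-1)); apply: span_eq => u _; rewrite mulN1r. Qed.

Lemma spanB P f h : in_span P f -> in_span P h -> in_span P (fun u => f u - h u).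
Proof. by move=> ? /spanN; exact: spanD. Qed.

Lemma span_sum P (I : Type) (r : seq I) (F : I -> V -> R) :
  (forall i, in_span P (F i)) -> in_span P (fun u => \sum_(i <- r) F i u).
Proof.
move=> HF; elim: r => [|i r IH].
  by apply: span_eq (span0 P) => u _; rewrite big_nil.
by apply: span_eq (spanD (HF i) IH) => u _; rewrite big_cons.
Qed.

Lemma span_sub P Q f : {subset P <= Q} -> in_span P f -> in_span Q f.
Proof.
move=> PQ [c cs cE]; exists (fun k u => (P k)%:R * c k u) => [k|u Wu].
  by apply: CinftyM => //; exact: Cinfty_cst.
rewrite cE // [RHS]big_mkcond [LHS]big_mkcond; apply: eq_bigr => k _.
have := PQ k; rewrite -!topredE /=; case: (P k) => [->|_] //; first by rewrite mul1r.
by rewrite !mul0r; case: ifP.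
Qed.

Lemma span_smooth P f : in_span P f -> Cinfty (upper W) f.
Proof.
have uo := upper_open Wo; have WW : upper W `<=` W by move=> u [].
move=> [c cs cE]; apply: (@Cinfty_eq _ _ _ (fun u => \sum_(k <- index_enum K) (P k)%:R * (c k u * Y k u))) => //.
  by move=> u Wu; rewrite cE // [RHS]big_mkcond; apply: eq_bigr => k _; case: (P k); rewrite ?mul1r ?mul0r.
apply: Cinfty_sum => // k; apply: CinftyM => //; first exact: Cinfty_cst.
by apply: CinftyM => //; exact: Cinfty_sub (cs k).
Qed.

Lemma span_der P Q f a : {subset P <= Q} ->
  (forall k, P k -> in_span Q (der a (Y k))) -> in_span P f -> in_span Q (der a f).
Proof.
have uo := upper_open Wo; have WW : upper W `<=` W by move=> u [].
move=> PQ HP [c cs cE].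
have H : in_span Q (fun u => \sum_(k <- index_enum K) ((P k)%:R * (der a (c k) u * Y k u) +
     (P k)%:R * (c k u * der a (Y k) u))).
  apply: span_sum => k; have [Pk|_] := boolP (P k); last first.
    by apply: span_eq (span0 _) => u _; rewrite !mul0r addr0.
  apply: spanD; apply: spanZ; apply: spanM => //; try exact: Cinfty_der.
    by apply: span_gen; apply: PQ.
  exact: HP.
apply: span_eq H => u Wu.
rewrite (der_eq (h := fun u => \sum_(k <- index_enum K) (P k)%:R * (c k u * Y k u)) _ uo Wu).
  symmetry; apply: has_der_derE; apply: has_der_sum => k; rewrite -mulrDr -[_ * (_ + _)]add0r.
  rewrite -[X in X + _](mul0r (c k u * Y k u)); apply: has_derM; first exact: has_der_cst.
  apply: has_derM; first by apply: (Cinfty_has_der _ (cs k)); exact: WW.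
  exact: (Cinfty_has_der _ (Ys k)).
by move=> v Wv; rewrite cE // [LHS]big_mkcond; apply: eq_bigr => k _; case: (P k); rewrite ?mul1r ?mul0r.
Qed.

(** Closure under the single derivative in the direction 0 is enough: it is a linear system along
    each slice. *)
Lemma closed_span_extend (u0 : V) : u0 0 0 = 0 -> W u0 ->
  (forall k, in_span predT (der 0 (Y k))) ->
  exists (O : set V) (h : K -> V -> R),
    [/\ open O, O u0, O `<=` W, forall k, Cinfty O (h k) &
     forall k u, upper O u -> h k u = Y k u].
Proof.
move=> u00 Wu0 H.
pose c k j := sval (cid2 (H k)) j.
have cs k j : Cinfty W (c k j) by rewrite /c; case: cid2.
have cE k u : upper W u -> der 0 (Y k) u = \sum_j c k j u * Y j u.
  by rewrite /c; case: cid2 => /= d _; apply.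
have [|||O [h [Oo Ou0 OW hs hE]]] := @ode_extend u0 W #|K|
  (fun i j => c (enum_val i) (enum_val j)) (fun i => Y (enum_val i)) u00 Wo Wu0 => //.
  by move=> i u Wu; rewrite cE // (reindex (@enum_val K predT)) //=; exact: onW_bij (enum_val_bij _).
exists O, (fun k => h (enum_rank k)); split=> // k u Ou; by rewrite hE // enum_rankK.
Qed.

End Span.
End ODEExtend.

(** * Prolongation of the metrizability equation to a closed linear system *)

Lemma contract1 (R : realType) (x y z w t : R) :
  x - w - t = y - z - w -> z = t + (y - x).
Proof. lra. Qed.

Lemma contract2 (R : realType) (k d x y : R) :
  d + x = (k + 1) * d + y -> k * d = x - y.
Proof. lra. Qed.

Section FiniteType.
Variables (R : realType) (n : nat).
Local Notation V := 'rV[R]_n.+1.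
Local Notation I := 'I_n.+1.
Variables (u0 : V) (W : set V) (Pi : I -> I -> I -> V -> R)
  (zeta : I -> I -> V -> R) (lam : I -> V -> R).
Hypotheses (n_gt0 : (0 < n)%N) (u00 : u0 0 0 = 0) (Wo : open W) (Wu0 : W u0)
  (Pis : forall c a b, Cinfty W (Pi c a b))
  (zs : forall b c, Cinfty (upper W) (zeta b c))
  (ls : forall c, Cinfty (upper W) (lam c))
  (zetaD : forall a b c u, upper W u -> der a (zeta b c) u =
     - (\sum_d Pi b a d u * zeta d c u) - (\sum_d Pi c a d u * zeta b d u)
     - (b == a)%:R * lam c u - (c == a)%:R * lam b u).

Let uo := upper_open Wo.

(** [None] stands for the divergence [nu]. The predicates [P0] and [P1] restrict the unknowns to
    [zeta], respectively to [zeta] and [lam], and so record the order reached by the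
    prolongation. *)
Let K : finType := option ((I * I) + I)%type.
Let nu u := \sum_c der c (lam c) u.
Let Y (k : K) : V -> R := match k with
  | Some (inl bc) => zeta bc.1 bc.2 | Some (inr c) => lam c | None => nu end.
Let P0 : pred K := fun k => if k is Some (inl _) then true else false.
Let P1 : pred K := fun k => if k is Some _ then true else false.

Let Ys k : Cinfty (upper W) (Y k).
Proof.
case: k => [[[b c]|c]|] //=; apply: Cinfty_sum => // c; exact: Cinfty_der.
Qed.

Let span := in_span W Y.

Let zeta_P0 b c : span P0 (zeta b c).
Proof. exact: (span_gen Y Wo (k := Some (inl (b, c)))). Qed.
Let lam_P1 c : span P1 (lam c).
Proof. exact: (span_gen Y Wo (k := Some (inr c))). Qed.
Let P01 : {subset P0 <= P1}. Proof. by case=> [[]|]. Qed.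
Let P1T : {subset P1 <= predT}. Proof. by []. Qed.

Let E a b c u := - (\sum_d Pi b a d u * zeta d c u) - (\sum_d Pi c a d u * zeta b d u).

Let E_P0 a b c : span P0 (E a b c).
Proof.
apply: spanB => //; [apply: spanN => //|]; apply: span_sum => // d; apply: spanM => //;
  exact: zeta_P0.
Qed.

Let dzeta a b c u : upper W u ->
  der a (zeta b c) u = E a b c u - (b == a)%:R * lam c u - (c == a)%:R * lam b u.
Proof. exact: zetaD. Qed.

Let dzeta_P1 a b c : span P1 (der a (zeta b c)).
Proof.
apply: (span_eq (f := fun u => E a b c u - (b == a)%:R * lam c u - (c == a)%:R * lam b u)).
  by move=> u Wu; rewrite dzeta.
apply: spanB => //; last by apply: spanZ => //; exact: lam_P1.
apply: spanB => //; first exact: (span_sub Wo P01 (E_P0 a b c)).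
by apply: spanZ => //; exact: lam_P1.
Qed.

Let dP0 f a : span P0 f -> span P1 (der a f).
Proof.
move=> Hf; apply: (span_der Wo Ys P01 _ Hf) => -[[[b c]|c]|] //= _.
exact: dzeta_P1.
Qed.

Let sm P f : span P f -> Cinfty (upper W) f.
Proof. exact: span_smooth. Qed.

(** What remains of d_a d_b zeta^(bc) = d_b d_a zeta^(bc), summed over b, besides the derivatives of
    [lam]. It differentiates combinations of [zeta] once and is therefore linear in [zeta] and
    [lam]. *)
Let G a c u := \sum_b (der a (E b b c) u - der b (E a b c) u).

Let G_P1 a c : span P1 (G a c).
Proof. by apply: span_sum => // b; apply: spanB => //; apply: dP0; exact: E_P0. Qed.

Let hder f a u : Cinfty (upper W) f -> upper W u -> has_der f u (unit_vec R a) (der a f u).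
Proof. by move=> H Wu; exact: (Cinfty_has_der a H Wu). Qed.

Let ddzeta e a b c u : upper W u -> der e (der a (zeta b c)) u =
  der e (E a b c) u - (b == a)%:R * der e (lam c) u - (c == a)%:R * der e (lam b) u.
Proof.
move=> Wu; rewrite (der_eq e uo Wu (fun v Wv => dzeta a b c Wv)).
apply: has_der_derE; apply: has_derB; last first.
  by rewrite -[X in has_der _ _ _ X]add0r -[X in X + _](mul0r (lam b u));
    apply: has_derM; [exact: has_der_cst|exact: hder].
apply: has_derB; first by apply: hder => //; exact: sm (E_P0 a b c).
by rewrite -[X in has_der _ _ _ X]add0r -[X in X + _](mul0r (lam c u));
    apply: has_derM; [exact: has_der_cst|exact: hder].
Qed.

(* Contracting the integrability condition of the first-order equations for
   [zeta] determines the derivatives of [lam] up to the divergence [nu]. *)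
Let dlam a c u : upper W u ->
  n.+1%:R * der a (lam c) u = (c == a)%:R * nu u + G a c u.
Proof.
move=> Wu.
have H : \sum_b der b (der a (zeta b c)) u = \sum_b der a (der b (zeta b c)) u.
  by apply: eq_bigr => b _; exact: (schwarz _ _ uo Wu (zs b c 2%N)).
have L : \sum_b der b (der a (zeta b c)) u =
    \sum_b der b (E a b c) u - der a (lam c) u - (c == a)%:R * nu u.
  rewrite (eq_bigr _ (fun b _ => ddzeta b a b c Wu)).
  by rewrite !sumrB (sum_delta a (fun b => der b (lam c) u)) -mulr_sumr.
have Rr : \sum_b der a (der b (zeta b c)) u =
    \sum_b der a (E b b c) u - n.+1%:R * der a (lam c) u - der a (lam c) u.
  rewrite (eq_bigr _ (fun b _ => ddzeta a b b c Wu)).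
  under eq_bigr do rewrite eqxx mul1r eq_sym.
  by rewrite !sumrB (sum_delta c (fun b => der a (lam b) u)) sumr_const card_ord mulr_natl.
rewrite /G sumrB; exact: contract1 (etrans (esym L) (etrans H Rr)).
Qed.

Let m0 : n.+1%:R != 0 :> R. Proof. by rewrite pnatr_eq0. Qed.

Let dlam_P2 a c : span predT (der a (lam c)).
Proof.
apply: (span_eq (f := fun u => n.+1%:R^-1 * ((c == a)%:R * nu u + G a c u))).
  by move=> u Wu; rewrite -dlam // mulKf.
apply: spanZ => //; apply: spanD => //; last exact: (span_sub Wo P1T (G_P1 a c)).
by apply: spanZ => //; exact: (span_gen Y Wo (k := None)).
Qed.

Let dP1 f a : span P1 f -> span predT (der a f).
Proof.
move=> Hf; apply: (span_der Wo Ys P1T _ Hf) => -[[[b c]|c]|] //= _; last exact: dlam_P2.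
exact: (span_sub Wo P1T (dzeta_P1 a b c)).
Qed.

Let ddlam e a c u : upper W u ->
  n.+1%:R * der e (der a (lam c)) u = (c == a)%:R * der e nu u + der e (G a c) u.
Proof.
move=> Wu; have sn := Ys None.
have <- : der e (fun u => n.+1%:R * der a (lam c) u) u = n.+1%:R * der e (der a (lam c)) u.
  apply: has_der_derE; rewrite -[X in has_der _ _ _ X]add0r.
  rewrite -[X in X + _](mul0r (der a (lam c) u)).
  by apply: has_derM; [exact: has_der_cst|apply: hder => //; exact: Cinfty_der].
rewrite (der_eq e uo Wu (fun v Wv => dlam a c Wv)).
apply: has_der_derE; apply: has_derD; last by apply: hder => //; exact: sm (G_P1 a c).
rewrite -[X in has_der _ _ _ X]add0r -[X in X + _](mul0r (nu u)).
by apply: has_derM; [exact: has_der_cst|exact: hder].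
Qed.

(** The divergence over c of the formula for (n+1) d_a lam^c has [nu] term d_a nu, while
    differentiating its trace gives (n+1) d_a nu. Second derivatives of [lam] commute, so the two
    results are equal. *)
Let dnu a u : upper W u ->
  n%:R * der a nu u = \sum_c (der c (G a c) u - der a (G c c) u).
Proof.
move=> Wu.
have H : \sum_c n.+1%:R * der c (der a (lam c)) u = \sum_c n.+1%:R * der a (der c (lam c)) u.
  apply: eq_bigr => c _.
  exact: (congr1 (fun x => n.+1%:R * x) (schwarz c a uo Wu (ls c 2%N))).
have L : \sum_c n.+1%:R * der c (der a (lam c)) u = der a nu u + \sum_c der c (G a c) u.
  rewrite (eq_bigr _ (fun c _ => ddlam c a c Wu)).
  rewrite big_split (sum_delta a (fun c => der c nu u)).
  reflexivity.
have Rr : \sum_c n.+1%:R * der a (der c (lam c)) u =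
    n.+1%:R * der a nu u + \sum_c der a (G c c) u.
  rewrite (eq_bigr _ (fun c _ => ddlam a c c Wu)).
  under eq_bigr do rewrite eqxx mul1r.
  rewrite big_split sumr_const card_ord -[X in X + _ = _]mulr_natl.
  reflexivity.
rewrite sumrB; apply: contract2; rewrite natr1; exact: (etrans (esym L) (etrans H Rr)).
Qed.

Let nn0 : n%:R != 0 :> R. Proof. by rewrite pnatr_eq0 -lt0n. Qed.

(** The extension of [nu] is returned as well, since it enters the last entry of L. *)
Lemma metrizability_extend : exists (O : set V) (hz : I -> I -> V -> R)
    (hl : I -> V -> R) (hn : V -> R),
  [/\ [/\ open O, O u0 & O `<=` W],
    [/\ forall b c, Cinfty O (hz b c), forall c, Cinfty O (hl c) & Cinfty O hn] &
    forall u, upper O u -> [/\ forall b c, hz b c u = zeta b c u,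
      forall c, hl c u = lam c u & hn u = \sum_c der c (lam c) u]].
Proof.
have [|O [h [Oo Ou0 OW hs hE]]] := closed_span_extend Wo Ys u00 Wu0.
  case=> [[[b c]|c]|] /=.
  - exact: (span_sub Wo P1T (dzeta_P1 0 b c)).
  - exact: dlam_P2.
  - apply: (span_eq (f := fun u => n%:R^-1 * \sum_c (der c (G 0 c) u - der 0 (G c c) u))).
      by move=> u Wu; rewrite -dnu // mulKf.
    by apply: spanZ => //; apply: span_sum => // c; apply: spanB => //; apply: dP1; exact: G_P1.
exists O, (fun b c => h (Some (inl (b, c)))), (fun c => h (Some (inr c))), (h None).
split; [by split|by split|]; move=> u Ou; split=> [b c|c|];
  [exact: (hE (Some (inl (b, c))) u Ou)|exact: (hE (Some (inr c)) u Ou)|exact: (hE None u Ou)].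
Qed.

End FiniteType.

(** * Metrics on an open set *)

#[global] Opaque der.

(** * Calculus of matrix-valued functions *)

Section MatrixCalculus.
Variables (R : realType) (n : nat).
Local Notation V := 'rV[R]_n.+1.
Implicit Types (O : set V) (u v : V) (f : V -> R).

Definition smoothM p q O (M : V -> 'M[R]_(p, q)) :=
  forall i j, Cinfty O (fun v => M v i j).

Definition dM p q a (M : V -> 'M[R]_(p, q)) u : 'M[R]_(p, q) :=
  \matrix_(i, j) der a (fun v => M v i j) u.

Lemma dME p q a (M : V -> 'M[R]_(p, q)) u i j :
  dM a M u i j = der a (fun v => M v i j) u.
Proof. exact: mxE. Qed.

#[local] Opaque dM.

Lemma der_ext f h a u : f =1 h -> der a f u = der a h u.
Proof. by move=> /funext ->. Qed.

Lemma der_cst O a (c : R) u : der a (fun _ : V => c) u = 0.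
Proof. exact: (has_der_derE (has_der_cst _ _ _)). Qed.

Section Rules.
Variables (O : set V) (Oo : open O).

Lemma derD f h a u : O u -> Cinfty O f -> Cinfty O h ->
  der a (fun v => f v + h v) u = der a f u + der a h u.
Proof.
by move=> Ou Hf Hh; apply: has_der_derE; apply: has_derD; exact: (Cinfty_has_der (O := O)).
Qed.

Lemma derM f h a u : O u -> Cinfty O f -> Cinfty O h ->
  der a (fun v => f v * h v) u = der a f u * h u + f u * der a h u.
Proof.
by move=> Ou Hf Hh; apply: has_der_derE; apply: has_derM; exact: (Cinfty_has_der (O := O)).
Qed.

Lemma derZ f (c : R) a u : O u -> Cinfty O f ->
  der a (fun v => c * f v) u = c * der a f u.
Proof.
move=> Ou Hf; have := @derM (fun=> c) f a u Ou (Cinfty_cst c Oo) Hf.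
by rewrite (der_cst O) mul0r add0r.
Qed.

Lemma der_sum (I : Type) (r : seq I) (F : I -> V -> R) a u : O u ->
  (forall i, Cinfty O (F i)) ->
  der a (fun v => \sum_(i <- r) F i v) u = \sum_(i <- r) der a (F i) u.
Proof.
move=> Ou HF; apply: has_der_derE; apply: has_der_sum => i.
exact: (Cinfty_has_der (O := O)).
Qed.

Lemma smoothM_mul p q s (A : V -> 'M[R]_(p, q)) (B : V -> 'M[R]_(q, s)) :
  smoothM O A -> smoothM O B -> smoothM O (fun v => A v *m B v).
Proof.
move=> HA HB i j; apply: (@Cinfty_eq _ _ _ (fun v => \sum_k A v i k * B v k j)) => //.
  by move=> v _; rewrite mxE.
by apply: Cinfty_sum => // k; exact: CinftyM.
Qed.

Lemma smoothM_scale p q f (A : V -> 'M[R]_(p, q)) :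
  Cinfty O f -> smoothM O A -> smoothM O (fun v => f v *: A v).
Proof.
move=> Hf HA i j; apply: (@Cinfty_eq _ _ _ (fun v => f v * A v i j)) => //.
  by move=> v _; rewrite mxE.
exact: CinftyM.
Qed.

Lemma smoothM_tr p q (A : V -> 'M[R]_(p, q)) : smoothM O A -> smoothM O (fun v => (A v)^T).
Proof.
move=> HA i j; apply: (@Cinfty_eq _ _ _ (fun v => A v j i)) => //.
by move=> v _; rewrite mxE.
Qed.

Lemma smoothM_cst p q (A : 'M[R]_(p, q)) : smoothM O (fun=> A).
Proof. by move=> i j; exact: Cinfty_cst. Qed.

Lemma smoothM_eq p q (A B : V -> 'M[R]_(p, q)) : (forall v, O v -> A v = B v) ->
  smoothM O A -> smoothM O B.
Proof.
by move=> AB HA i j; apply: (Cinfty_eq Oo _ (HA i j)) => v Ov; rewrite AB.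
Qed.

Lemma smoothM_dM p q a (A : V -> 'M[R]_(p, q)) : smoothM O A -> smoothM O (dM a A).
Proof.
move=> HA i j; apply: (@Cinfty_eq _ _ _ (der a (fun v => A v i j))) => //.
  by move=> v _; rewrite mxE.
exact: Cinfty_der.
Qed.

Lemma smooth_det p (A : V -> 'M[R]_p) : smoothM O A -> Cinfty O (fun v => \det (A v)).
Proof.
move=> HA; apply: Cinfty_sum => // s; apply: CinftyM => //; first exact: Cinfty_cst.
by apply: Cinfty_prod => // i; exact: HA.
Qed.

(** By Cramer's rule the inverse is the adjugate, polynomial in the entries, divided by the
    determinant. *)
Lemma smoothM_inv p (A : V -> 'M[R]_p) : (forall v, O v -> A v \in unitmx) ->
  smoothM O A -> smoothM O (fun v => invmx (A v)).
Proof.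
move=> Au HA.
have d0 v : O v -> \det (A v) != 0 by move=> /Au; rewrite unitmxE unitfE.
apply: (@smoothM_eq _ _ (fun v => (\det (A v))^-1 *: \adj (A v))).
  by move=> v Ov; rewrite /invmx Au.
apply: smoothM_scale; first by apply: Cinfty_inv => //; exact: smooth_det.
move=> i j; apply: (@Cinfty_eq _ _ _ (fun v => (-1) ^+ (j + i) * \det (row' j (col' i (A v))))) => //.
  by move=> v _; rewrite mxE.
apply: CinftyM => //; first exact: Cinfty_cst.
apply: smooth_det => k l; apply: (@Cinfty_eq _ _ _ (fun v => A v (lift j k) (lift i l))) => //.
by move=> v _; rewrite !mxE.
Qed.

Lemma dM_eq p q a (A B : V -> 'M[R]_(p, q)) u : O u -> (forall v, O v -> A v = B v) ->
  dM a A u = dM a B u.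
Proof.
move=> Ou AB; apply/matrixP => i j; rewrite !mxE; apply: (der_eq a Oo Ou) => v Ov.
by rewrite AB.
Qed.

Lemma dM_cst p q a (A : 'M[R]_(p, q)) u : dM a (fun=> A) u = 0.
Proof. by apply/matrixP => i j; rewrite !mxE (der_cst O). Qed.

Lemma dM_mul p q s a (A : V -> 'M[R]_(p, q)) (B : V -> 'M[R]_(q, s)) u : O u ->
  smoothM O A -> smoothM O B ->
  dM a (fun v => A v *m B v) u = dM a A u *m B u + A u *m dM a B u.
Proof.
move=> Ou HA HB; apply/matrixP => i j; rewrite !mxE -big_split /=.
have -> : (fun v => (A v *m B v) i j) = (fun v => \sum_k A v i k * B v k j).
  by apply/funext => v; rewrite mxE.
rewrite der_sum //; last by move=> k; exact: CinftyM.
by apply: eq_bigr => k _; rewrite derM // !mxE.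
Qed.

Lemma dM_add p q a (A B : V -> 'M[R]_(p, q)) u : O u -> smoothM O A -> smoothM O B ->
  dM a (fun v => A v + B v) u = dM a A u + dM a B u.
Proof.
move=> Ou HA HB; apply/matrixP => i j; rewrite !mxE -derD //.
by apply: der_ext => v; rewrite mxE.
Qed.

Lemma dM_scale p q a f (A : V -> 'M[R]_(p, q)) u : O u -> Cinfty O f -> smoothM O A ->
  dM a (fun v => f v *: A v) u = der a f u *: A u + f u *: dM a A u.
Proof.
move=> Ou Hf HA; apply/matrixP => i j; rewrite !mxE -derM //.
by apply: der_ext => v; rewrite mxE.
Qed.

Lemma dM_tr p q a (A : V -> 'M[R]_(p, q)) u : dM a (fun v => (A v)^T) u = (dM a A u)^T.
Proof.
by apply/matrixP => i j; rewrite !mxE; apply: der_ext => v; rewrite mxE.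
Qed.

Lemma dM_inv p a (A : V -> 'M[R]_p) u : O u -> (forall v, O v -> A v \in unitmx) ->
  smoothM O A -> dM a (fun v => invmx (A v)) u = - (invmx (A u) *m dM a A u *m invmx (A u)).
Proof.
move=> Ou Au HA; have HI := smoothM_inv Au HA.
have : dM a (fun v => A v *m invmx (A v)) u = 0.
  rewrite (@dM_eq _ _ _ _ (fun=> 1%:M)) ?dM_cst // => v Ov.
  by rewrite mulmxV // Au.
rewrite dM_mul // => /eqP; rewrite addrC addr_eq0 => /eqP H.
by rewrite -[LHS](mulKmx (Au u Ou)) H mulmxN mulmxA.
Qed.

Lemma dM_schwarz p q a b (A : V -> 'M[R]_(p, q)) u : O u -> smoothM O A ->
  dM a (dM b A) u = dM b (dM a A) u.
Proof.
move=> Ou HA; apply/matrixP => i j.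
apply: (etrans (dME a (dM b A) u i j)); apply: (etrans (der_ext a u (fun v => dME b A v i j))).
apply: (etrans _ (esym (dME b (dM a A) u i j))).
apply: (etrans _ (esym (der_ext b u (fun v => dME a A v i j)))).
exact (schwarz a b Oo Ou (HA i j 2%N)).
Qed.

End Rules.

Lemma has_der_prod (I : eqType) (r : seq I) (F : I -> V -> R) u v (l : I -> R) :
  uniq r -> (forall i, has_der (F i) u v (l i)) ->
  has_der (fun x => \prod_(i <- r) F i x) u v
    (\sum_(i <- r) l i * \prod_(j <- r | j != i) F j u).
Proof.
move=> + Fl; elim: r => [_|i r IH].
  under eq_fun do rewrite big_nil; rewrite big_nil; exact: has_der_cst.
rewrite cons_uniq => /andP[ir /IH{}IH].
under eq_fun do rewrite big_cons.
rewrite big_cons big_cons eqxx /=.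
have -> : \prod_(j <- r | j != i) F j u = \prod_(j <- r) F j u.
  rewrite big_seq_cond [RHS]big_seq_cond; apply: eq_bigl => j.
  by rewrite andbT; case: eqVneq => [->|]; rewrite ?(negPf ir) ?andbT.
have -> : \sum_(k <- r) l k * \prod_(j <- i :: r | j != k) F j u =
    F i u * \sum_(k <- r) l k * \prod_(j <- r | j != k) F j u.
  rewrite mulr_sumr big_seq [RHS]big_seq; apply: eq_bigr => k kr.
  rewrite big_cons; case: eqVneq => [ik|_]; first by rewrite ik kr in ir.
  by rewrite mulrCA.
exact: has_derM.
Qed.

(** Jacobi's formula. The Leibniz expansion is differentiated row by row; each term is the
    determinant with one row replaced by its derivative, expanded along that row. *)
Lemma der_det O p a (A : V -> 'M[R]_p) u : open O -> O u -> smoothM O A ->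
  der a (fun v => \det (A v)) u = \tr (\adj (A u) *m dM a A u).
Proof.
move=> Oo Ou HA; apply: has_der_derE.
have H : has_der (fun v => \det (A v)) u (unit_vec R a)
   (\sum_(s : 'S_p) (-1) ^+ s * \sum_i der a (fun v => A v i (s i)) u *
      \prod_(j | j != i) A u j (s j)).
  apply: has_der_sum => s; rewrite -[X in has_der _ _ _ X]add0r.
  rewrite -[X in X + _](mul0r (\prod_i A u i (s i))); apply: has_derM.
    exact: has_der_cst.
  apply: (@has_der_prod _ _ (fun i v => A v i (s i)) u (unit_vec R a)
    (fun i => der a (fun v => A v i (s i)) u)); first exact: index_enum_uniq.
  by move=> i; exact: (Cinfty_has_der _ (HA i (s i))).
suff E' : \sum_(s : 'S_p) (-1) ^+ s * \sum_i der a (fun v => A v i (s i)) u *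
      \prod_(j | j != i) A u j (s j) = \tr (\adj (A u) *m dM a A u) by rewrite -E'.
have E i : \sum_(s : 'S_p) (-1) ^+ s * (der a (fun v => A v i (s i)) u *
      \prod_(j | j != i) A u j (s j)) = \sum_j dM a A u i j * cofactor (A u) i j.
  pose B := \matrix_(k, j) if k == i then dM a A u i j else A u k j.
  have -> : \sum_j dM a A u i j * cofactor (A u) i j = \det B.
    rewrite (expand_det_row B i); apply: eq_bigr => j _.
    have -> : B i j = dM a A u i j by rewrite mxE eqxx.
    congr (_ * _).
    congr (_ * \det _); apply/matrixP => k l; rewrite !mxE.
    by rewrite eq_sym (negPf (neq_lift _ _)).
  apply: eq_bigr => s _; congr (_ * _); rewrite [RHS](bigD1 i) //=; congr (_ * _).
    by rewrite mxE eqxx dME.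
  by apply: eq_bigr => j /negPf ji; rewrite mxE ji.
under eq_bigr do rewrite mulr_sumr.
rewrite exchange_big /=; under eq_bigr do rewrite E.
rewrite exchange_big /=; apply: eq_bigr => j _; rewrite mxE; apply: eq_bigr => i _.
by rewrite [in RHS]mxE mulrC.
Qed.

Lemma der_det_unit O p a (A : V -> 'M[R]_p) u : open O -> O u -> smoothM O A ->
  A u \in unitmx -> der a (fun v => \det (A v)) u = \det (A u) * \tr (invmx (A u) *m dM a A u).
Proof.
move=> Oo Ou HA Au; rewrite (der_det _ Oo) //.
have d0 : \det (A u) != 0 by move: Au; rewrite unitmxE unitfE.
by rewrite /invmx Au -scalemxAl mxtraceZ mulVKf.
Qed.

(** Replacing the absolute value by a square makes powers of |f| visibly smooth where f does not
    vanish, whatever its sign. *)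
Lemma abs_powRE (x p : R) : `|x| `^ p = (x ^+ 2) `^ (p / 2).
Proof.
rewrite -[x ^+ 2]real_normK ?num_real // -powR_mulrn //.
by rewrite -powRrM mulrC divfK.
Qed.

Lemma smooth_abs_powR O f (p : R) : open O -> (forall u, O u -> f u != 0) ->
  Cinfty O f -> Cinfty O (fun u => `|f u| `^ p).
Proof.
move=> Oo f0 Hf; apply: (@Cinfty_eq _ _ _ (fun u => (f u * f u) `^ (p / 2))) => //.
  by move=> u _; rewrite abs_powRE expr2.
apply: Cinfty_powR => //; last exact: CinftyM.
by move=> u Ou; rewrite -expr2 exprn_even_gt0 //= f0.
Qed.

Lemma der_abs_powR O f (p : R) a u : open O -> O u -> f u != 0 ->
  Cinfty O f -> der a (fun u => `|f u| `^ p) u = p * (der a f u / f u) * `|f u| `^ p.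
Proof.
move=> Oo Ou fu0 Hf.
have -> : (fun u => `|f u| `^ p) = (fun u => (f u * f u) `^ (p / 2)).
  by apply/funext => v; rewrite abs_powRE expr2.
have ff : 0 < f u * f u by rewrite -expr2 exprn_even_gt0 //= fu0.
apply: has_der_derE; have D := Cinfty_has_der a Hf Ou.
have H := has_der_comp1 (f := fun x => x `^ (p / 2)) (h := fun v => f v * f v)
  (u := u) (v := unit_vec R a) (l := p / 2 * (f u * f u) `^ (p / 2 - 1)) _ (has_derM D D).
suff -> : p * (der a f u / f u) * `|f u| `^ p =
   p / 2 * (f u * f u) `^ (p / 2 - 1) * (der a f u * f u + f u * der a f u).
  by apply: H; apply/has_der_is_derive; exact: is_derive1_powR.
have ff0 : f u * f u != 0 by rewrite gt_eqF.
rewrite powRB ?ff0 ?implybT // powRr1 ?ltW // abs_powRE expr2.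
by move: ((f u * f u) `^ _) => X; field.
Qed.

End MatrixCalculus.

(** * The Levi-Civita connection, its projective invariants and L in coordinates *)

Lemma koszul_sum (R : realType) (x y z : R) : 2^-1 * (x + y - z + (x + z - y)) = x.
Proof. lra. Qed.

Lemma double_halfK (R : realType) (x : R) : x = 2^-1 * (x + x).
Proof. lra. Qed.

Lemma log_hessian_cancel (R : realType) (x y p q t : R) : t != 0 ->
  2 * (x + 2 * p * q) * t = 2 * (y + 2 * q * p) * t -> x = y.
Proof.
move=> t0 /(mulIf t0) H; have t2 : (2 : R) != 0 by rewrite pnatr_eq0.
by apply: (addIr (2 * p * q)); rewrite (mulfI t2 H); ring.
Qed.

Lemma ricci_collect (R : realType) (k x y z w q : R) :
  x + w + w - (k + 2) * w + ((k + 2) * (z + 2 * q) - (y + 2 * z + (k + 4) * q)) =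
  x - y + k * (- w + z + q).
Proof. ring. Qed.

Lemma kappa_collect (R : realType) (k x y z w : R) : k != 0 -> k + 1 != 0 ->
  (k + 1)^-1 * (k^-1 * x - y + z + w) + w =
  (k * (k + 1))^-1 * x - (k + 1)^-1 * (- z - (k + 2) * w + y).
Proof. by move=> k0 k1; field; rewrite k0 k1. Qed.

Section LocalMetric.
Variables (R : realType) (n : nat).
Local Notation V := 'rV[R]_n.+1.
Local Notation I := 'I_n.+1.
Implicit Types (u v : V) (a b c d e k : I).

Lemma pd_open (O : set V) f a u : open O -> O `<=` half_space (n := n) -> O u -> Cinfty O f ->
  pd a f u = der a f u.
Proof.
move=> Oo Oh Ou Hf; apply: (pd_der Oo Ou) => //; first exact: Oh.
by case: (Cinfty_has_der a Hf Ou).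
Qed.

(** The quadratic part of the Ricci curvature for coefficients split into a trace-free part [P] and
    a form [y]. In the coefficient n + 4 of y_a y_b, the full trace of the identity contributes n +
    1 and three other pairings of Kronecker deltas contribute 1 each. *)
Lemma ricci_quad (P : I -> I -> I -> R) (y : I -> R) a b :
  (forall c a b, P c a b = P c b a) -> (forall a, \sum_k P k k a = 0) ->
  \sum_k \sum_e (P k a e + (k == a)%:R * y e + (k == e)%:R * y a) *
     (P e k b + (e == k)%:R * y b + (e == b)%:R * y k) =
  \sum_k \sum_e P k a e * P e k b + 2 * \sum_e y e * P e a b + (n%:R + 4) * (y a * y b).
Proof.
move=> Psym Ptr.
have inner k : \sum_e (P k a e + (k == a)%:R * y e + (k == e)%:R * y a) *
     (P e k b + (e == k)%:R * y b + (e == b)%:R * y k) =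
   \sum_e P k a e * P e k b + P k k a * y b + y k * P k a b +
   (k == a)%:R * (\sum_e y e * P e k b) + (k == a)%:R * (y k * y b) +
   (k == a)%:R * (y b * y k) + P k k b * y a + y a * y b + (k == b)%:R * (y a * y k).
  have -> : \sum_e (P k a e + (k == a)%:R * y e + (k == e)%:R * y a) *
     (P e k b + (e == k)%:R * y b + (e == b)%:R * y k) =
    \sum_e (P k a e * P e k b + (e == k)%:R * (P k a e * y b) + (e == b)%:R * (y k * P k a e) +
      (k == a)%:R * (y e * P e k b) + (e == k)%:R * ((k == a)%:R * (y e * y b)) +
      (e == b)%:R * ((k == a)%:R * (y e * y k)) + (e == k)%:R * (P e k b * y a) +
      (e == k)%:R * ((e == k)%:R * (y a * y b)) + (e == k)%:R * ((e == b)%:R * (y a * y k))).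
    by apply: eq_bigr => e _; rewrite (eq_sym k e); ring.
  rewrite !big_split /= -mulr_sumr.
  rewrite (sum_delta k (fun e => P k a e * y b)) (sum_delta b (fun e => y k * P k a e)).
  rewrite (sum_delta k (fun e => (k == a)%:R * (y e * y b))).
  rewrite (sum_delta b (fun e => (k == a)%:R * (y e * y k))).
  rewrite (sum_delta k (fun e => P e k b * y a)).
  rewrite (sum_delta k (fun e => (e == k)%:R * (y a * y b))).
  by rewrite (sum_delta k (fun e => (e == b)%:R * (y a * y k))) eqxx mul1r (Psym k a k).
under eq_bigr do rewrite inner.
rewrite !big_split /= -!mulr_suml !Ptr !mul0r !addr0.
rewrite (sum_delta a (fun k => \sum_e y e * P e k b)).
rewrite (sum_delta a (fun k => y k * y b)) (sum_delta a (fun k => y b * y k)).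
rewrite (sum_delta b (fun k => y a * y k)) sumr_const card_ord -[y a *+ _]mulr_natr -natr1.
ring.
Qed.

Section Metric.
Variables (O : set V) (g : V -> 'M[R]_n.+1).
Hypotheses (Oo : open O) (Oh : O `<=` half_space (n := n)) (gs : smoothM O g)
  (gsym : forall u, O u -> (g u)^T = g u) (gunit : forall u, O u -> g u \in unitmx).

Let gis : smoothM O (fun u => invmx (g u)). Proof. exact: smoothM_inv. Qed.

Lemma metric_sym u a b : O u -> g u a b = g u b a.
Proof. by move=> Ou; rewrite -[in LHS](gsym Ou) mxE. Qed.

Lemma inv_metric_sym u : O u -> (invmx (g u))^T = invmx (g u).
Proof. by move=> Ou; rewrite trmx_inv gsym. Qed.

Lemma der_metric_sym c u a b : O u -> der c (fun v => g v a b) u = der c (fun v => g v b a) u.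
Proof. by move=> Ou; apply: (der_eq c Oo Ou) => v Ov; exact: metric_sym. Qed.

Lemma christoffelE c a b u : O u -> christoffel g c a b u =
  2^-1 * \sum_d invmx (g u) c d * (der a (fun v => g v d b) u + der b (fun v => g v a d) u
     - der d (fun v => g v a b) u).
Proof.
move=> Ou; rewrite /christoffel; congr (_ * _); apply: eq_bigr => d _.
by rewrite !(pd_open _ Oo Oh Ou (gs _ _)).
Qed.

Lemma christoffel_smooth c a b : Cinfty O (christoffel g c a b).
Proof.
apply: (Cinfty_eq Oo (fun u Ou => esym (christoffelE c a b Ou))).
apply: CinftyM => //; first exact: Cinfty_cst.
apply: Cinfty_sum => // d; apply: CinftyM => //.
by apply: CinftyB => //; [apply: CinftyD => //|]; exact: Cinfty_der.
Qed.

Lemma christoffel_sym c a b u : O u -> christoffel g c a b u = christoffel g c b a u.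
Proof.
move=> Ou; rewrite !christoffelE //; congr (_ * _); apply: eq_bigr => d _; congr (_ * _).
rewrite (der_metric_sym a d b Ou) (der_metric_sym b d a Ou) (der_metric_sym d a b Ou).
by congr (_ - _); exact: addrC.
Qed.

Definition conn_mx (Gam : conn_coef R n) a u : 'M[R]_n.+1 := \matrix_(c, b) Gam c a b u.

(** The product of [g] with the connection matrix is half the Koszul expression; adding its
    transpose cancels the two terms antisymmetric in the matrix indices. *)
Lemma metric_compat a u : O u ->
  g u *m conn_mx (christoffel g) a u + (conn_mx (christoffel g) a u)^T *m g u = dM a g u.
Proof.
move=> Ou.
pose L : 'M[R]_n.+1 := \matrix_(d, b) (der a (fun v => g v d b) u +
  der b (fun v => g v a d) u - der d (fun v => g v a b) u).
have E : g u *m conn_mx (christoffel g) a u = 2^-1 *: L.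
  have -> : conn_mx (christoffel g) a u = 2^-1 *: (invmx (g u) *m L).
    apply/matrixP => c b; rewrite !mxE christoffelE //; congr (_ * _).
    by apply: eq_bigr => d _; rewrite mxE.
  by rewrite -scalemxAr mulKVmx // gunit.
have E' : (conn_mx (christoffel g) a u)^T *m g u = 2^-1 *: L^T.
  by rewrite -{1}(gsym Ou) -trmx_mul E linearZ.
rewrite E E' -scalerDr; apply/matrixP => d b; rewrite mxE [in LHS]mxE dME.
have -> : L d b = der a (fun v => g v d b) u +
  der b (fun v => g v a d) u - der d (fun v => g v a b) u by rewrite mxE.
have -> : L^T d b = der a (fun v => g v d b) u +
  der d (fun v => g v a b) u - der b (fun v => g v a d) u.
  by rewrite !mxE (der_metric_sym a b d Ou).
exact: koszul_sum.
Qed.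

(** The difference of the two connections, with its upper index lowered by [h], is antisymmetric in
    one pair of indices and symmetric in another, hence zero. *)
Lemma conn_mx_unique (Gam Gam' : I -> 'M[R]_n.+1) (h : 'M[R]_n.+1) : h \in unitmx ->
  h^T = h ->
  (forall a b c, Gam a c b = Gam b c a) -> (forall a b c, Gam' a c b = Gam' b c a) ->
  (forall a, h *m Gam a + (Gam a)^T *m h = h *m Gam' a + (Gam' a)^T *m h) ->
  forall a, Gam a = Gam' a.
Proof.
move=> hu hs S1 S2 E a.
pose D a := Gam a - Gam' a; pose T a b c := (h *m D a) b c.
have Tas x y z : T x y z = - T x z y.
  have : h *m D x + (h *m D x)^T = 0.
    by rewrite trmx_mul hs /D [X in _ + X *m _]linearB /= mulmxBr mulmxBl addrACA -opprD E subrr.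
  by move/matrixP/(_ y z); rewrite mxE [X in _ + X]mxE [in RHS]mxE => /eqP; rewrite addr_eq0 => /eqP.
have Ts x y z : T x y z = T z y x.
  have DE p q r : D p q r = Gam p q r - Gam' p q r by rewrite !mxE.
  by rewrite /T mxE [RHS]mxE; apply: eq_bigr => d _; rewrite !DE S1 S2.
have T0 x y z : T x y z = 0.
  have h1 := Tas x y z; have h2 := Ts x z y; have h3 := Tas y z x.
  have h4 := Ts y x z; have h5 := Tas z x y; have h6 := Ts z y x.
  move: h1 h2 h3 h4 h5 h6.
  move: (T x y z) (T x z y) (T y z x) (T y x z) (T z x y) (T z y x) => *; lra.
have : h *m D a = 0 by apply/matrixP => b c; rewrite [RHS]mxE; exact: T0.
move/(congr1 (mulmx (invmx h))); rewrite mulKmx // mulmx0 => /eqP.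
by rewrite subr_eq0 => /eqP.
Qed.

Lemma trace_conn a u : O u -> \tr (conn_mx (christoffel g) a u) =
  2^-1 * \tr (invmx (g u) *m dM a g u).
Proof.
move=> Ou; rewrite -metric_compat // mulmxDr mulKmx ?gunit // mxtraceD.
rewrite mxtrace_mulC -mulmxA mulmxV ?gunit // mulmx1 mxtrace_tr.
exact: double_halfK.
Qed.

(** The connection form on E(1), where nabla_a = d_a + [gam a]. *)
Definition gam a u := n.+2%:R^-1 * \sum_k christoffel g k k a u.

Lemma gam_trace a u : O u -> n.+2%:R * gam a u = \tr (conn_mx (christoffel g) a u).
Proof.
move=> Ou; rewrite /gam mulrA mulfV ?pnatr_eq0 // mul1r; apply: eq_bigr => k _.
by rewrite mxE christoffel_sym.
Qed.

Lemma gam_smooth a : Cinfty O (gam a).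
Proof.
apply: CinftyM => //; first exact: Cinfty_cst.
by apply: Cinfty_sum => // k; exact: christoffel_smooth.
Qed.

Let det0 u : O u -> \det (g u) != 0.
Proof. by move=> /gunit; rewrite unitmxE unitfE. Qed.

Lemma tau_invE u : (tau g u)^-1 = `|\det (g u)| `^ (n.+2%:R^-1).
Proof.
rewrite /tau /vol -powRN opprK -(powR12_sqrt (normr_ge0 _)) -powRrM.
by rewrite mulrA mulVf ?mul1r // pnatr_eq0.
Qed.

Lemma tau_inv_gt0 u : O u -> 0 < (tau g u)^-1.
Proof. by move=> Ou; rewrite tau_invE powR_gt0 // normr_gt0 det0. Qed.

Lemma tau_inv_smooth : Cinfty O (fun u => (tau g u)^-1).
Proof.
apply: (@Cinfty_eq _ _ _ (fun u => `|\det (g u)| `^ (n.+2%:R^-1))) => //.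
  by move=> u _; rewrite tau_invE.
by apply: smooth_abs_powR => //; exact: smooth_det.
Qed.

(** In invariant terms, tau is parallel for the Levi-Civita connection: the logarithmic derivative
    of |det g| is the trace of g^-1 d_a g, which is twice the trace of the connection matrix. *)
Lemma der_tau_inv a u : O u ->
  der a (fun v => (tau g v)^-1) u = 2 * gam a u * (tau g u)^-1.
Proof.
move=> Ou; rewrite (der_ext a u tau_invE) tau_invE.
rewrite (der_abs_powR _ _ Oo Ou (det0 Ou) (smooth_det Oo gs)).
rewrite (der_det_unit a Oo Ou gs (gunit Ou)) [_ / \det _]mulrC mulKf ?det0 //.
congr (_ * _); have -> : \tr (invmx (g u) *m dM a g u) = 2 * (n.+2%:R * gam a u).
  by rewrite gam_trace // trace_conn // mulVKf // pnatr_eq0.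
by rewrite mulrCA mulKf // pnatr_eq0.
Qed.

Let zeta := tau_inv_metric g.

Lemma zeta_smooth : smoothM O zeta.
Proof. by apply: smoothM_scale => //; exact: tau_inv_smooth. Qed.

Lemma zeta_sym u : O u -> (zeta u)^T = zeta u.
Proof. by move=> Ou; rewrite /zeta /tau_inv_metric linearZ /= inv_metric_sym. Qed.

Lemma dM_zeta a u : O u -> dM a zeta u = (2 * gam a u) *: zeta u -
  (conn_mx (christoffel g) a u *m zeta u + zeta u *m (conn_mx (christoffel g) a u)^T).
Proof.
move=> Ou; rewrite /zeta /tau_inv_metric (dM_scale a Ou tau_inv_smooth gis).
rewrite der_tau_inv // (dM_inv Oo a Ou gunit gs) -metric_compat // scalerA; congr (_ + _).
rewrite scalerN; congr (- _).
rewrite mulmxDr mulmxDl mulKmx ?gunit // -[invmx _ *m _ *m _ in X in _ *: (_ + X)]mulmxA.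
rewrite -mulmxA mulmxV ?gunit // mulmx1 scalerDr scalemxAr; congr (_ + _).
by rewrite -scalemxAl.
Qed.

(* Thomas's projective parameters.  They only depend on the projective class,
   hence are smooth up to the boundary although [christoffel g] is not. *)
Definition thomas c a b u :=
  christoffel g c a b u - (c == a)%:R * gam b u - (c == b)%:R * gam a u.

Lemma thomas_smooth c a b : Cinfty O (thomas c a b).
Proof.
by apply: CinftyB => //; [apply: CinftyB => //; first exact: christoffel_smooth|];
  (apply: CinftyM => //; [exact: Cinfty_cst|exact: gam_smooth]).
Qed.

Lemma thomas_sym c a b u : O u -> thomas c a b u = thomas c b a u.
Proof. by move=> Ou; rewrite /thomas christoffel_sym // addrAC. Qed.

Lemma thomas_trace a u : O u -> \sum_k thomas k k a u = 0.
Proof.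
move=> Ou; rewrite /thomas !sumrB (sum_delta a (fun k => gam k u)).
have -> : \sum_(k : I) (k == k)%:R * gam a u = n.+1%:R * gam a u.
  under eq_bigr do rewrite eqxx mul1r.
  by rewrite sumr_const card_ord mulr_natl.
have -> : \sum_k christoffel g k k a u = n.+2%:R * gam a u.
  by rewrite /gam mulVKf // pnatr_eq0.
by rewrite -natr1; move: (gam a u) => x; ring.
Qed.

Definition lam b u := \sum_c zeta u b c * gam c u.

Lemma lam_smooth b : Cinfty O (lam b).
Proof.
apply: Cinfty_sum => // c; apply: CinftyM => //; last exact: gam_smooth.
exact: (zeta_smooth b c).
Qed.

Lemma zeta_symE u b c : O u -> zeta u b c = zeta u c b.
Proof. by move=> Ou; rewrite -[in LHS](zeta_sym Ou) mxE. Qed.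

(* The metrizability equation of the projective class, with [lam] as the
   prolongation variable. *)
Lemma der_zeta a b c u : O u -> der a (fun v => zeta v b c) u =
  - (\sum_d thomas b a d u * zeta u d c) - (\sum_d thomas c a d u * zeta u b d)
  - (b == a)%:R * lam c u - (c == a)%:R * lam b u.
Proof.
move=> Ou; rewrite -dME dM_zeta //.
(* Once the connection is split into [thomas] and [gam], the terms gam_a zeta from the two indices
   cancel the term 2 gam_a zeta due to the weight, and the contraction of [gam] with [zeta] is
   [lam]. *)
have E b' (F : I -> R) :
    \sum_d christoffel g b' a d u * F d = \sum_d thomas b' a d u * F d +
      (b' == a)%:R * (\sum_d gam d u * F d) + gam a u * F b'.
  rewrite mulr_sumr -big_split /= -(sum_delta b' F) mulr_sumr -big_split /=.
  by apply: eq_bigr => d _; rewrite /thomas [d == b']eq_sym; ring.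
have lamE x (F : I -> R) : (forall d, F d = zeta u x d) -> \sum_d gam d u * F d = lam x u.
  by move=> FE; apply: eq_bigr => d _; rewrite FE mulrC.
have -> : ((2 * gam a u) *: zeta u - (conn_mx (christoffel g) a u *m zeta u +
    zeta u *m (conn_mx (christoffel g) a u)^T)) b c =
   2 * gam a u * zeta u b c - (\sum_d christoffel g b a d u * zeta u d c
     + \sum_d christoffel g c a d u * zeta u b d).
  rewrite mxE [X in X + _]mxE [X in _ + X]mxE [X in - X]mxE; congr (_ - (_ + _)).
    by rewrite mxE; apply: eq_bigr => d _; rewrite mxE.
  by rewrite mxE; apply: eq_bigr => d _; rewrite !mxE mulrC.
rewrite (E b) (E c) (lamE c) => [|d]; last exact: zeta_symE.
rewrite (lamE b) // (zeta_symE _ _ Ou).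
by move: (\sum_d _) (\sum_d _) => X Y; ring.
Qed.


Lemma christoffel_thomas c a b u :
  christoffel g c a b u = thomas c a b u + (c == a)%:R * gam b u + (c == b)%:R * gam a u.
Proof. by rewrite /thomas addrAC subrK subrK. Qed.

(** [gam] is half the logarithmic differential of tau^-1, hence closed. The symmetry is read off the
    second derivatives of tau^-1 itself, without introducing a logarithm. *)
Lemma der_gam_sym a b u : O u -> der a (gam b) u = der b (gam a) u.
Proof.
move=> Ou; pose t v := (tau g v)^-1.
have E c d : der c (der d t) u = 2 * (der c (gam d) u + 2 * gam c u * gam d u) * t u.
  rewrite (der_eq c Oo Ou (fun v Ov => der_tau_inv d Ov)).
  have s2 : Cinfty O (fun v => 2 * gam d v).
    by apply: CinftyM => //; [exact: Cinfty_cst|exact: gam_smooth].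
  rewrite (derM c Ou s2 tau_inv_smooth) (derZ Oo _ c Ou (gam_smooth d)) der_tau_inv //.
  by rewrite /t; ring.
have := schwarz a b Oo Ou (tau_inv_smooth 2%N); rewrite -/t !E.
have t0 : t u != 0 by rewrite gt_eqF // tau_inv_gt0.
exact: log_hessian_cancel.
Qed.

Definition thomas_ricci a b u :=
  \sum_k der k (thomas k a b) u - \sum_k \sum_e thomas k a e u * thomas e k b u.

(** The change of Ricci curvature under the projective change by [gam] that leads from the
    coefficients [thomas] to the Levi-Civita connection. Closedness of [gam] rules out a skew term.
    Only [thomas_ricci] extends to the boundary by itself. *)
Lemma ricciE a b u : O u -> ricci (christoffel g) a b u = thomas_ricci a b u +
  n%:R * (- der a (gam b) u + \sum_e gam e u * thomas e a b u + gam a u * gam b u).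
Proof.
move=> Ou; have cs := christoffel_smooth; have ts := thomas_smooth.
rewrite /ricci /riemann.
have -> : \sum_k (pd k (christoffel g k a b) u - pd a (christoffel g k k b) u +
    \sum_e (christoffel g k k e u * christoffel g e a b u -
             christoffel g k a e u * christoffel g e k b u)) =
  \sum_k der k (christoffel g k a b) u - \sum_k der a (christoffel g k k b) u +
  (\sum_e (\sum_k christoffel g k k e u) * christoffel g e a b u -
   \sum_k \sum_e christoffel g k a e u * christoffel g e k b u).
  have -> : \sum_e (\sum_k christoffel g k k e u) * christoffel g e a b u =
      \sum_k \sum_e christoffel g k k e u * christoffel g e a b u.
    by rewrite exchange_big /=; apply: eq_bigr => e _; rewrite mulr_suml.
  rewrite -!sumrB -big_split /=; apply: eq_bigr => k _.
  by rewrite sumrB !(pd_open _ Oo Oh Ou (cs _ _ _)).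
have tr e : \sum_k christoffel g k k e u = n.+2%:R * gam e u.
  by rewrite /gam mulVKf // pnatr_eq0.
have -> : \sum_k der a (christoffel g k k b) u = n.+2%:R * der a (gam b) u.
  rewrite -(derZ Oo _ a Ou (gam_smooth b)) -(der_sum _ _ Ou (fun k => cs k k b)).
  by apply: der_ext => v; rewrite /gam mulVKf // pnatr_eq0.
have -> : \sum_k der k (christoffel g k a b) u =
   \sum_k der k (thomas k a b) u + der a (gam b) u + der b (gam a) u.
  have gz c d : Cinfty O (fun v => (c == d)%:R * gam b v).
    by apply: CinftyM => //; [exact: Cinfty_cst|exact: gam_smooth].
  have ga c d : Cinfty O (fun v => (c == d)%:R * gam a v).
    by apply: CinftyM => //; [exact: Cinfty_cst|exact: gam_smooth].
  rewrite -(sum_delta a (fun k => der k (gam b) u)) -(sum_delta b (fun k => der k (gam a) u)).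
  rewrite -!big_split /=; apply: eq_bigr => k _.
  rewrite (der_ext k u (christoffel_thomas k a b)).
  rewrite (derD k Ou (CinftyD Oo (ts k a b) (gz k a)) (ga k b)).
  rewrite (derD k Ou (ts k a b) (gz k a)).
  by rewrite (derZ Oo _ k Ou (gam_smooth b)) (derZ Oo _ k Ou (gam_smooth a)).
have -> : \sum_k \sum_e christoffel g k a e u * christoffel g e k b u =
  \sum_k \sum_e thomas k a e u * thomas e k b u + 2 * \sum_e gam e u * thomas e a b u +
   (n%:R + 4) * (gam a u * gam b u).
  rewrite -(ricci_quad (P := fun c a b => thomas c a b u) (fun c => gam c u)).
  - by apply: eq_bigr => k _; apply: eq_bigr => e _; rewrite !christoffel_thomas.
  - by move=> c d e; exact: thomas_sym.
  - by move=> c; exact: thomas_trace.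
have -> : \sum_e (\sum_k christoffel g k k e u) * christoffel g e a b u =
   n.+2%:R * (\sum_e gam e u * thomas e a b u + 2 * (gam a u * gam b u)).
  have -> : 2 * (gam a u * gam b u) = \sum_e (e == a)%:R * (gam e u * gam b u) +
      \sum_e (e == b)%:R * (gam e u * gam a u).
    rewrite (sum_delta a (fun e => gam e u * gam b u)) (sum_delta b (fun e => gam e u * gam a u)).
    by rewrite [gam b u * _]mulrC mulr_natl mulr2n.
  rewrite -!big_split /= mulr_sumr; apply: eq_bigr => e _.
  by rewrite tr christoffel_thomas; ring.
rewrite (der_gam_sym b a Ou) /thomas_ricci -[n.+2]addn2 natrD.
exact: ricci_collect.
Qed.

Let nu u := \sum_c der c (lam c) u.

Lemma divergence_zeta d u : O u -> \sum_c der c (fun v => zeta v c d) u =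
  - (\sum_c \sum_e thomas d c e u * zeta u c e) - n.+2%:R * lam d u.
Proof.
move=> Ou; rewrite (eq_bigr _ (fun c _ => der_zeta c c d Ou)).
under eq_bigr do rewrite eqxx mul1r (eq_sym d).
rewrite !sumrB (sum_delta d (fun c => lam c u)) sumr_const card_ord -mulr_natl sumrN.
have -> : \sum_c \sum_e thomas c c e u * zeta u e d = 0.
  rewrite exchange_big big1 // => e _.
  by rewrite -mulr_suml thomas_trace // mul0r.
by rewrite -[n.+2]addn1 natrD; move: (\sum_c _) (lam d u) => x y; ring.
Qed.

(** The term zeta^(cd) d_c gam_d also occurs in the contraction of [zeta] with the Schouten tensor,
    with the opposite sign; trading it for [nu] removes the derivatives of [gam] from there. *)
Lemma divergence_lam u : O u -> nu u =
  - (\sum_d (\sum_c \sum_e thomas d c e u * zeta u c e) * gam d u)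
  - n.+2%:R * (\sum_d lam d u * gam d u) + \sum_c \sum_d zeta u c d * der c (gam d) u.
Proof.
move=> Ou.
have -> : nu u = \sum_d (\sum_c der c (fun v => zeta v c d) u) * gam d u +
    \sum_c \sum_d zeta u c d * der c (gam d) u.
  under [X in _ = X + _]eq_bigr do rewrite mulr_suml.
  rewrite [X in _ = X + _]exchange_big -big_split /=; apply: eq_bigr => c _.
  rewrite -big_split /= /lam (der_sum _ c Ou); last first.
    by move=> d; apply: CinftyM => //; [exact: (zeta_smooth c d)|exact: gam_smooth].
  by apply: eq_bigr => d _; rewrite (derM c Ou (zeta_smooth c d) (gam_smooth d)).
congr (_ + _); rewrite mulr_sumr -sumrN -sumrB; apply: eq_bigr => d _.
by rewrite divergence_zeta //; ring.
Qed.

(** On the left stands the scalar entry of L in jet coordinates, where gam zeta gam comes from the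
    change of splitting. On the right [gam] has disappeared, and every ingredient extends to the
    boundary. *)
Lemma kappaE u : (0 < n)%N -> O u ->
  n.+1%:R^-1 * (\sum_a \sum_b zeta u a b * proj_schouten (christoffel g) a b u) +
    \sum_a lam a u * gam a u =
  (n%:R * n.+1%:R)^-1 * (\sum_a \sum_b zeta u a b * thomas_ricci a b u) - n.+1%:R^-1 * nu u.
Proof.
move=> n0 Ou; have nn0 : n%:R != 0 :> R by rewrite pnatr_eq0 -lt0n.
have n1 : n%:R + 1 != 0 :> R by rewrite natr1 pnatr_eq0.
have -> : \sum_a \sum_b zeta u a b * proj_schouten (christoffel g) a b u =
  n%:R^-1 * (\sum_a \sum_b zeta u a b * thomas_ricci a b u) -
  \sum_c \sum_d zeta u c d * der c (gam d) u +
  \sum_d (\sum_c \sum_e thomas d c e u * zeta u c e) * gam d u +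
  \sum_a lam a u * gam a u.
  have -> : \sum_d (\sum_c \sum_e thomas d c e u * zeta u c e) * gam d u =
      \sum_a \sum_b zeta u a b * \sum_e gam e u * thomas e a b u.
    under eq_bigr do rewrite mulr_suml; rewrite exchange_big; apply: eq_bigr => c _.
    under eq_bigr do rewrite mulr_suml; rewrite exchange_big; apply: eq_bigr => e _.
    by rewrite mulr_sumr; apply: eq_bigr => d _; ring.
  have -> : \sum_a lam a u * gam a u = \sum_a \sum_b zeta u a b * (gam a u * gam b u).
    by apply: eq_bigr => c _; rewrite mulr_suml; apply: eq_bigr => d _; ring.
  rewrite mulr_sumr -sumrB -!big_split; apply: eq_bigr => c _ /=.
  rewrite mulr_sumr -sumrB -!big_split; apply: eq_bigr => d _ /=.
  by rewrite /proj_schouten ricciE // mulrDr mulKf //; ring.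
rewrite divergence_lam // -[n.+2]addn2 natrD -(natr1 n).
exact: kappa_collect.
Qed.

Definition L_kappa u :=
  n.+1%:R^-1 * (\sum_a \sum_b zeta u a b * proj_schouten (christoffel g) a b u).

Lemma L_blockE u : O u -> L_tau_inv_metric g u =
  block_mx (L_kappa u + \sum_a lam a u * gam a u)%:M (\row_b lam b u)
    (\col_b lam b u) (zeta u).
Proof.
move=> Ou; rewrite /L_tau_inv_metric /tractor_of_triple /splitting.
set G := \col_a (_ * _).
have lG : zeta u *m G = \col_b lam b u.
  by apply/colP => b; rewrite mxE [RHS]mxE; apply: eq_bigr => c _; rewrite [G c 0]mxE.
have Gl : G^T *m zeta u = \row_b lam b u.
  rewrite -{1}(zeta_sym Ou) -trmx_mul lG; apply/rowP => b.
  by rewrite mxE [LHS]mxE [RHS]mxE.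
rewrite tr_block_mx !trmx1 !trmx0 !mulmx_block !mul1mx !mulmx1 !mul0mx !mulmx0 !add0r !addr0.
rewrite Gl lG; congr block_mx; rewrite raddfD /=; congr (_ + _).
apply/matrixP => i j; rewrite !ord1 mxE [RHS]mxE eqxx mulr1n; apply: eq_bigr => c _.
by rewrite [G c 0]mxE [X in X * _]mxE.
Qed.

(* In the Levi-Civita splitting L is block diagonal and the splitting has
   determinant 1; taking the determinant avoids dividing by [tau_inv_metric],
   which may vanish at the boundary. *)
Lemma scalar_curvatureE u : (0 < n)%N -> O u ->
  scalar_curvature g u = n%:R * n.+1%:R * (Num.sg (\det (g u)) * \det (L_tau_inv_metric g u)).
Proof.
move=> n0 Ou; have nn0 : n%:R != 0 :> R by rewrite pnatr_eq0 -lt0n.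
have n1 : n.+1%:R != 0 :> R by rewrite pnatr_eq0.
rewrite /L_tau_inv_metric /tractor_of_triple !det_mulmx det_tr.
have -> : \det (splitting (christoffel g) u) = 1.
  by rewrite /splitting det_lblock !det1 mulr1.
rewrite mul1r mulr1 trmx0 det_lblock det_scalar1 detZ det_inv.
have -> : n.+1%:R^-1 * (\sum_a \sum_b tau_inv_metric g u a b *
    proj_schouten (christoffel g) a b u) = (n%:R * n.+1%:R)^-1 * (tau g u)^-1 * scalar_curvature g u.
  have -> : \sum_a \sum_b tau_inv_metric g u a b * proj_schouten (christoffel g) a b u =
      n%:R^-1 * ((tau g u)^-1 * scalar_curvature g u).
    rewrite /scalar_curvature !mulr_sumr; apply: eq_bigr => a _; rewrite !mulr_sumr.
    by apply: eq_bigr => b _; rewrite /tau_inv_metric mxE /proj_schouten; ring.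
  by rewrite invfM; ring.
(* The scalar slot contributes one factor tau^-1 and det [zeta] contributes n + 1, in total
   tau^-(n+2) = |det g|; against the det g^-1 in det [zeta] only the sign is left. *)
have tt : (tau g u)^-1 * (tau g u)^-1 ^+ n.+1 = `|\det (g u)|.
  rewrite -exprS tau_invE -powR_mulrn ?powR_ge0 // -powRrM mulVf ?pnatr_eq0 // powRr1 //.
have -> : Num.sg (\det (g u)) * ((n%:R * n.+1%:R)^-1 * (tau g u)^-1 * scalar_curvature g u *
    ((tau g u)^-1 ^+ n.+1 * (\det (g u))^-1)) =
   (n%:R * n.+1%:R)^-1 * scalar_curvature g u * (Num.sg (\det (g u)) * ((tau g u)^-1 * (tau g u)^-1 ^+ n.+1) / \det (g u)).
  ring.
rewrite tt -numEsg mulfV ?det0 // mulr1 mulVKf // mulf_neq0 //.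
Qed.

End Metric.
End LocalMetric.

(** * Extension in coordinates near a boundary point *)

Section LocalExtension.
Variables (R : realType) (n : nat).
Local Notation V := 'rV[R]_n.+1.
Local Notation I := 'I_n.+1.
Implicit Types (u v : V) (a b c d e k : I).

Lemma smoothM_block p q r s (O : set V) (A : V -> 'M[R]_(p, q)) (B : V -> 'M[R]_(p, r))
    (C : V -> 'M[R]_(s, q)) (D : V -> 'M[R]_(s, r)) :
  smoothM O A -> smoothM O B -> smoothM O C -> smoothM O D ->
  smoothM O (fun v => block_mx (A v) (B v) (C v) (D v)).
Proof.
move=> HA HB HC HD i j; case: (splitP i) => i' Hi; case: (splitP j) => j' Hj.
- have -> : i = lshift _ i' by apply/val_inj.
  have -> : j = lshift _ j' by apply/val_inj.
  by under eq_fun do rewrite block_mxEul; exact: HA.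
- have -> : i = lshift _ i' by apply/val_inj.
  have -> : j = rshift _ j' by apply/val_inj.
  by under eq_fun do rewrite block_mxEur; exact: HB.
- have -> : i = rshift _ i' by apply/val_inj.
  have -> : j = lshift _ j' by apply/val_inj.
  by under eq_fun do rewrite block_mxEdl; exact: HC.
- have -> : i = rshift _ i' by apply/val_inj.
  have -> : j = rshift _ j' by apply/val_inj.
  by under eq_fun do rewrite block_mxEdr; exact: HD.
Qed.

(** The upper half of a ball is convex, and by the intermediate value theorem [f] cannot change sign
    along a segment without vanishing. *)
Lemma sign_const (u0 : V) (r : R) (f : V -> R) u v : 0 < r ->
  let B := upper [set w | `|w - u0| < r] in
  Cinfty B f -> (forall w, B w -> f w != 0) -> B u -> B v -> Num.sg (f u) = Num.sg (f v).
Proof.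
move=> r0 B fs f0 Bu Bv.
have Bo : open B by apply: upper_open; exact: ballO_open.
pose w (t : R) : V := u + t *: (v - u).
have wE t : w t = (1 - t) *: u + t *: v by rewrite /w scalerBr scalerBl scale1r addrAC addrA addrAC.
have wB t : 0 <= t <= 1 -> B (w t).
  move=> /andP[t0 t1]; move: Bu Bv => [ur u_gt0] [vr v_gt0].
  have t1' : 0 <= 1 - t by rewrite subr_ge0.
  split.
    rewrite /=; have -> : w t - u0 = (1 - t) *: (u - u0) + t *: (v - u0).
      by rewrite wE !scalerBr addrACA -opprD -scalerDl subrK scale1r.
    apply: le_lt_trans (ler_normD _ _) _; rewrite !normrZ (ger0_norm t0) (ger0_norm t1').
    have -> : r = (1 - t) * r + t * r by rewrite -mulrDl subrK mul1r.
    have [->|tn0] := eqVneq t 0; first by rewrite subr0 !mul1r !mul0r !addr0.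
    apply: ler_ltD; first by rewrite ler_wpM2l // ltW.
    by rewrite ltr_pM2l // lt0r tn0.
  rewrite /= wE !mxE; rewrite /= in u_gt0 v_gt0.
  have [->|tn0] := eqVneq t 0; first by rewrite subr0 mul1r mul0r addr0.
  by apply: ltr_wpDl; [rewrite mulr_ge0 // ltW|rewrite mulr_gt0 // lt0r tn0].
have w0 : w 0 = u by rewrite /w scale0r addr0.
have w1 : w 1 = v by rewrite /w scale1r addrC subrK.
have wc : continuous w.
  move=> t; apply: cvgD; first exact: cvg_cst.
  by apply: cvgZr_tmp; exact: cvg_id.
have fc : {within `[0, 1], continuous (fun t => f (w t))}.
  apply: continuous_in_subspaceT => t; rewrite inE /= in_itv /= => t01.
  have C1 : {for w t, continuous f} by exact: (Cinfty_cont Bo (wB _ t01) fs).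
  exact: (cvg_comp w f (wc t) C1).
have noz : ~ (Num.min (f u) (f v) <= 0 <= Num.max (f u) (f v)).
  move=> H; have [|c c01 fc0] := @IVT R (fun t => f (w t)) 0 1 0 ler01 fc.
    by rewrite w0 w1.
  have cI : 0 <= c <= 1 by move: c01; rewrite in_itv.
  by have := f0 _ (wB c cI); rewrite fc0 eqxx.
have fu := f0 _ Bu; have fv := f0 _ Bv.
case: (ltgtP (f u) 0) fu noz => // fu _; case: (ltgtP (f v) 0) fv => // fv _ noz.
- by rewrite !ltr0_sg.
- by case: noz; rewrite ge_min le_max (ltW fu) (ltW fv) orbT.
- by case: noz; rewrite ge_min le_max (ltW fu) (ltW fv) orbT.
- by rewrite !gtr0_sg.
Qed.

Variables (u0 : V) (W : set V) (g : V -> 'M[R]_n.+1)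
  (hatG : I -> I -> I -> V -> R) (Ups : I -> V -> R).
Hypotheses (n_gt0 : (0 < n)%N) (u00 : u0 0 0 = 0) (Wo : open W) (Wu0 : W u0)
  (gs : smoothM (upper W) g) (gsym : forall u, upper W u -> (g u)^T = g u)
  (gunit : forall u, upper W u -> g u \in unitmx)
  (hatGs : forall c a b, Cinfty W (hatG c a b))
  (hatGE : forall c a b u, upper W u ->
    hatG c a b u = christoffel g c a b u + (c == b)%:R * Ups a u + (c == a)%:R * Ups b u).

Let uo := upper_open Wo.
Let uh : upper W `<=` half_space (n := n).
Proof. by move=> u [_]; exact: ltW. Qed.

(* The trace-free part of [hatG], in which the one-form [Ups] drops out. *)
Let Pi c a b u := hatG c a b u - n.+2%:R^-1 *
  ((c == a)%:R * (\sum_k hatG k k b u) + (c == b)%:R * (\sum_k hatG k k a u)).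

Let Pis c a b : Cinfty W (Pi c a b).
Proof.
apply: CinftyB => //; apply: CinftyM => //; first exact: Cinfty_cst.
by apply: CinftyD => //; apply: CinftyM => //; by [exact: Cinfty_cst|exact: Cinfty_sum].
Qed.

Let PiE c a b u : upper W u -> Pi c a b u = thomas g c a b u.
Proof.
move=> Wu; have m0 : n.+2%:R != 0 :> R by rewrite pnatr_eq0.
(* The trace of the projective change is (n+1) Ups + Ups, so [Ups] enters with the same factor n + 2
   as [gam], and subtracting the trace removes both. *)
have E x : \sum_k hatG k k x u = n.+2%:R * (gam g x u + Ups x u).
  under eq_bigr do rewrite hatGE // eqxx mul1r.
  rewrite !big_split /= (sum_delta x (fun k => Ups k u)) sumr_const card_ord -[_ *+ _]mulr_natl.
  rewrite mulrDr /gam mulVKf // -(natr1 n.+1) mulrDl mul1r.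
  by rewrite -addrA [Ups x u + _]addrC.
by rewrite /Pi !E /thomas hatGE //; field.
Qed.

Let hRic a b u := \sum_k der k (Pi k a b) u - \sum_k \sum_e Pi k a e u * Pi e k b u.

Let hRics a b : Cinfty W (hRic a b).
Proof.
apply: CinftyB => //; apply: Cinfty_sum => // k; first exact: Cinfty_der.
by apply: Cinfty_sum => // e; exact: CinftyM.
Qed.

Let hRicE a b u : upper W u -> hRic a b u = thomas_ricci g a b u.
Proof.
move=> Wu; congr (_ - _).
  by apply: eq_bigr => k _; apply: (der_eq k uo Wu) => v Wv; exact: PiE.
by apply: eq_bigr => k _; apply: eq_bigr => e _; rewrite !PiE.
Qed.

Theorem local_extension : exists (O : set V) (hz : V -> 'M[R]_n.+1)
    (hQ : V -> 'M[R]_(1 + n.+1)) (hS : V -> R),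
  [/\ [/\ open O, O u0 & O `<=` W],
      [/\ smoothM O hz, smoothM O hQ & Cinfty O hS] &
      forall u, upper O u -> [/\ hz u = tau_inv_metric g u,
        hQ u = L_tau_inv_metric g u & hS u = scalar_curvature g u]].
Proof.
have [|O [hz [hl [hn [[Oo Ou0 OW] [hzs hls hns] hE]]]]] :=
  @metrizability_extend R n u0 W Pi (fun b c u => tau_inv_metric g u b c)
    (lam g) n_gt0 u00 Wo Wu0 Pis (zeta_smooth uo gs gunit) (lam_smooth uo uh gs gunit).
  move=> a b c u Wu; rewrite (der_zeta uo uh gs gsym gunit) //.
  by do 2 congr (_ - _); congr (- _ - _); apply: eq_bigr => d _; rewrite PiE.
(* Shrinking to a ball makes its upper half convex, so that det g has a constant sign there. *)
have [r r0 Hr] := (near_ballP _ _).1 (near_open Oo Ou0).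
pose B : set V := [set u | `|u - u0| < r].
have Bo : open B by exact: ballO_open.
have BO : B `<=` O by move=> u /Hr.
have BW : B `<=` W by move=> u /BO /OW.
have uBW : upper B `<=` upper W by move=> u [/BW].
have uBO : upper B `<=` upper O by move=> u [/BO].
(* The right-hand side of [kappaE] with each ingredient replaced by its extension. *)
pose kap u := (n%:R * n.+1%:R)^-1 * (\sum_a \sum_b hz a b u * hRic a b u) - n.+1%:R^-1 * hn u.
have kaps : Cinfty B kap.
  apply: CinftyB => //; (apply: CinftyM => //; first exact: Cinfty_cst); last exact: Cinfty_sub hns.
  apply: Cinfty_sum => // a; apply: Cinfty_sum => // b; apply: CinftyM => //.
    exact: Cinfty_sub (hzs a b).
  exact: Cinfty_sub (hRics a b).
pose Z u : 'M[R]_n.+1 := \matrix_(a, b) hz a b u.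
have Zs : smoothM B Z.
  move=> i j; apply: (Cinfty_eq Bo _ (Cinfty_sub BO (hzs i j))) => v _; by rewrite mxE.
pose Q u : 'M[R]_(1 + n.+1) := block_mx (kap u)%:M (\row_b hl b u) (\col_b hl b u) (Z u).
have Qs : smoothM B Q.
  apply: smoothM_block => //.
  - move=> i j; apply: (Cinfty_eq Bo _ kaps) => v _; by rewrite !ord1 mxE eqxx mulr1n.
  - move=> i j; apply: (Cinfty_eq Bo _ (Cinfty_sub BO (hls j))) => v _; by rewrite mxE.
  - move=> i j; apply: (Cinfty_eq Bo _ (Cinfty_sub BO (hls i))) => v _; by rewrite mxE.
have ZE u : upper B u -> Z u = tau_inv_metric g u.
  by move=> Bu; have [H _ _] := hE u (uBO u Bu); apply/matrixP => i j; rewrite mxE H.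
have QE u : upper B u -> Q u = L_tau_inv_metric g u.
  move=> Bu; have [Hz Hl Hn] := hE u (uBO u Bu); have Wu := uBW u Bu.
  rewrite (L_blockE gsym Wu) /Q ZE //; congr (block_mx _%:M _ _ _).
  - rewrite (kappaE uo uh gs gsym gunit n_gt0 Wu) /kap Hn; congr (_ * _ - _).
    by apply: eq_bigr => a _; apply: eq_bigr => b _; rewrite Hz hRicE.
  - by apply/rowP => b; rewrite !mxE Hl.
  - by apply/colP => b; rewrite !mxE Hl.
(* The sign is taken at one interior point of the half ball, since det g need not have a limit at
   the boundary. *)
pose s := Num.sg (\det (g (slice u0 (r / 2)))).
have Bs : upper B (slice u0 (r / 2)).
  have r2 : 0 < r / 2 by rewrite divr_gt0.
  split; last by rewrite /= slice0.
  apply: ball_slice => //; first by rewrite /= subrr normr0.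
  by rewrite gtr0_norm // ltr_pdivrMr // ltr_pMr // ltr1n.
exists B, Z, Q, (fun u => n%:R * n.+1%:R * (s * \det (Q u))); split.
- by split=> //; rewrite /B /= subrr normr0.
- split=> //; apply: CinftyM => //; first exact: Cinfty_cst.
  by apply: CinftyM => //; [exact: Cinfty_cst|exact: smooth_det].
- move=> u Bu; have Wu := uBW u Bu; split; [exact: ZE|exact: QE|].
  rewrite (scalar_curvatureE gunit n_gt0 Wu) QE //; congr (_ * (_ * _)).
  apply: (sign_const (u0 := u0) (r := r) (f := fun u => \det (g u))) => //.
    by apply: smooth_det; [exact: upper_open|move=> i j; exact: Cinfty_sub (gs i j)].
  by move=> v /uBW /gunit; rewrite unitmxE unitfE.
Qed.

End LocalExtension.

(** * Charts *)

Lemma within_preimage_open (S S' : topologicalType) (A : set S) (f : S -> S') (B : set S') :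
  {within A, continuous f} -> open B -> exists2 C : set S, open C & C `&` A = (f @^-1` B) `&` A.
Proof. by move=> /continuousP fc Bo; exact: (open_subspaceP A (f @^-1` B)).1 (fc B Bo). Qed.

Section Charts.
Variables (R : realType) (n : nat) (T : topologicalType) (I : Type).
Variable phi : I -> chart R n T.
Local Notation V := 'rV[R]_n.+1.
Local Notation e_ := (unit_vec R).
Local Notation cr i := (crd (phi i)).
Local Notation pr i := (par (phi i)).
Local Notation dm i := (dom (phi i)).
Local Notation H := (half_space (n := n)).
Hypothesis mfd : manifold_with_boundary phi.

Lemma crd_half i x : dm i x -> H (cr i x).
Proof.
move=> xi; have [D _ DE] := crd_img (phi i).
by have [] : (D `&` H) (cr i x) by rewrite -DE; exists x.
Qed.

(** Neighbourhoods in the manifold are exchanged for open sets of R^(n+1), of which only the part in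
    the half space consists of coordinates of points. *)
Lemma near_img i x (A : set T) : dm i x -> open A -> A x ->
  exists O : set V, [/\ open O, O (cr i x) &
    forall v, O v -> H v -> [/\ dm i (pr i v), A (pr i v) & cr i (pr i v) = v]].
Proof.
move=> xi Ao Ax; have [D Do DE] := crd_img (phi i).
have [B Bo BE] := within_preimage_open (@par_continuous _ _ _ (phi i)) Ao.
exists (B `&` D); split; first exact: openI.
  have xim : (cr i @` dm i) (cr i x) by exists x.
  split; last by have := xim; rewrite DE => -[].
  have : ((pr i @^-1` A) `&` (cr i @` dm i)) (cr i x).
    by split=> //=; rewrite crdK.
  by rewrite -BE => -[].
move=> v [Bv Dv] Hv.
have vim : (cr i @` dm i) v by rewrite DE.
have : ((pr i @^-1` A) `&` (cr i @` dm i)) v by rewrite -BE; split.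
case=> Av _; case: vim Av => y yi <-; by rewrite /= crdK.
Qed.

Lemma smooth_mx_local p q (A : set V) (f : V -> 'M[R]_(p, q)) u : smooth_mx_on A f -> A u ->
  exists (O : set V) (h : V -> 'M[R]_(p, q)), [/\ open O, O u, smoothM O h &
    forall v, O v -> A v -> f v = h v].
Proof.
move=> fs Au.
have ex (ij : 'I_p * 'I_q) : exists Oh : set V * (V -> R), [/\ open Oh.1, Oh.1 u, Cinfty Oh.1 Oh.2 &
    forall v, Oh.1 v -> A v -> f v ij.1 ij.2 = Oh.2 v].
  by have [ O [h Oh]] := fs ij.1 ij.2 u Au; exists (O, h).
pose F ij := sval (cid (ex ij)).
have FP ij : [/\ open (F ij).1, (F ij).1 u, Cinfty (F ij).1 (F ij).2 &
    forall v, (F ij).1 v -> A v -> f v ij.1 ij.2 = (F ij).2 v].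
  by rewrite /F; case: cid.
have N : nbhs u [set v | forall ij, (F ij).1 v].
  apply: (@filter_forall _ _ (fun ij v => (F ij).1 v) _ (nbhs_filter u)) => ij.
  by have [? ? _ _] := FP ij; exact: near_open.
have [r r0 Hr] := (near_ballP _ _).1 N.
exists [set v | `|v - u| < r], (fun v => \matrix_(i, j) (F (i, j)).2 v).
split; first exact: ballO_open.
- by rewrite /= subrr normr0.
- move=> i j; have [_ _ Fs _] := FP (i, j).
  apply: (@Cinfty_eq _ _ _ (F (i, j)).2); first exact: ballO_open.
    by move=> v _; rewrite mxE.
  by apply: Cinfty_sub Fs => v /Hr /(_ (i, j)).
- move=> v /Hr Ov Av; apply/matrixP => i j; rewrite mxE.
  by have [_ _ _ FE] := FP (i, j); exact: (FE v (Ov (i, j)) Av).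
Qed.

(** The two-sided counterpart of [Jac], meant for a smooth extension of a transition map beyond the
    half space. *)
Definition jacobian_mx (F : V -> V) u : 'M[R]_n.+1 := \matrix_(k, a) der a (fun v => F v 0 k) u.

Lemma jacobian_mx_smooth (O : set V) F : open O -> smoothM O F -> smoothM O (jacobian_mx F).
Proof.
move=> Oo Fs k a; apply: (@Cinfty_eq _ _ _ (der a (fun v => F v 0 k))) => //.
  by move=> v _; rewrite mxE.
by apply: Cinfty_der; exact: Fs.
Qed.

Lemma Jac_jacobian (O : set V) (f F : V -> V) u : open O -> smoothM O F -> O u -> H u ->
  (forall v, O v -> H v -> f v = F v) -> Jac f u = jacobian_mx F u.
Proof.
move=> Oo Fs Ou Hu fF; apply/matrixP => k a; rewrite !mxE.
apply: (pd_der Oo Ou Hu); first by case: (Cinfty_has_der a (Fs 0 k) Ou).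
by move=> v Ov Hv; rewrite fF.
Qed.

Lemma jacobian_mx_comp (O O' : set V) (F G : V -> V) u : open O -> open O' ->
  smoothM O F -> smoothM O' G -> O u -> (forall v, O v -> O' (F v)) ->
  jacobian_mx (fun v => G (F v)) u = jacobian_mx G (F u) *m jacobian_mx F u.
Proof.
move=> Oo O'o Fs Gs Ou FO; apply/matrixP => k a; rewrite mxE [RHS]mxE.
rewrite (der_comp a Oo O'o (fun b => Fs 0 b) Ou (FO u Ou) (Gs 0 k)).
by apply: eq_bigr => b _; rewrite [X in _ = X * _]mxE [X in _ = _ * X]mxE.
Qed.

Lemma transition_local i j x : dm i x -> dm j x ->
  exists (O : set V) (F : V -> V), [/\ open O, O (cr i x), smoothM O F &
   forall v, O v -> H v -> [/\ dm i (pr i v), dm j (pr i v), cr i (pr i v) = v &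
     transition phi i j v = F v]].
Proof.
move=> xi xj; have [_ _ _ sm] := mfd.
have Au : (cr i @` (dm i `&` dm j)) (cr i x) by exists x.
have [ O1 [F [ O1o O1u Fs FE]]] := smooth_mx_local (sm i j) Au.
have [ O2 [ O2o O2u O2E]] := near_img xi (dom_open (phi j)) xj.
exists (O1 `&` O2), F; split; [exact: openI|by []| |].
  by move=> k l; apply: Cinfty_sub (Fs k l) => v [].
move=> v [ O1v O2v] Hv; have [h1 h2 h3] := O2E v O2v Hv; split=> //.
by apply: FE => //; exists (pr i v).
Qed.

Lemma transition_crd i j x : dm i x -> transition phi i j (cr i x) = cr j x.
Proof. by move=> xi; rewrite /transition crdK. Qed.

(** The chain rule is applied to smooth extensions of the two transition maps. Their composite
    extends the third one, because coordinates of points stay in the half space. *)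
Lemma Jac_chain i j k x : dm i x -> dm j x -> dm k x ->
  Jac (transition phi i k) (cr i x) =
  Jac (transition phi j k) (cr j x) *m Jac (transition phi i j) (cr i x).
Proof.
move=> xi xj xk.
have [ O1 [F [ O1o O1u Fs FE]]] := transition_local xi xj.
have [ O2 [G [ O2o O2u Gs GE]]] := transition_local xj xk.
have Hu := crd_half xi; have Hu' := crd_half xj.
have Fu : F (cr i x) = cr j x.
  by have [_ _ _ <-] := FE _ O1u Hu; rewrite transition_crd.
have Fc : F @ cr i x --> F (cr i x).
  apply: (cvg_mxP (nbhs_filter _) F _).2 => a b; exact: (Cinfty_cont O1o O1u (Fs a b)).
have N : nbhs (cr i x) (F @^-1` O2) by apply: Fc; rewrite Fu; exact: near_open.
have [r r0 Hr] := (near_ballP _ _).1 (filterI N (near_open O1o O1u)).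
pose B : set V := [set v | `|v - cr i x| < r].
have Bo : open B by exact: ballO_open.
have Bu : B (cr i x) by rewrite /B /= subrr normr0.
have BF v : B v -> O2 (F v) by move=> /Hr[].
have BO v : B v -> O1 v by move=> /Hr[].
have FsB : smoothM B F by move=> a b; apply: Cinfty_sub (Fs a b).
have GFs : smoothM B (fun v => G (F v)).
  by move=> a b; apply: (Cinfty_comp Bo O2o _ BF (Gs a b)) => c; exact: FsB.
rewrite (Jac_jacobian Bo GFs Bu Hu); last first.
  move=> v Bv Hv; have [h1 h2 h3 h4] := FE v (BO v Bv) Hv.
  have HF : H (F v) by rewrite -h4 /transition; exact: crd_half.
  have [_ _ _ <-] := GE _ (BF v Bv) HF.
  by rewrite -h4 /transition (crdK h2).
rewrite (jacobian_mx_comp Bo O2o FsB Gs Bu BF) Fu.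
rewrite (Jac_jacobian O1o Fs O1u Hu); last by move=> v Ov Hv; have [] := FE v Ov Hv.
by rewrite (Jac_jacobian O2o Gs O2u Hu') // => v Ov Hv; have [] := GE v Ov Hv.
Qed.

Lemma jacobian_mx_id u : jacobian_mx id u = 1%:M.
Proof.
apply/matrixP => k a; rewrite !mxE (has_der_derE (has_der_coord k u (e_ a))).
by rewrite unit_vecE.
Qed.

Lemma Jac_id i x : dm i x -> Jac (transition phi i i) (cr i x) = 1%:M.
Proof.
move=> xi; have [ O [ Oo Ou OE]] := near_img xi (dom_open (phi i)) xi.
rewrite (@Jac_jacobian O _ id) //; first exact: jacobian_mx_id.
- by move=> k l; rewrite ord1; exact: Cinfty_coord.
- exact: crd_half.
- by move=> v Ov Hv; have [_ _] := OE v Ov Hv.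
Qed.

(** The Jacobian of the transition back is an inverse, by the chain rule. *)
Lemma Jac_unit i j x : dm i x -> dm j x -> Jac (transition phi i j) (cr i x) \in unitmx.
Proof.
move=> xi xj; have := Jac_chain xi xj xi; rewrite Jac_id // => /esym E.
by have [] := mulmx1_unit E.
Qed.

Lemma der_at_min (O : set V) f a u : open O -> O u -> Cinfty O f ->
  (forall v, O v -> f u <= f v) -> der a f u = 0.
Proof.
move=> Oo Ou fs fmin.
have [r r0 Hr] := (near_ballP _ _).1 (near_open Oo Ou).
pose h (t : R) := f (u + t *: e_ a).
have inO t : `|t| < r -> O (u + t *: e_ a).
  move=> tr; apply: Hr; rewrite addrC addKr normrZ; apply: le_lt_trans tr.
  by rewrite -[leRHS]mulr1 ler_pM // norm_unit_vec.
have hD t : `|t| < r -> has_der h t 1 (der a f (u + t *: e_ a)).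
  by move=> tr; apply/has_der_line; apply: (Cinfty_has_der _ fs); exact: inO.
have M := @derive1_at_min R h (- r) r 0.
have D0 : is_derive (0 : R) (1 : R) h 0.
  apply: M.
  - by rewrite ltW // gtrN.
  - by move=> t; rewrite in_itv /= -ltr_norml => /hD[].
  - by rewrite in_itv /= oppr_lt0 r0.
  - move=> t; rewrite in_itv /= -ltr_norml => tr; rewrite /h scale0r addr0.
    by apply: fmin; exact: inO.
have [_ E] := D0.
have [|_] := hD 0; first by rewrite normr0.
by rewrite E scale0r addr0 => ->.
Qed.

(* If the coordinate vanished, the 0-th component of the transition map would
   have a minimum, and its Jacobian a zero row. *)
Lemma interior_chart i x : interior_pts phi x -> dm i x -> 0 < cr i x 0 0.
Proof.
move=> [j xj xj0] xi; have := crd_half xi; rewrite /half_space /= le_eqVlt => /orP[/eqP E|//].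
have [ O [F [ Oo Ou Fs FE]]] := transition_local xj xi.
pose O' := upper O.
have O'u : O' (cr j x) by split.
have O'o : open O' by exact: upper_open.
have OH v : O' v -> H v by move=> [_]; exact: ltW.
have E0 a : der a (fun v => F v 0 0) (cr j x) = 0.
  apply: (der_at_min a O'o O'u).
    by apply: Cinfty_sub (Fs 0 0) => v [].
  have [_ _ _ <-] := FE _ Ou (OH _ O'u); rewrite transition_crd // -E => v O'v.
  have [ Ov _] := O'v; have [h1 h2 h3 <-] := FE _ Ov (OH _ O'v).
  exact: (crd_half h2).
have := Jac_unit xj xi; rewrite (Jac_jacobian Oo Fs Ou (OH _ O'u)); last first.
  by move=> v Ov Hv; have [] := FE v Ov Hv.
rewrite unitmxE unitfE (expand_det_row _ 0) big1 ?eqxx // => a _.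
by rewrite mxE E0 mul0r.
Qed.

Lemma boundary_chart i x : boundary_pts phi x -> dm i x -> cr i x 0 0 = 0.
Proof.
move=> [j xj xj0] xi; have := crd_half xi; rewrite /half_space /= le_eqVlt => /orP[/eqP <-//|x0].
have xint : interior_pts phi x by exists i.
by have := interior_chart xint xj; rewrite xj0 ltxx.
Qed.

Lemma interior_or_boundary x : interior_pts phi x \/ boundary_pts phi x.
Proof.
have [_ _ cov _] := mfd; have [i xi] := cov x.
have := crd_half xi; rewrite /half_space /= le_eqVlt => /orP[/eqP E|x0].
  by right; exists i.
by left; exists i.
Qed.

End Charts.

(** * Gluing local extensions by limits along inward rays *)

Section Extension.
Variables (R : realType) (n : nat) (T : topologicalType) (I : Type).
Variable phi : I -> chart R n T.
Local Notation V := 'rV[R]_n.+1.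
Local Notation e_ := (unit_vec R).
Local Notation cr i := (crd (phi i)).
Local Notation pr i := (par (phi i)).
Local Notation dm i := (dom (phi i)).
Local Notation H := (half_space (n := n)).
Hypothesis mfd : manifold_with_boundary phi.

Definition ray (u : V) (t : R) : V := u + t *: e_ 0.

Lemma ray0 u t : ray u t 0 0 = u 0 0 + t.
Proof. by rewrite !mxE !eqxx mulr1. Qed.

Lemma ray_upper (O : set V) u : open O -> O u -> 0 <= u 0 0 ->
  \forall t \near 0^'+, upper O (ray u t).
Proof.
move=> Oo Ou u0.
have N : \forall t \near 0^'+, O (ray u t) := @cvg_line_right R n u (e_ 0) _ (near_open Oo Ou).
near=> t; split.
  by near: t; exact: N.
by rewrite /= ray0 ltr_wpDl //; near: t; exact: nbhs_right_gt.
Unshelve. all: by end_near. Qed.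

Lemma cvg_ray p q (O : set V) (F : V -> 'M[R]_(p, q)) u : open O -> O u -> smoothM O F ->
  (fun t => F (ray u t)) @ 0^'+ --> F u.
Proof.
move=> Oo Ou Fs; have C : F @ u --> F u.
  by apply: (cvg_mxP (nbhs_filter u) F _).2 => a b; exact: (Cinfty_cont Oo Ou (Fs a b)).
exact: (cvg_comp (ray u) F (@cvg_line_right R n u (e_ 0)) C).
Qed.

Lemma cvg_ray_near p q (O : set V) (f F : V -> 'M[R]_(p, q)) u : open O -> O u -> 0 <= u 0 0 ->
  smoothM O F -> (forall v, upper O v -> f v = F v) -> (fun t => f (ray u t)) @ 0^'+ --> F u.
Proof.
move=> Oo Ou u0 Fs fF; apply: cvg_trans (cvg_ray Oo Ou Fs); apply: near_eq_cvg.
by apply: filterS (ray_upper Oo Ou u0) => t /fF.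
Qed.

Lemma cvg_ray_nearR (O : set V) (f F : V -> R) u : open O -> O u -> 0 <= u 0 0 ->
  Cinfty O F -> (forall v, upper O v -> f v = F v) -> (fun t => f (ray u t)) @ 0^'+ --> F u.
Proof.
move=> Oo Ou u0 Fs fF.
have C := cvg_comp (ray u) F (@cvg_line_right R n u (e_ 0)) (Cinfty_cont Oo Ou Fs).
apply: cvg_trans C; apply: near_eq_cvg.
by apply: filterS (ray_upper Oo Ou u0) => t /fF.
Qed.

Lemma cvg_mulmx (S : Type) (F : set_system S) (FF : Filter F) p q r
    (A : S -> 'M[R]_(p, q)) (B : S -> 'M[R]_(q, r)) (A' : 'M[R]_(p, q)) (B' : 'M[R]_(q, r)) :
  A @ F --> A' -> B @ F --> B' -> (fun t => A t *m B t) @ F --> A' *m B'.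
Proof.
move=> /(cvg_mxP FF A A') cA /(cvg_mxP FF B B') cB; apply/(cvg_mxP FF) => i j.
rewrite mxE; under eq_fun do rewrite mxE.
by apply: cvg_sumr => k; apply: cvgM.
Qed.

Lemma cvg_trmx (S : Type) (F : set_system S) (FF : Filter F) p q
    (A : S -> 'M[R]_(p, q)) (A' : 'M[R]_(p, q)) : A @ F --> A' -> (fun t => (A t)^T) @ F --> A'^T.
Proof.
move=> /(cvg_mxP FF A A') cA; apply/(cvg_mxP FF) => i j.
rewrite mxE; under eq_fun do rewrite mxE; exact: cA.
Qed.

Section Bundle.
Variables (p q : nat) (B : bundle R n p q) (s : components R n I p q).
Hypothesis fib_closed : forall (f : R -> 'M[R]_(p, q)) (l : 'M[R]_(p, q)),
  (\forall t \near 0^'+, fib B (f t)) -> f @ 0^'+ --> l -> fib B l.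
Hypothesis act_cvg : forall i j x (f : R -> 'M[R]_(p, q)) (l : 'M[R]_(p, q)), dm i x -> dm j x ->
  f @ 0^'+ --> l ->
  (fun t => act B (transition phi i j) (ray (cr i x) t) (f t)) @ 0^'+ -->
    act B (transition phi i j) (cr i x) l.
Hypothesis s_int : smooth_section phi B (interior_pts phi) s.
Hypothesis s_bd : forall i x, boundary_pts phi x -> dm i x ->
  exists (O : set V) (h : V -> 'M[R]_(p, q)), [/\ open O, O (cr i x), smoothM O h &
    forall v, upper O v -> s i v = h v].

(* Boundary values are forced to be limits along the inward direction e_0, so
   that they transform correctly by continuity of the action. *)
Definition limit_ext : components R n I p q := fun i u =>
  if 0 < u 0 0 then s i u
  else \matrix_(k, l) lim ((fun t => s i (ray u t) k l) @ 0^'+).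

Lemma limit_extE i (O : set V) h u : open O -> smoothM O h ->
  (forall v, upper O v -> s i v = h v) -> O u -> H u -> limit_ext i u = h u.
Proof.
move=> Oo hs sh Ou; rewrite /half_space /= /limit_ext => u0; case: ifPn => [u_gt0|_].
  exact: sh.
have C := cvg_ray_near Oo Ou u0 hs sh.
apply/matrixP => k l; rewrite mxE; apply: cvg_lim => //.
exact: (cvg_mxP (at_right_proper_filter 0) _ _).1 C k l.
Qed.

(** At a boundary point the transformation law is known along the inward ray of the first chart,
    where points are interior. Both sides converge, by continuity of the action and of the local
    extensions, and limits are unique. *)
Theorem extends_by_limits : extends_smoothly phi B setT s.
Proof.
have [sf sa ss] := s_int; exists limit_ext; last first.
  by move=> i x _ xint xi; rewrite /limit_ext (interior_chart mfd xint xi).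
have ext_int i x : interior_pts phi x -> dm i x -> limit_ext i (cr i x) = s i (cr i x).
  by move=> xint xi; rewrite /limit_ext (interior_chart mfd xint xi).
split.
- move=> i x _ xi; have [xint|xbd] := interior_or_boundary mfd x.
    by rewrite ext_int //; exact: sf.
  have [W [h [Wo Wu hs sh]]] := s_bd xbd xi.
  have x0 := crd_half xi.
  rewrite (limit_extE Wo hs sh Wu x0).
  apply: (fib_closed _ (cvg_ray_near Wo Wu x0 hs sh)).
  have [D [Do Du DE]] := near_img xi (dom_open (phi i)) xi.
  apply: filterS (ray_upper Do Du x0) => t [Dt t0].
  have [h1 _ h2] := DE _ Dt (ltW t0).
  by rewrite -h2; apply: sf => //; exists i => //; rewrite h2.
- move=> i j x _ xi xj; have [xint|xbd] := interior_or_boundary mfd x.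
    by rewrite !ext_int //; exact: sa.
  have x0 := crd_half xi; have y0 := crd_half xj.
  have [W [h [Wo Wu hs sh]]] := s_bd xbd xi.
  have [W' [h' [W'o W'u h's sh']]] := s_bd xbd xj.
  rewrite (limit_extE Wo hs sh Wu x0) (limit_extE W'o h's sh' W'u y0).
  have C1 := act_cvg xi xj (cvg_ray_near Wo Wu x0 hs sh).
  have [D [F [Do Du Fs DE]]] := transition_local mfd xi xj.
  have Fx : F (cr i x) = cr j x.
    by have [_ _ _ <-] := DE _ Du x0; rewrite transition_crd.
  (* The image of the ray under the transition map need not be a ray in the chart [j]; continuity of
     the local extension [h'] still gives the limit. *)
  have C2 : (fun t => h' (F (ray (cr i x) t))) @ 0^'+ --> h' (cr j x).
    have C : h' @ cr j x --> h' (cr j x).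
      apply: (cvg_mxP (nbhs_filter _) h' _).2 => a b.
      exact: (Cinfty_cont W'o W'u (h's a b)).
    rewrite -Fx in C *.
    exact: (cvg_comp (fun t => F (ray (cr i x) t)) h' (cvg_ray Do Du Fs) C).
  have NF : \forall t \near 0^'+, W' (F (ray (cr i x) t)).
    by apply: (cvg_ray Do Du Fs); rewrite Fx; exact: near_open.
  have C3 : (fun t => act B (transition phi i j) (ray (cr i x) t) (s i (ray (cr i x) t)))
      @ 0^'+ --> h' (cr j x).
    apply: cvg_trans C2; apply: near_eq_cvg.
    apply: filterS (filterI NF (ray_upper Do Du x0)) => t [W't [Dt t0]].
    have [h1 h2 h3 h4] := DE _ Dt (ltW t0).
    have yint : interior_pts phi (pr i (ray (cr i x) t)) by exists i; rewrite ?h3.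
    have := sa i j _ yint h1 h2; rewrite h3 => <-; rewrite -h4 in W't *.
    by rewrite sh' //; split=> //; exact: (interior_chart mfd yint h2).
  exact: (cvg_unique _ C3 C1).
- move=> i k l u [x [_ xi] <-]; have x0 := crd_half xi.
  have [xint|xbd] := interior_or_boundary mfd x.
    have [W [h [Wo Wu hs sh]]] := ss i k l (cr i x) (imageP _ (conj xint xi)).
    exists (upper W), h; split.
    + exact: upper_open.
    + by split=> //; exact: (interior_chart mfd).
    + by apply: Cinfty_sub hs => v [].
    + move=> v [Wv v0] [y [_ yi] yv]; rewrite /limit_ext v0 sh //.
      by exists y => //; split=> //; exists i => //; rewrite yv.
  have [W [h [Wo Wu hs sh]]] := s_bd xbd xi.
  exists W, (fun v => h v k l); split=> // v Wv [y [_ yi] yv].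
  rewrite (limit_extE Wo hs sh Wv) // -yv; exact: crd_half.
Qed.

End Bundle.

(** Functions are treated as sections of the trivial line bundle, so that the gluing of sections
    applies to the scalar curvature. *)
Definition scalar_bundle : bundle R n 1 1 := Bundle setT (fun _ _ A => A).

Lemma function_extends (f : I -> V -> R) :
  extends_smoothly phi scalar_bundle setT (fun i u => (f i u)%:M) ->
  function_extends_smoothly phi f.
Proof.
have [_ _ cov _] := mfd.
(* One chart is chosen at each point; the trivial transformation law makes the value independent of
   the choice. *)
move=> [s [_ sa ss] sE]; pose c x := sval (cid (cov x)).
have cP x : dm (c x) x by rewrite /c; case: cid.
have cE i x : dm i x -> s (c x) (cr (c x) x) = s i (cr i x).
  by move=> xi; rewrite (sa (c x) i x Logic.I (cP x) xi).
exists (fun x => s (c x) (cr (c x) x) 0 0); last first.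
  by move=> i x xint xi; rewrite (cE i) // sE // mxE eqxx mulr1n.
move=> i u [x xi <-].
have [W [h [Wo Wu hs sh]]] := ss i 0 0 (cr i x) (imageP _ (conj Logic.I xi)).
exists W, h; split=> // v Wv [y yi yv]; rewrite -sh //; last by exists y.
by rewrite -yv crdK // (cE i).
Qed.

End Extension.

(** * Jacobians, densities and jets of transition maps up to the boundary *)

Lemma scalar_mx11E (R : nzRingType) (x : R) (i j : 'I_1) : (x%:M : 'M[R]_1) i j = x.
Proof. by rewrite !ord1 mxE eqxx mulr1n. Qed.

Section TransitionSmooth.
Variables (R : realType) (n : nat) (T : topologicalType) (I : Type).
Variable phi : I -> chart R n T.
Local Notation V := 'rV[R]_n.+1.
Local Notation e_ := (unit_vec R).
Local Notation cr i := (crd (phi i)).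
Local Notation pr i := (par (phi i)).
Local Notation dm i := (dom (phi i)).
Local Notation H := (half_space (n := n)).
Hypothesis mfd : manifold_with_boundary phi.

Definition density (w : R) (F : V -> V) (u : V) : R :=
  `|\det (jacobian_mx F u)| `^ (w / n.+2%:R).

(** The shape of [jet_change] with density factor, Jacobian and gradient as free arguments, which
    separates the matrix algebra from the calculus. *)
Definition jet_form (d : R) (J : 'M[R]_n.+1) (p : 'I_n.+1 -> R) : 'M[R]_(1 + n.+1) :=
  block_mx d%:M 0 (\col_a p a) (d *: J^T).

Definition jet_mx (F : V -> V) (u : V) : 'M[R]_(1 + n.+1) :=
  jet_form (density (- 1) F u) (jacobian_mx F u) (fun a => der a (density (- 1) F) u).

Lemma density_smooth (O : set V) F w : open O -> smoothM O F ->
  (forall v, O v -> jacobian_mx F v \in unitmx) -> Cinfty O (density w F).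
Proof.
move=> Oo Fs Fu; apply: smooth_abs_powR => //.
  by move=> v /Fu; rewrite unitmxE unitfE.
exact: (smooth_det Oo (jacobian_mx_smooth Oo Fs)).
Qed.

Lemma jet_mx_smooth (O : set V) F : open O -> smoothM O F ->
  (forall v, O v -> jacobian_mx F v \in unitmx) -> smoothM O (jet_mx F).
Proof.
move=> Oo Fs Fu; have ds := density_smooth (- 1) Oo Fs Fu.
apply: smoothM_block.
- move=> i j; apply: (Cinfty_eq Oo _ ds) => v _; exact/esym/scalar_mx11E.
- exact: smoothM_cst.
- move=> a j; apply: (Cinfty_eq Oo _ (Cinfty_der a ds)) => v _; by rewrite mxE.
- apply: (smoothM_scale Oo ds); apply: (smoothM_tr Oo); exact: jacobian_mx_smooth.
Qed.

(** Invertibility of the Jacobian is an open condition, so it holds for a smooth extension [F] on a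
    full neighbourhood, where density factors and jet changes then become smooth functions. *)
Lemma transition_jac i j x (A : set V) : dm i x -> dm j x -> open A -> A (cr j x) ->
  exists (O : set V) (F : V -> V), [/\
    [/\ open O, O (cr i x), smoothM O F & forall v, O v -> A (F v) /\ jacobian_mx F v \in unitmx] &
    forall v, O v -> H v -> [/\
      [/\ dm i (pr i v), dm j (pr i v), cr i (pr i v) = v & cr j (pr i v) = F v],
      Jac (transition phi i j) v = jacobian_mx F v,
      forall w, density_factor w (transition phi i j) v = density w F v &
      jet_change (transition phi i j) v = jet_mx F v]].
Proof.
move=> xi xj Ao Ax; have [D [F [Do Du Fs DE]]] := transition_local mfd xi xj.
have Hu := crd_half xi.
have Js := jacobian_mx_smooth Do Fs.
have JE v : D v -> H v -> Jac (transition phi i j) v = jacobian_mx F v.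
  move=> Dv Hv; apply: (Jac_jacobian Do Fs Dv Hv) => w Dw Hw.
  by have [] := DE w Dw Hw.
have J0 : \det (jacobian_mx F (cr i x)) != 0.
  by rewrite -JE // -unitfE -unitmxE; exact: Jac_unit.
have Fx : F (cr i x) = cr j x.
  by have [_ _ _ <-] := DE _ Du Hu; rewrite transition_crd.
have NA : nbhs (cr i x) (F @^-1` A).
  have C : F @ cr i x --> F (cr i x).
    by apply: (cvg_mxP (nbhs_filter _) F _).2 => a b; exact: (Cinfty_cont Do Du (Fs a b)).
  by apply: C; rewrite Fx; exact: near_open.
have NJ : nbhs (cr i x) [set v | \det (jacobian_mx F v) != 0].
  have C := Cinfty_cont Do Du (smooth_det Do Js).
  have N0 : nbhs (\det (jacobian_mx F (cr i x))) [set y : R | y != 0].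
    by apply: open_nbhs_nbhs; split; [exact: open_neq|exact: J0].
  exact: (C _ N0).
have [r r0 Hr] := (near_ballP _ _).1 (filterI (filterI NA NJ) (near_open Do Du)).
pose B : set V := [set v | `|v - cr i x| < r].
have Bo : open B by exact: ballO_open.
have Bu : B (cr i x) by rewrite /B /= subrr normr0.
have BD : B `<=` D by move=> v /Hr[].
have Fu v : B v -> jacobian_mx F v \in unitmx by move=> /Hr[[_ h] _]; rewrite unitmxE unitfE.
have FsB : smoothM B F by move=> a b; apply: Cinfty_sub (Fs a b).
have dE w v : B v -> H v -> density_factor w (transition phi i j) v = density w F v.
  by move=> Bv Hv; rewrite /density_factor JE //; exact: BD.
exists B, F; split.
  by split; [exact: Bo|exact: Bu|exact: FsB|move=> v Bv; split; [by have [[]] := Hr v Bv|exact: Fu]].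
move=> v Bv Hv; have [h1 h2 h3 h4] := DE v (BD v Bv) Hv; split.
- by split.
- exact: (JE v (BD v Bv) Hv).
- by move=> w; exact: dE.
- have E a : pd a (density_factor (- 1) (transition phi i j)) v = der a (density (- 1) F) v.
    apply: (pd_der Bo Bv Hv); last exact: (dE (- 1)).
    by have [] := Cinfty_has_der a (density_smooth (- 1) Bo FsB Fu) Bv.
  rewrite -[LHS]/(jet_form (density_factor (- 1) (transition phi i j) v)
    (Jac (transition phi i j) v) (fun a => pd a (density_factor (- 1) (transition phi i j)) v)).
  by rewrite (dE _ v Bv Hv) (JE v (BD v Bv) Hv) (funext E).
Qed.

Lemma sym2_tangent_act_cvg w i j x (f : R -> 'M[R]_n.+1) (l : 'M[R]_n.+1) : dm i x -> dm j x ->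
  f @ 0^'+ --> l ->
  (fun t => act (sym2_tangent n w) (transition phi i j) (ray (cr i x) t) (f t)) @ 0^'+ -->
    act (sym2_tangent n w) (transition phi i j) (cr i x) l.
Proof.
move=> xi xj fl; have [D [F [[Do Du Fs FD] DE]]] := transition_jac xi xj openT Logic.I.
have x0 := crd_half xi; have Fu v : D v -> jacobian_mx F v \in unitmx by move=> /FD[].
have [_ JE dE _] := DE _ Du x0; rewrite /= JE dE.
have CJ : (fun t => Jac (transition phi i j) (ray (cr i x) t)) @ 0^'+ --> jacobian_mx F (cr i x).
  apply: (cvg_ray_near Do Du x0 (jacobian_mx_smooth Do Fs)) => v [Dv v0].
  by have [] := DE v Dv (ltW v0).
apply: cvgZ.
  apply: (cvg_ray_nearR Do Du x0 (density_smooth w Do Fs Fu)) => v [Dv v0].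
  by have [_ _ h _] := DE v Dv (ltW v0); exact: h.
by apply: cvg_mulmx; [exact: cvg_mulmx|exact: cvg_trmx].
Qed.

Lemma sym2_tractor_act_cvg i j x (f : R -> 'M[R]_(1 + n.+1)) (l : 'M[R]_(1 + n.+1)) :
  dm i x -> dm j x -> f @ 0^'+ --> l ->
  (fun t => act (sym2_tractor R n) (transition phi i j) (ray (cr i x) t) (f t)) @ 0^'+ -->
    act (sym2_tractor R n) (transition phi i j) (cr i x) l.
Proof.
move=> xi xj fl; have [D [F [[Do Du Fs FD] DE]]] := transition_jac xi xj openT Logic.I.
have x0 := crd_half xi; have Fu v : D v -> jacobian_mx F v \in unitmx by move=> /FD[].
have [_ _ _ JE] := DE _ Du x0; rewrite /= JE.
have CJ : (fun t => jet_change (transition phi i j) (ray (cr i x) t)) @ 0^'+ -->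
    jet_mx F (cr i x).
  apply: (cvg_ray_near Do Du x0 (jet_mx_smooth Do Fs Fu)) => v [Dv v0].
  by have [] := DE v Dv (ltW v0).
by apply: (cvg_mulmx (at_right_proper_filter 0) _ CJ); apply: (cvg_mulmx (at_right_proper_filter 0) _ fl); exact: cvg_trmx.
Qed.

Lemma symmetric_closed p (f : R -> 'M[R]_p) (l : 'M[R]_p) :
  (\forall t \near 0^'+, symmetric_mx (f t)) -> f @ 0^'+ --> l -> symmetric_mx l.
Proof.
move=> fs fl; have C := cvg_trmx (at_right_proper_filter 0) fl.
have C' : f @ 0^'+ --> l^T.
  by apply: cvg_trans C; apply: near_eq_cvg; apply: filterS fs => t ->.
exact: (cvg_unique _ C' fl).
Qed.

End TransitionSmooth.

(** * Projectively extended connection coefficients *)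

Section Flat.
Variable R : realType.
Implicit Types (x : R) (k : nat).

(** The family x^-k exp(-1/x) is closed under differentiation up to linear combinations; its member
    of index 0 is the usual profile of a bump function. *)
Definition flat k x : R := if 0 < x then x^-1 ^+ k * expR (- x^-1) else 0.

Lemma flatS k x : flat k.+1 x = x^-1 * flat k x.
Proof. by rewrite /flat; case: ifP; rewrite ?mulr0 // exprS mulrA. Qed.

Lemma flat_ge0 k x : 0 <= flat k x.
Proof.
rewrite /flat; case: ifPn => // x0; rewrite mulr_ge0 ?expR_ge0 // exprn_ge0 // invr_ge0 ltW //.
Qed.

(** With y = 1/x, the bound exp y >= y^(k+2) / (k+2)! makes the function O(x^2), so that it has
    derivative 0 at the origin. *)
Lemma flat_le k x : `|flat k x| <= k.+2`!%:R * x ^+ 2.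
Proof.
rewrite ger0_norm ?flat_ge0 // /flat; case: ifPn => [x0|_]; last by rewrite mulr_ge0 // sqr_ge0.
have y0 : 0 < x^-1 by rewrite invr_gt0.
have F0 : 0 < k.+2`!%:R :> R by rewrite ltr0n fact_gt0.
rewrite expRN ler_pdivrMr ?expR_gt0 //.
have H : x^-1 ^+ k.+2 <= k.+2`!%:R * expR x^-1.
  rewrite mulrC -ler_pdivrMr //; apply: le_trans (expR_ge1Dxn k.+1 (ltW y0)).
  by rewrite lerDr.
have -> : x^-1 ^+ k = x ^+ 2 * x^-1 ^+ k.+2.
  by rewrite -[k.+2]addn2 exprD mulrCA -exprMn mulfV ?gt_eqF // expr1n mulr1.
by rewrite [leRHS]mulrAC [leRHS]mulrC ler_wpM2l // sqr_ge0.
Qed.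

Lemma has_der_quadratic (f : R -> R) (C : R) : (forall x, `|f x| <= C * x ^+ 2) ->
  has_der f 0 1 0.
Proof.
move=> fC; have f0 : f 0 = 0.
  by apply/eqP; rewrite -normr_le0; have := fC 0; rewrite expr0n mulr0.
have C0 : 0 <= C by have := fC 1; rewrite expr1n mulr1; exact: le_trans (normr_ge0 _).
have L : (fun h : R => h^-1 *: ((f \o shift 0) (h *: 1) - f 0)) @ 0^' --> (0 : R).
  apply/cvgr0Pnorm_le => e e0; near=> h.
  have h0 : h != 0 by near: h; exact: nbhs_dnbhs_neq.
  rewrite /= f0 subr0 addr0 normrZ normfV ler_pdivrMl ?normr_gt0 //.
  have -> : h *: (1 : R) = h by rewrite /GRing.scale /= mulr1.
  apply: le_trans (fC h) _; rewrite -real_normK ?num_real // expr2 mulrCA ler_wpM2l //.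
  have he : `|h| <= e / (C + 1).
    near: h; apply: dnbhs0_le; by rewrite divr_gt0 // ltr_wpDl.
  apply: le_trans (_ : (C + 1) * `|h| <= _); first by rewrite ler_wpM2r // lerDl.
  by rewrite mulrC -ler_pdivlMr // ltr_wpDl.
by split; [apply/cvg_ex; exists 0|exact: (cvg_lim _ L)].
Unshelve. all: by end_near. Qed.

Lemma has_der_flat k x : has_der (flat k) x 1 (flat k.+2 x - k%:R * flat k.+1 x).
Proof.
have [x0|x0|->] := ltgtP x 0.
- have z m : flat m x = 0 by rewrite /flat ltNge (ltW x0).
  rewrite !z mulr0 subrr; apply: (has_der_near (f := fun=> 0)); last exact: has_der_cst.
  by near=> y; rewrite /flat ltNge ltW //; near: y; exact: lt_nbhsl.
- have xn0 : x != 0 by rewrite gt_eqF.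
  have DV : has_der (fun y : R => y^-1) x 1 (- (x^-1 * x^-1)).
    rewrite -[- _]mulr1; apply: has_derV => //.
    by apply/has_der_is_derive; exact: is_derive_id.
  elim: k => [|k IH].
    rewrite mul0r subr0; apply: (has_der_near (f := fun y : R => expR (- y^-1))).
      near=> y; rewrite /flat expr0 mul1r ifT //; near: y; exact: lt_nbhsr.
    have -> : flat 2 x = expR (- x^-1) * (- - (x^-1 * x^-1)).
      by rewrite opprK /flat x0 expr2 mulrC.
    apply: (has_der_comp1 (f := expR) (h := fun y : R => - y^-1)); last exact: has_derN.
    by apply/has_der_is_derive; exact: is_derive_expR.
  have -> : flat k.+1 = fun y => y^-1 * flat k y by apply/funext => y; exact: flatS.
  have -> : flat k.+3 x - k.+1%:R * flat k.+2 x =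
     - (x^-1 * x^-1) * flat k x + x^-1 * (flat k.+2 x - k%:R * flat k.+1 x).
    by rewrite !flatS -natr1; ring.
  exact: has_derM.
- have z m : flat m 0 = 0 by rewrite /flat ltxx.
  by rewrite !z mulr0 subrr; apply: has_der_quadratic => y; exact: flat_le.
Unshelve. all: by end_near. Qed.

Variable n : nat.
Local Notation V := 'rV[R]_n.+1.

Lemma Cinfty_flat (O : set V) (q : V -> R) k : open O -> Cinfty O q -> Cinfty O (fun u => flat k (q u)).
Proof.
move=> Oo qs m; elim: m k => [|m IH] k.
  move=> u; rewrite inE => Ou.
  have C : {for q u, continuous (flat k)}.
    apply/differentiable_continuous/derivable1_diffP.
    by case: (has_der_flat k (q u)).
  exact: (cvg_comp q (flat k) (Cinfty_cont Oo Ou qs) C).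
apply: (CkS (df := fun a u => (flat k.+2 (q u) - k%:R * flat k.+1 (q u)) * der a q u)) => //.
  move=> a u Ou; apply: has_der_comp1; first exact: has_der_flat.
  exact: Cinfty_has_der qs Ou.
move=> a; apply: CkM => //; last exact: (Cinfty_der a qs).
have -> : (fun u => flat k.+2 (q u) - k%:R * flat k.+1 (q u)) =
  (fun u => flat k.+2 (q u) + (- k%:R) * flat k.+1 (q u)) by apply/funext => u; rewrite mulNr.
by apply: CkD => //; apply: CkM => //; exact: Ck_cst.
Qed.

(** The Euclidean norm is used because its square is smooth; the support lies in the Euclidean ball
    and hence in the box of the same radius. *)
Definition bump (u0 : V) (r : R) (u : V) : R :=
  flat 0 (r ^+ 2 - \sum_i (u 0 i - u0 0 i) ^+ 2).

Lemma bump_smooth u0 r : Cinfty setT (bump u0 r).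
Proof.
apply: Cinfty_flat; first exact: openT.
apply: CinftyB; [exact: openT|by apply: Cinfty_cst; exact: openT|].
apply: Cinfty_sum => [|i]; first exact: openT.
apply: (@Cinfty_eq _ _ _ (fun u : V => (u 0 i - u0 0 i) * (u 0 i - u0 0 i))).
- exact: openT.
- by move=> u _; rewrite expr2.
have H : Cinfty setT (fun u : V => u 0 i - u0 0 i).
  apply: CinftyB; [exact: openT|by apply: Cinfty_coord; exact: openT|].
  by apply: Cinfty_cst; exact: openT.
by apply: CinftyM => //; exact: openT.
Qed.

Lemma bump_center (u0 : V) (r : R) : 0 < r -> 0 < bump u0 r u0.
Proof.
move=> r0; rewrite /bump big1 => [|i _]; last by rewrite subrr expr0n.
by rewrite subr0 /flat exprn_gt0 // expr0 mul1r expR_gt0.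
Qed.

Lemma bump_supp (u0 : V) (r : R) (u : V) i : 0 <= r -> r < `|u 0 i - u0 0 i| -> bump u0 r u = 0.
Proof.
move=> r0 ur; rewrite /bump /flat ifF //; apply/negbTE; rewrite -leNgt subr_le0.
rewrite (bigD1 i) //= ler_wpDr //; first by apply: sumr_ge0 => j _; exact: sqr_ge0.
by rewrite -[leRHS]real_normK ?num_real // ler_sqr ?nnegrE // ltW.
Qed.

End Flat.

Section ExtendedConnection.
Variables (R : realType) (n : nat) (T : topologicalType) (I : Type).
Variable phi : I -> chart R n T.
Local Notation V := 'rV[R]_n.+1.
Local Notation e_ := (unit_vec R).
Local Notation cr i := (crd (phi i)).
Local Notation pr i := (par (phi i)).
Local Notation dm i := (dom (phi i)).
Local Notation H := (half_space (n := n)).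
Hypothesis mfd : manifold_with_boundary phi.

(* Closed because compact: this is where the Hausdorff hypothesis enters. *)
Lemma half_box_closed i (u0 : V) (r : R) (O : set V) : u0 0 0 = 0 ->
  (forall v, H v -> (forall k, `|v 0 k - u0 0 k| <= r) -> O v) ->
  (forall v, O v -> H v -> (cr i @` dm i) v) ->
  closed (pr i @` [set v | H v /\ forall k, `|v 0 k - u0 0 k| <= r]).
Proof.
move=> u00 boxO OE; have [hT _ _ _] := mfd.
pose A (k : 'I_n.+1) : set R :=
  [set` (if k == 0 then `[0, r] else `[u0 0 k - r, u0 0 k + r])].
have KE : [set v : V | H v /\ forall k, `|v 0 k - u0 0 k| <= r] = [set v | forall k, A k (v ord0 k)].
  apply/seteqP; split=> v /=.
    move=> [Hv vr] k; have := vr k; rewrite ler_distl /A /=.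
    case: eqP => [->|_]; last by rewrite in_itv.
    by rewrite u00 [0 + r]add0r => /andP[_ vr0]; rewrite in_itv /= vr0 andbT.
  move=> vA; have := vA 0; rewrite /A eqxx /= in_itv /= => /andP[h1 h2]; have r0 := le_trans h1 h2.
  split=> // k; have := vA k; rewrite ler_distl /A /=.
  case: eqP => [->|_] /=; last by rewrite in_itv.
  rewrite u00 [0 + r]add0r h2 andbT => _; apply: le_trans h1.
  by rewrite sub0r oppr_le0.
apply: compact_closed => //; apply: continuous_compact.
  apply: (@continuous_subspaceW _ _ _ (cr i @` dm i)); last exact: par_continuous.
  by move=> v /= [Hv vr]; apply: OE => //; exact: boxO.
rewrite KE; apply: rV_compact => k; rewrite /A; case: ifP => _; exact: segment_compact.
Qed.

(** The extension property of the projective structure is tested on vector fields over all of [U],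
    which a chart need not cover. The coordinate field is therefore cut off inside a compact box and
    continued by zero; closedness of the box in the manifold gives smoothness outside the chart. *)
Lemma extend_coordinate_field (U : set T) i x : boundary_pts phi x -> dm i x ->
  exists (O : set V) (chi : V -> R), [/\ open O, O (cr i x), Cinfty setT chi,
    forall v, O v -> 0 < chi v &
    forall a, exists2 X : components R n I n.+1 1, smooth_section phi (tangent R n) U X &
      forall v, O v -> H v -> X i v = chi v *: delta_mx a 0].
Proof.
move=> xbd xi; have [ O1 [ O1o O1u O1E]] := near_img xi openT Logic.I.
pose u0 := cr i x; have u00 : u0 0 0 = 0 by exact: (boundary_chart mfd).
have [r2 r20 Hr] := (near_ballP _ _).1 (near_open O1o O1u).
pose r := r2 / 2; have r0 : 0 < r by rewrite divr_gt0.
have rr2 : r < r2 by rewrite ltr_pdivrMr // ltr_pMr // ltr1n.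
have boxO (v : V) : (forall k, `|v 0 k - u0 0 k| <= r) -> O1 v.
  move=> vr; apply: Hr; apply: le_lt_trans rr2; apply/mx_norm_leP; first exact: ltW.
  by move=> k l; rewrite !mxE ord1.
pose K := pr i @` [set v | H v /\ forall k, `|v 0 k - u0 0 k| <= r].
have Kc : closed K.
  apply: (half_box_closed (O := O1)) => // [v _|v Ov Hv]; first exact: boxO.
  by have [h1 _ h2] := O1E v Ov Hv; exists (pr i v).
pose chi := bump u0 r.
have chis : Cinfty setT chi by exact: bump_smooth.
have chi_pos : nbhs u0 [set v | 0 < chi v].
  have C := Cinfty_cont openT (Logic.I : setT u0) chis.
  have N0 : nbhs (chi u0) [set y : R | 0 < y].
    by apply: open_nbhs_nbhs; split; [exact: open_gt|exact: bump_center].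
  exact: (C _ N0).
have [r3 r30 Hr3] := (near_ballP _ _).1 (filterI chi_pos (near_open O1o O1u)).
exists [set v | `|v - u0| < r3], chi; split.
- exact: ballO_open.
- by rewrite /= subrr normr0.
- exact: chis.
- by move=> v /Hr3[].
move=> a.
(* Components in the chart [j] are those of the cut-off field transported by the Jacobian; the value
   is 0 outside the chart [i]. *)
pose X : components R n I n.+1 1 := fun j v =>
  if pselect (dm i (pr j v)) then
    chi (cr i (pr j v)) *: (Jac (transition phi i j) (cr i (pr j v)) *m delta_mx a 0) else 0.
have XE j y : dm i y -> dm j y ->
    X j (cr j y) = chi (cr i y) *: (Jac (transition phi i j) (cr i y) *m delta_mx a 0).
  by move=> yi yj; rewrite /X crdK //; case: pselect.
have X0 j y : ~ dm i y -> dm j y -> X j (cr j y) = 0.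
  by move=> yi yj; rewrite /X crdK //; case: pselect.
exists X; last first.
  move=> v /Hr3[_ O1v] Hv; have [h1 _ h2] := O1E v O1v Hv.
  by rewrite -{1}h2 XE // Jac_id // mul1mx h2.
split=> //.
- move=> j k y _ yj yk; have [yi|yi] := pselect (dm i y).
    by rewrite !XE //= -scalemxAr mulmxA -Jac_chain.
  by rewrite !X0 //= mulmx0.
- move=> j k l _ [y [_ yj] <-]; have [yi|yi] := pselect (dm i y).
    (* The components are functions of the coordinates in [j] while the field is given in those of
       [i], so transition maps in both directions are needed. *)
    have [D [F [[Do Du Fs FD] DE]]] := transition_jac mfd yi yj openT Logic.I.
    have [D' [F' [[D'o D'u F's F'D] D'E]]] := transition_jac mfd yj yi Do Du.
    pose Z (v : V) : 'cV[R]_n.+1 := chi (F' v) *: (jacobian_mx F (F' v) *m delta_mx a 0).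
    have M : smoothM D' Z.
      have H1 : Cinfty D' (fun v => chi (F' v)).
        by apply: (Cinfty_comp D'o openT _ _ chis) => // c; exact: F's.
      have H2 : smoothM D' (fun v => jacobian_mx F (F' v)).
        move=> b c; apply: (Cinfty_comp D'o Do _ _ (jacobian_mx_smooth Do Fs b c)).
          by move=> d; exact: F's.
        by move=> v /F'D[].
      apply: (smoothM_scale D'o H1); apply: (smoothM_mul D'o H2); exact: smoothM_cst.
    exists D', (fun v => Z v k l); split; [exact: D'o|exact: D'u|exact: M|].
    move=> v D'v [z [_ zj] zv]; have Hv : H v by rewrite -zv; exact: crd_half.
    have [[h1 h2 h3 h4] _ _ _] := D'E v D'v Hv.
    have E : X j v = Z v.
      rewrite /Z -{1}h3 XE // h4; have [DF' _] := F'D v D'v.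
      have HF' : H (F' v) by rewrite -h4; exact: crd_half.
      by have [_ -> _ _] := DE _ DF' HF'.
    by rewrite E.
  have Ko : open (~` K) by exact: closed_openC.
  have Ky : (~` K) y.
    move=> [v [Hv vr] vy]; apply: yi; rewrite -vy.
    by have [] := O1E v (boxO v vr) Hv.
  have [D [Do Du DE]] := near_img yj Ko Ky.
  exists D, (fun=> 0); split=> //; first exact: Cinfty_cst.
  move=> v Dv [z [_ zj] zv]; have Hv : H v by rewrite -zv; exact: crd_half.
  have [h1 h2 h3] := DE v Dv Hv.
  (* A neighbour of [y] may lie in the chart [i] again, but outside the box, where the bump function
     vanishes. *)
  rewrite -h3; have [yi'|yi'] := pselect (dm i (pr j v)); last by rewrite X0 // mxE.
  rewrite XE //.
  have -> : chi (cr i (pr j v)) = 0; last by rewrite scale0r mxE.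
  have /existsNP[k0 Hk0] : ~ forall k, `|cr i (pr j v) 0 k - u0 0 k| <= r.
    move=> vr; apply: h2; exists (cr i (pr j v)); last by rewrite crdK.
    by split=> //; exact: crd_half.
  by apply: (bump_supp (i := k0) (ltW r0)); rewrite ltNge; exact/negP.
Qed.

(* For X = chi e_a and Y = chi e_b the coefficients can be read off wherever
   chi does not vanish. *)
Lemma projective_change_coordinate (Gam : conn_coef R n) Ups (O : set V) chi
    (X Y : V -> 'cV[R]_n.+1) a b c u :
  open O -> O u -> O `<=` H -> Cinfty O chi ->
  (forall v, O v -> X v = chi v *: delta_mx a 0) ->
  (forall v, O v -> Y v = chi v *: delta_mx b 0) ->
  projective_change Gam Ups X Y u c 0 = (c == b)%:R * (chi u * der a chi u) +
    chi u * chi u * (Gam c a b u + (c == b)%:R * Ups u 0 a + (c == a)%:R * Ups u 0 b).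
Proof.
move=> Oo Ou OH chis XE YE.
have deltaE d k v : (chi v *: delta_mx d 0 : 'cV[R]_n.+1) k 0 = (k == d)%:R * chi v.
  by rewrite !mxE eqxx andbT mulrC.
have Yk k v : O v -> Y v k 0 = (k == b)%:R * chi v by move=> Ov; rewrite YE // deltaE.
have Xk k v : O v -> X v k 0 = (k == a)%:R * chi v by move=> Ov; rewrite XE // deltaE.
have pdY d : pd d (fun v => Y v c 0) u = (c == b)%:R * der d chi u.
  rewrite (@pd_der R n O _ (fun v => (c == b)%:R * chi v) d u Oo Ou (OH u Ou)).
  - exact: (derZ Oo _ d Ou chis).
  - have S : Cinfty O (fun v => (c == b)%:R * chi v) by apply: CinftyM => //; exact: Cinfty_cst.
    by have [] := Cinfty_has_der d S Ou.
  - by move=> v Ov _; exact: Yk.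
rewrite /projective_change /cov_deriv mxE [X in X + _]mxE [X in X + _ + _]mxE.
rewrite [X in _ + X + _]mxE [X in _ + X]mxE !Yk // !Xk //.
have UE (Z : 'cV[R]_n.+1) d : (forall k, Z k 0 = (k == d)%:R * chi u) ->
    (Ups u *m Z) 0 0 = Ups u 0 d * chi u.
  move=> ZE; rewrite mxE -(sum_delta d (fun k => Ups u 0 k * chi u)).
  by apply: eq_bigr => k _; rewrite ZE mulrCA.
rewrite (UE _ a) => [|k]; last exact: Xk.
rewrite (UE _ b) => [|k]; last exact: Yk.
have -> : \sum_d X u d 0 * pd d (fun v => Y v c 0) u = (c == b)%:R * (chi u * der a chi u).
  rewrite -(sum_delta a (fun d => (c == b)%:R * (chi u * der d chi u))).
  by apply: eq_bigr => d _; rewrite pdY Xk //; move: (der d chi u) => z; ring.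
have -> : \sum_d \sum_e Gam c d e u * X u d 0 * Y u e 0 = chi u * chi u * Gam c a b u.
  rewrite -(sum_delta a (fun d => chi u * chi u * Gam c d b u)); apply: eq_bigr => d _.
  rewrite -(sum_delta b (fun e => chi u * chi u * Gam c d e u)) mulr_sumr.
  by apply: eq_bigr => e _; rewrite Xk // Yk //; ring.
by move: (der a chi u) => z; ring.
Qed.

Theorem extended_coefficients (Gam : I -> conn_coef R n) i x :
  projective_structure_extends phi Gam -> boundary_pts phi x -> dm i x ->
  exists (O : set V) (hatG : 'I_n.+1 -> 'I_n.+1 -> 'I_n.+1 -> V -> R) (Ups : 'I_n.+1 -> V -> R),
    [/\ open O, O (cr i x), forall c a b, Cinfty O (hatG c a b),
      (forall v, O v -> H v -> dm i (pr i v) /\ cr i (pr i v) = v) &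
      forall c a b v, upper O v -> hatG c a b v =
        Gam i c a b v + (c == b)%:R * Ups a v + (c == a)%:R * Ups b v].
Proof.
move=> proj xbd xi; have [U [Ups [Uo Ux _ ext]]] := proj x xbd.
have [ O [chi [ Oo Ou chis chi0 fields]]] := extend_coordinate_field U xbd xi.
pose X a := s2val (cid2 (fields a)).
have Xs a : smooth_section phi (tangent R n) U (X a) by rewrite /X; case: cid2.
have XE a v : O v -> H v -> X a i v = chi v *: delta_mx a 0.
  exact: (s2valP' (cid2 (fields a)) v).
have [D [Do Du DE]] := near_img xi Uo Ux.
have loc a b : exists Wh : set V * (V -> 'cV[R]_n.+1), [/\ open Wh.1, Wh.1 (cr i x),
   smoothM Wh.1 Wh.2 & forall v, upper (Wh.1 `&` D) v ->
     projective_change (Gam i) (Ups i) (X a i) (X b i) v = Wh.2 v].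
  have [s [_ _ ss] sE] := ext _ _ (Xs a) (Xs b).
  have Ax : (cr i @` (U `&` dm i)) (cr i x) by exists x.
  have [W [h [Wo Wu hs sh]]] := smooth_mx_local (ss i) Ax.
  exists (W, h); split=> // v [[Wv Dv] v0].
  have [h1 h2 h3] := DE v Dv (ltW v0).
  have vint : interior_pts phi (pr i v) by exists i; rewrite ?h3.
  have := sE i _ h2 vint h1; rewrite h3 => <-; rewrite sh //.
  by exists (pr i v).
pose W a b := sval (cid (loc a b)).
have WP a b : [/\ open (W a b).1, (W a b).1 (cr i x), smoothM (W a b).1 (W a b).2 &
   forall v, upper ((W a b).1 `&` D) v ->
     projective_change (Gam i) (Ups i) (X a i) (X b i) v = (W a b).2 v].
  by rewrite /W; case: cid.
have N : nbhs (cr i x) [set v | forall ab : 'I_n.+1 * 'I_n.+1, (W ab.1 ab.2).1 v].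
  apply: (@filter_forall _ _ (fun ab v => (W ab.1 ab.2).1 v) _ (nbhs_filter (cr i x))) => ab.
  by have [? ? _ _] := WP ab.1 ab.2; exact: near_open.
have [r r0 Hr] := (near_ballP _ _).1 (filterI (filterI N (near_open Oo Ou)) (near_open Do Du)).
pose B : set V := [set v | `|v - cr i x| < r].
have Bo : open B by exact: ballO_open.
have BO : B `<=` O by move=> v /Hr[[]].
have BD : B `<=` D by move=> v /Hr[].
have BW a b : B `<=` (W a b).1 by move=> v /Hr[[h _] _]; exact: (h (a, b)).
have chiB : Cinfty B chi by apply: Cinfty_sub chis.
have chin0 v : B v -> chi v * chi v != 0.
  by move=> /BO /chi0 h; rewrite mulf_neq0 // gt_eqF.
(* The coordinate formula for the projective change of chi e_a and chi e_b, solved for the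
   coefficient, with the smooth extension [W a b] in place of the projective change itself. *)
pose hatG c a b v := ((W a b).2 v c 0 - (c == b)%:R * (chi v * der a chi v)) * (chi v * chi v)^-1.
exists B, hatG, (fun a v => Ups i v 0 a); split=> //.
- by rewrite /B /= subrr normr0.
- move=> c a b; apply: (CinftyM Bo); last first.
    by apply: (Cinfty_inv Bo chin0); exact: CinftyM.
  apply: (CinftyB Bo).
    by have [_ _ h _] := WP a b; exact: (Cinfty_sub (@BW a b) (h c 0)).
  apply: (CinftyM Bo); first exact: Cinfty_cst.
  by apply: (CinftyM Bo chiB); exact: Cinfty_der.
- by move=> v Bv Hv; have [h1 _ h2] := DE v (BD v Bv) Hv.
move=> c a b v [Bv v0]; have [_ _ _ WE] := WP a b.
have uo := upper_open Bo.
have uH : upper B `<=` H by move=> w [_]; exact: ltW.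
have chiu : Cinfty (upper B) chi by apply: Cinfty_sub chiB => w [].
have E k : forall w, upper B w -> X k i w = chi w *: delta_mx k 0.
  by move=> w [Bw w0]; apply: XE; [exact: BO|exact: ltW].
rewrite /hatG -WE; last by split=> //; split; [exact: (@BW a b)|exact: BD].
rewrite (projective_change_coordinate _ _ c uo (conj Bv v0) uH chiu (E a) (E b)).
by rewrite [X in (X - _) * _]addrC addrK mulrAC mulfV ?mul1r // chin0.
Qed.

End ExtendedConnection.

(** * Behaviour under coordinate changes *)

Lemma jet_log_cancel (R : realType) (d t s m x : R) : x != 0 ->
  d * (m * t + s) + - 1 * m * (x * t / x) * d = d * s.
Proof. by move=> x0; field. Qed.

Lemma curvature_collect (R : realType) p q (j1 j2 r1 r2 t1 t2 s b1 b2 q1 q2 : 'M[R]_(p, q)) :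
  r1 - t1 + j1 = s + (b1 + (t2 - q1)) -> r2 - t2 + j2 = s + (b2 + (t1 - q2)) ->
  j1 - j2 + r1 - r2 = b1 - b2 + q2 - q1.
Proof.
move=> /matrixP E1 /matrixP E2; apply/matrixP => i j.
by have := E1 i j; have := E2 i j; rewrite !mxE; lra.
Qed.

Lemma mx_addsubE (R : pzRingType) p q (X Y Z W : 'M[R]_(p, q)) i j :
  (X - Y + Z - W) i j = X i j - Y i j + Z i j - W i j.
Proof. by rewrite !mxE. Qed.

Lemma lincomb_mxE (R : pzRingType) (I : finType) p q (c : I -> R) (M : I -> 'M[R]_(p, q)) i j :
  (\sum_l c l *: M l) i j = \sum_l c l * M l i j.
Proof. by rewrite summxE; apply: eq_bigr => l _; rewrite mxE. Qed.

Lemma cancel_common (V : zmodType) (x x' y z w t : V) : x' = x ->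
  x + y - (x' + z) + w - t = y - z + w - t.
Proof. by move=> ->; rewrite opprD addrACA subrr add0r. Qed.

(** [S] stands for the second derivative of the Jacobian; being symmetric in the two directions, it
    drops out of the antisymmetrised equations. *)
Lemma curvature_algebra (R : realType) p (J Ga Gb Ba Bb Gab Gba Bab Bba S Ja Jb : 'M[R]_p) :
  J *m Ga = Ja + Ba *m J -> J *m Gb = Jb + Bb *m J ->
  Ja *m Gb + J *m Gab = S + (Bab *m J + Bb *m Ja) ->
  Jb *m Ga + J *m Gba = S + (Bba *m J + Ba *m Jb) ->
  J *m (Gab - Gba + Ga *m Gb - Gb *m Ga) = (Bab - Bba + Ba *m Bb - Bb *m Ba) *m J.
Proof.
move=> Ea Eb; have -> : Ja = J *m Ga - Ba *m J by rewrite Ea addrK.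
have -> : Jb = J *m Gb - Bb *m J by rewrite Eb addrK.
rewrite !mulmxBl !mulmxBr !mulmxA => E1 E2.
by rewrite mulmxDr mulmxBr mulmxDl mulmxBl !mulmxA (curvature_collect E1 E2).
Qed.

Lemma compat_collect (R : comNzRingType) p q (J D : 'M[R]_(p, q)) (G B : 'M[R]_p) :
  (D^T *m G + J^T *m (G *m B + B^T *m G)) *m J + J^T *m G *m D =
  J^T *m (G *m (D + B *m J)) + (D + B *m J)^T *m G *m J.
Proof.
have -> : (D + B *m J)^T = D^T + J^T *m B^T by rewrite raddfD /= trmx_mul.
rewrite !(mulmxDl, mulmxDr) !mulmxA [RHS]addrC -!addrA; congr (_ + _).
by rewrite addrC -addrA.
Qed.

Definition splitting_form (R : realType) n (y : 'I_n.+1 -> R) : 'M[R]_(1 + n.+1) :=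
  block_mx 1%:M 0 (\col_a y a) 1%:M.

(** The hypothesis is the transformation law of the connection form on E(1). It says that in the two
    splittings the change of jets becomes block diagonal. *)
Lemma jet_split (R : realType) n (d : R) (J : 'M[R]_n.+1) (p y y' : 'I_n.+1 -> R) :
  (forall a, d * y a + p a = d * \sum_l J l a * y' l) ->
  splitting_form y *m jet_form d J p =
  block_mx d%:M 0 0 (d *: J^T) *m splitting_form y'.
Proof.
move=> E; rewrite /splitting_form /jet_form !mulmx_block.
rewrite !mul1mx !mulmx1 !mul0mx !mulmx0 !addr0 !add0r; congr block_mx.
apply/colP => a; rewrite mul_mx_scalar -scalemxAl !mxE E; congr (_ * _).
by apply: eq_bigr => l _; rewrite !mxE.
Qed.

(** By [jet_split] the congruence by the jet change reduces to the blocks, which scale by d^2; no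
    mixed terms arise because the middle slot is zero. *)
Lemma tractor_algebra (R : realType) n (d k k' : R) (J z z' : 'M[R]_n.+1) (p y y' : 'I_n.+1 -> R) :
  (forall a, d * y a + p a = d * \sum_l J l a * y' l) ->
  z' = (d * d) *: (J *m z *m J^T) -> k' = (d * d) * k ->
  (splitting_form y')^T *m block_mx k'%:M 0 0 z' *m splitting_form y' =
  (jet_form d J p)^T *m ((splitting_form y)^T *m block_mx k%:M 0 0 z *m splitting_form y) *m
    jet_form d J p.
Proof.
move=> E Ez Ek; rewrite -!mulmxA (jet_split E) !mulmxA -trmx_mul (jet_split E) trmx_mul.
congr (_ *m _); rewrite -!mulmxA; congr (_ *m _).
rewrite tr_block_mx !mulmx_block !(trmx0, mul0mx, mulmx0, addr0, add0r).
rewrite tr_scalar_mx linearZ /= trmxK -!scalar_mxM; congr (block_mx _ _ _ _).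
  by rewrite Ek mulrCA mulrC mulrA.
by rewrite Ez -scalemxAl -!scalemxAr scalerA mulmxA.
Qed.

Lemma L_kappa_curvature (R : realType) n (h : 'rV[R]_n.+1 -> 'M[R]_n.+1) u :
  n.+1%:R^-1 * (\sum_a \sum_b tau_inv_metric h u a b * proj_schouten (christoffel h) a b u) =
  n.+1%:R^-1 * n%:R^-1 * ((tau h u)^-1 * scalar_curvature h u).
Proof.
rewrite -mulrA; congr (_ * _).
rewrite /scalar_curvature !mulr_sumr; apply: eq_bigr => a _; rewrite !mulr_sumr.
by apply: eq_bigr => b _; rewrite /tau_inv_metric mxE /proj_schouten; ring.
Qed.

Section Naturality.
Variables (R : realType) (n : nat).
Local Notation V := 'rV[R]_n.+1.
Local Notation ix := 'I_n.+1.
Variables (O O' : set V) (F : V -> V) (J g g' : V -> 'M[R]_n.+1).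
Hypotheses (Oo : open O) (O'o : open O').
Hypotheses (Oh : O `<=` half_space (n := n)) (O'h : O' `<=` half_space (n := n)).
Hypotheses (Fs : smoothM O F) (FO : forall v, O v -> O' (F v)).
Hypotheses (Js : smoothM O J) (Ju : forall v, O v -> J v \in unitmx).
Hypothesis JE : forall k a v, O v -> J v k a = der a (fun w => F w 0 k) v.
Hypotheses (gs : smoothM O g) (gsym : forall u, O u -> (g u)^T = g u)
  (gunit : forall u, O u -> g u \in unitmx).
Hypotheses (g's : smoothM O' g') (g'sym : forall u, O' u -> (g' u)^T = g' u)
  (g'unit : forall u, O' u -> g' u \in unitmx).
Hypothesis gE : forall v, O v -> g v = (J v)^T *m g' (F v) *m J v.

Lemma der_pullback a (f : V -> R) u : O u -> Cinfty O' f ->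
  der a (fun v => f (F v)) u = \sum_l J u l a * der l f (F u).
Proof.
move=> Ou fs; rewrite (der_comp a Oo O'o (fun b => Fs 0 b) Ou (FO Ou) fs).
by apply: eq_bigr => l _; rewrite mulrC JE.
Qed.

Lemma smoothM_pullback p q (M : V -> 'M[R]_(p, q)) : smoothM O' M ->
  smoothM O (fun v => M (F v)).
Proof.
by move=> Ms i j; apply: (Cinfty_comp Oo O'o _ FO (Ms i j)) => c; exact: Fs.
Qed.

Lemma dM_pullback p q a (M : V -> 'M[R]_(p, q)) u : O u -> smoothM O' M ->
  dM a (fun v => M (F v)) u = \sum_l J u l a *: dM l M (F u).
Proof.
move=> Ou Ms; apply/matrixP => i j; rewrite dME summxE (der_pullback a Ou (Ms i j)).
by apply: eq_bigr => l _; rewrite mxE dME.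
Qed.

Lemma jacobian_closed a b k u : O u -> dM a J u k b = dM b J u k a.
Proof.
move=> Ou; rewrite !dME.
rewrite (der_eq a Oo Ou (fun v Ov => JE k b Ov)) (der_eq b Oo Ou (fun v Ov => JE k a Ov)).
exact: (schwarz a b Oo Ou (Fs 0 k 2%N)).
Qed.

Let Gam a u := conn_mx (christoffel g) a u.
Let Gam' a u := conn_mx (christoffel g') a u.

Lemma conn_mx_smooth (D : set V) (h : V -> 'M[R]_n.+1) a : open D -> D `<=` half_space (n := n) ->
  smoothM D h -> (forall u, D u -> h u \in unitmx) -> smoothM D (conn_mx (christoffel h) a).
Proof.
move=> Do Dh hs hu c b; apply: (Cinfty_eq Do _ (christoffel_smooth Do Dh hs hu c a b)) => v _.
by rewrite mxE.
Qed.

Let Gs a : smoothM O (Gam a). Proof. exact: conn_mx_smooth. Qed.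
Let G's a : smoothM O' (Gam' a). Proof. exact: conn_mx_smooth. Qed.

(** The connection matrix of [g'] on the tangent bundle pulled back along [F]: only the form index
    is contracted with the Jacobian. *)
Definition pullback_conn a u : 'M[R]_n.+1 := \sum_l J u l a *: Gam' l (F u).
Local Notation B := pullback_conn.

Lemma conn_sym (D : set V) (h : V -> 'M[R]_n.+1) a b c u : open D -> D `<=` half_space (n := n) ->
  smoothM D h -> (forall u, D u -> (h u)^T = h u) -> D u ->
  conn_mx (christoffel h) a u c b = conn_mx (christoffel h) b u c a.
Proof. by move=> Do Dh hs hsym Du; rewrite mxE [RHS]mxE; exact: (christoffel_sym Do Dh hs hsym). Qed.

(* The right-hand side defines a symmetric connection compatible with [g]. *)
Lemma christoffel_transform a u : O u -> J u *m Gam a u = dM a J u + B a u *m J u.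
Proof.
move=> Ou; have O'u := FO Ou.
pose Gt a := invmx (J u) *m (dM a J u + B a u *m J u).
suff E : forall a, Gam a u = Gt a by rewrite E mulKVmx // Ju.
have tmp k c b : (dM c J u + B c u *m J u) k b = (dM b J u + B b u *m J u) k c.
  rewrite mxE [RHS]mxE jacobian_closed //; congr (_ + _); rewrite mxE [RHS]mxE.
  have S p q : B p u k q = \sum_l J u l p * Gam' l (F u) k q.
    exact: lincomb_mxE.
  under eq_bigr do rewrite S mulr_suml; rewrite exchange_big.
  apply: eq_bigr => l _; rewrite S mulr_suml; apply: eq_bigr => m _.
  rewrite /Gam' (conn_sym l m k O'o O'h g's g'sym O'u).
  by move: (conn_mx _ _ _ _ _) => z; ring.
apply: (conn_mx_unique (gunit Ou) (gsym Ou)).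
- by move=> p q r; exact: (conn_sym p q r Oo Oh gs gsym Ou).
- move=> p q r; rewrite /Gt mxE [RHS]mxE; apply: eq_bigr => k _; congr (_ * _); exact: tmp.
move=> c; rewrite (metric_compat Oo Oh gs gsym gunit c Ou).
pose G v := g' (F v); have Gsm : smoothM O G by exact: smoothM_pullback.
have DG : dM c G u = G u *m B c u + (B c u)^T *m G u.
  have BT : (B c u)^T = \sum_l J u l c *: (Gam' l (F u))^T.
    by rewrite /B raddf_sum; apply: eq_bigr => l _; rewrite [LHS]linearZ.
  rewrite (dM_pullback c Ou g's) BT /B mulmx_sumr mulmx_suml -big_split.
  apply: eq_bigr => l _; rewrite -(metric_compat O'o O'h g's g'sym g'unit l O'u).
  by rewrite -scalemxAr -scalemxAl scalerDr.
have JT : smoothM O (fun v => (J v)^T) by exact: smoothM_tr.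
have E : g u *m Gt c = (J u)^T *m (G u *m (dM c J u + B c u *m J u)).
  by rewrite gE // /Gt -!mulmxA mulKVmx ?Ju.
have E' : (Gt c)^T *m g u = ((dM c J u + B c u *m J u)^T *m G u) *m J u.
  rewrite -{1}(gsym Ou) -trmx_mul E !trmx_mul trmxK /G g'sym //.
rewrite E E' (dM_eq Oo c Ou gE) (dM_mul Oo c Ou (smoothM_mul Oo JT Gsm) Js).
rewrite (dM_mul Oo c Ou JT Gsm) dM_tr DG.
exact: compat_collect.
Qed.

Definition curv_mx (G : conn_coef R n) a b u : 'M[R]_n.+1 := \matrix_(c, d) riemann G a b c d u.

Definition ric_mx (G : conn_coef R n) u : 'M[R]_n.+1 := \matrix_(a, b) ricci G a b u.

Lemma curv_mxE (D : set V) (h : V -> 'M[R]_n.+1) a b u : open D -> D `<=` half_space (n := n) ->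
  smoothM D h -> (forall u, D u -> h u \in unitmx) -> D u ->
  let G c := conn_mx (christoffel h) c in
  curv_mx (christoffel h) a b u = dM a (G b) u - dM b (G a) u + G a u *m G b u - G b u *m G a u.
Proof.
move=> Do Dh hs hu Du G; apply/matrixP => c d; rewrite mxE /riemann.
have E p q : pd p (christoffel h c q d) u = dM p (G q) u c d.
  rewrite (pd_open p Do Dh Du (christoffel_smooth Do Dh hs hu c q d)) dME.
  by apply: der_ext => v; rewrite mxE.
have P p q : (G p u *m G q u) c d = \sum_e christoffel h c p e u * christoffel h e q d u.
  by rewrite mxE; apply: eq_bigr => e _; rewrite [X in X * _]mxE [X in _ * X]mxE.
rewrite !E mx_addsubE.
by rewrite !P sumrB addrA.
Qed.

Lemma dM_sum p q a (A : ix -> V -> 'M[R]_(p, q)) u : O u -> (forall l, smoothM O (A l)) ->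
  dM a (fun v => \sum_l A l v) u = \sum_l dM a (A l) u.
Proof.
move=> Ou As; apply/matrixP => i j; rewrite dME summxE.
rewrite (der_ext a u (fun v => summxE _ _ _ i j)) (der_sum _ a Ou) => [|l]; last exact: As.
by apply: eq_bigr => l _; rewrite dME.
Qed.

Lemma pullback_conn_smooth a : smoothM O (B a).
Proof.
move=> c d; apply: (@Cinfty_eq _ _ _ (fun u => \sum_l J u l a * Gam' l (F u) c d)) => //.
  by move=> u _; exact/esym/lincomb_mxE.
apply: (Cinfty_sum _ Oo) => l; apply: (CinftyM Oo); first exact: Js.
exact: (smoothM_pullback (@G's l) c d).
Qed.

Lemma dM_pullback_conn a b u : O u -> dM a (B b) u =
  \sum_l dM a J u l b *: Gam' l (F u) +
  \sum_l \sum_m (J u l a * J u m b) *: dM l (Gam' m) (F u).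
Proof.
move=> Ou; have S l : smoothM O (fun v => J v l b *: Gam' l (F v)).
  exact: (smoothM_scale Oo (Js l b) (smoothM_pullback (@G's l))).
rewrite /B (dM_sum a Ou S) [X in _ = _ + X]exchange_big -big_split; apply: eq_bigr => l _.
rewrite (dM_scale a Ou (Js l b) (smoothM_pullback (@G's l))) (dM_pullback a Ou (@G's l)).
rewrite scaler_sumr -dME; congr (_ + _); apply: eq_bigr => m _.
by rewrite scalerA mulrC.
Qed.

(* Antisymmetrise the derivative of [dM b J = J *m Gam b - B b *m J]. *)
Lemma curvature_transform a b u : O u -> J u *m curv_mx (christoffel g) a b u =
  (\sum_l \sum_m (J u l a * J u m b) *: curv_mx (christoffel g') l m (F u)) *m J u.
Proof.
move=> Ou; have O'u := FO Ou.
have EE p q : dM p J u *m Gam q u + J u *m dM p (Gam q) u =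
    dM p (dM q J) u + (dM p (B q) u *m J u + B q u *m dM p J u).
  rewrite -(dM_mul Oo p Ou Js (@Gs q)).
  rewrite -(dM_mul Oo p Ou (@pullback_conn_smooth q) Js).
  rewrite -(dM_add p Ou (smoothM_dM Oo q Js) (smoothM_mul Oo (@pullback_conn_smooth q) Js)).
  by apply: (dM_eq Oo p Ou) => v Ov; exact: christoffel_transform.
have Eba := EE b a; rewrite (dM_schwarz Oo b a Ou Js) in Eba.
rewrite (curv_mxE a b Oo Oh gs gunit Ou) /=.
rewrite (curvature_algebra (christoffel_transform a Ou) (christoffel_transform b Ou) (EE a b) Eba).
congr (_ *m _).
have BB p q : B p u *m B q u = \sum_l \sum_m (J u l p * J u m q) *: (Gam' l (F u) *m Gam' m (F u)).
  rewrite mulmx_suml; apply: eq_bigr => l _; rewrite mulmx_sumr; apply: eq_bigr => m _.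
  by rewrite -scalemxAl -scalemxAr scalerA.
rewrite !dM_pullback_conn // !BB.
have closedE : \sum_l dM b J u l a *: Gam' l (F u) = \sum_l dM a J u l b *: Gam' l (F u).
  by apply: eq_bigr => l _; rewrite (jacobian_closed b a l Ou).
rewrite (cancel_common _ _ _ _ closedE).
rewrite [X in _ - X + _ - _]exchange_big [X in _ + _ - X]exchange_big -sumrB -!big_split.
rewrite -sumrB; apply: eq_bigr => l _; rewrite -sumrB -!big_split -sumrB; apply: eq_bigr => m _.
rewrite (curv_mxE l m O'o O'h g's g'unit O'u) /= [J u m b * _]mulrC.
by rewrite [RHS]scalerBr scalerDr scalerBr.
Qed.

Lemma ricci_transform u : O u ->
  ric_mx (christoffel g) u = (J u)^T *m ric_mx (christoffel g') (F u) *m J u.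
Proof.
move=> Ou; apply/matrixP => a b.
pose R' l m := curv_mx (christoffel g') l m (F u); pose K := invmx (J u).
have CE k : riemann (christoffel g) k a k b u =
    \sum_l \sum_m (J u l k * J u m a) * (K *m R' l m *m J u) k b.
  transitivity (curv_mx (christoffel g) k a u k b); first by rewrite mxE.
  rewrite -[curv_mx _ _ _ _](mulKmx (Ju Ou)) curvature_transform // mulmxA.
  rewrite mulmx_sumr mulmx_suml summxE; apply: eq_bigr => l _.
  rewrite mulmx_sumr mulmx_suml summxE; apply: eq_bigr => m _.
  by rewrite -scalemxAr -scalemxAl mxE.
rewrite mxE /ricci; under eq_bigr do rewrite CE exchange_big.
rewrite exchange_big -mulmxA mxE; apply: eq_bigr => m _.
rewrite exchange_big [X in X * _]mxE mxE mulr_sumr.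
transitivity (\sum_l J u m a * (R' l m *m J u) l b).
  apply: eq_bigr => l _; have -> : R' l m *m J u = J u *m (K *m R' l m *m J u).
    by rewrite !mulmxA mulmxV ?mul1mx // Ju.
  by rewrite [in RHS]mxE mulr_sumr; apply: eq_bigr => k _; rewrite mulrCA mulrA.
under eq_bigr do rewrite mxE mulr_sumr; rewrite exchange_big; apply: eq_bigr => q _.
rewrite -mulr_sumr -mulr_suml; congr (_ * (_ * _)); rewrite mxE; apply: eq_bigr => l _.
by rewrite mxE.
Qed.

Lemma invmx_transform u : O u -> J u *m invmx (g u) *m (J u)^T = invmx (g' (F u)).
Proof.
move=> Ou; have gu := gunit Ou; have g'u := g'unit (FO Ou); have J1 := Ju Ou.
have JT : (J u)^T \in unitmx by rewrite unitmx_tr.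
have E : g' (F u) *m (J u *m invmx (g u) *m (J u)^T) = 1%:M.
  apply: (can_inj (mulKmx JT)); rewrite mulmx1 !mulmxA -gE // mulmxV // mul1mx //.
by rewrite -[LHS](mulKmx g'u) E mulmx1.
Qed.

Lemma scalar_curvature_tr (h : V -> 'M[R]_n.+1) v :
  scalar_curvature h v = \tr (invmx (h v) *m (ric_mx (christoffel h) v)^T).
Proof.
rewrite /mxtrace /scalar_curvature; apply: eq_bigr => a _; rewrite mxE.
by apply: eq_bigr => b _; rewrite [X in _ = _ * X]mxE [X in _ = _ * X]mxE.
Qed.

Lemma scalar_curvature_transform u : O u ->
  scalar_curvature g u = scalar_curvature g' (F u).
Proof.
move=> Ou; rewrite !scalar_curvature_tr ricci_transform // -invmx_transform //.
by rewrite !trmx_mul trmxK !mulmxA mxtrace_mulC !mulmxA.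
Qed.

(** The trace of the transformation law of the connection; the inhomogeneous term is the logarithmic
    derivative of the density factor of E(-1). *)
Lemma gam_transform a u : O u ->
  gam g a u = n.+2%:R^-1 * \tr (invmx (J u) *m dM a J u) + \sum_l J u l a * gam g' l (F u).
Proof.
move=> Ou; have m0 : n.+2%:R != 0 :> R by rewrite pnatr_eq0.
apply: (mulfI m0); rewrite (gam_trace Oo Oh gs gsym a Ou) mulrDr mulVKf //.
have -> : conn_mx (christoffel g) a u = invmx (J u) *m (dM a J u + B a u *m J u).
  by rewrite -christoffel_transform // mulKmx // Ju.
rewrite mulmxDr mxtraceD; congr (_ + _); rewrite mxtrace_mulC -mulmxA mulmxV ?Ju // mulmx1.
rewrite /B raddf_sum mulr_sumr; apply: eq_bigr => l _ /=.
by rewrite mxtraceZ -(gam_trace O'o O'h g's g'sym l (FO Ou)) mulrCA.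
Qed.

Let det_gt0 u : O u -> 0 < `|\det (J u)|.
Proof. by move=> /Ju; rewrite unitmxE unitfE normr_gt0. Qed.

Lemma tau_inv_transform u : O u ->
  (tau g' (F u))^-1 = `|\det (J u)| `^ (- 2 / n.+2%:R) * (tau g u)^-1.
Proof.
move=> Ou; have J0 := det_gt0 Ou.
have -> : (tau g u)^-1 = `|\det (J u)| `^ (2 / n.+2%:R) * (tau g' (F u))^-1.
  rewrite !tau_invE gE // !det_mulmx det_tr mulrAC -expr2 normrM normrX.
  by rewrite powRM ?exprn_ge0 // -powR_mulrn // -powRrM.
by rewrite mulrA mulNr powRN mulVf ?mul1r // gt_eqF // powR_gt0.
Qed.

Lemma tau_inv_metric_transform u : O u ->
  tau_inv_metric g' (F u) =
  `|\det (J u)| `^ (- 2 / n.+2%:R) *: (J u *m tau_inv_metric g u *m (J u)^T).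
Proof.
move=> Ou; rewrite /tau_inv_metric tau_inv_transform // -invmx_transform //.
by rewrite -scalemxAr -scalemxAl scalerA.
Qed.

(** The factor d of the jet change has d^2 = |det J|^(-2/(n+2)), the factor of weight -2. The scalar
    slot is a constant multiple of tau^-1 times the invariant scalar curvature, so it has this
    weight as well. *)
Lemma L_transform u : O u ->
  let jet := jet_form (`|\det (J u)| `^ (- 1 / n.+2%:R)) (J u)
    (fun a => der a (fun v => `|\det (J v)| `^ (- 1 / n.+2%:R)) u) in
  L_tau_inv_metric g' (F u) = jet^T *m L_tau_inv_metric g u *m jet.
Proof.
move=> Ou jet; have J0 := det_gt0 Ou.
set d := `|\det (J u)| `^ (- 1 / n.+2%:R) in jet *.
have dd : d * d = `|\det (J u)| `^ (- 2 / n.+2%:R).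
  rewrite /d -powRD; last by rewrite (gt_eqF J0) implybT.
  by congr (_ `^ _); rewrite -mulrDl -opprD.
rewrite /L_tau_inv_metric /tractor_of_triple trmx0.
apply: (@tractor_algebra R n d _ _ (J u) _ _ _ (fun a => gam g a u) (fun a => gam g' a (F u))).
- move=> a; rewrite (gam_transform a Ou).
  have d0 : \det (J u) != 0 by rewrite -normr_gt0.
  rewrite (der_abs_powR _ a Oo Ou d0 (smooth_det Oo Js)).
  rewrite (der_det_unit a Oo Ou Js (Ju Ou)) -/d.
  have := jet_log_cancel d (\tr (invmx (J u) *m dM a J u)) (\sum_l J u l a * gam g' l (F u))
    (n.+2%:R^-1) d0.
  by [].
- by rewrite dd tau_inv_metric_transform.
- rewrite dd !L_kappa_curvature tau_inv_transform // scalar_curvature_transform //.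
  by rewrite -[_ * _ * scalar_curvature _ _]mulrA mulrCA.
Qed.

End Naturality.

(** * Smoothness of the curvature and of L in a chart *)

Lemma block_congruence_sym (R : comNzRingType) n (S : 'M[R]_(1 + n)) (k : R) (z : 'M[R]_n) :
  z^T = z -> (S^T *m block_mx k%:M 0 0 z *m S)^T = S^T *m block_mx k%:M 0 0 z *m S.
Proof.
by move=> zs; rewrite !trmx_mul trmxK tr_block_mx !trmx0 tr_scalar_mx zs mulmxA.
Qed.

Section SmoothTensors.
Variables (R : realType) (n : nat).
Local Notation V := 'rV[R]_n.+1.
Variables (O : set V) (g : V -> 'M[R]_n.+1).
Hypotheses (Oo : open O) (Oh : O `<=` half_space (n := n)) (gs : smoothM O g)
  (gsym : forall u, O u -> (g u)^T = g u) (gunit : forall u, O u -> g u \in unitmx).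

Let Gs := christoffel_smooth Oo Oh gs gunit.

Lemma ricci_smooth a b : Cinfty O (ricci (christoffel g) a b).
Proof.
apply: (Cinfty_sum _ Oo) => k.
have E p q c d : Cinfty O (fun u => pd p (christoffel g c q d) u).
  apply: (Cinfty_eq Oo _ (Cinfty_der p (Gs c q d))) => u Ou.
  exact/esym/(pd_open p Oo Oh Ou (Gs c q d)).
apply: (CinftyD Oo); first exact: (CinftyB Oo).
by apply: (Cinfty_sum _ Oo) => e; apply: (CinftyB Oo); exact: (CinftyM Oo).
Qed.

Lemma scalar_curvature_smooth : Cinfty O (scalar_curvature g).
Proof.
apply: (Cinfty_sum _ Oo) => a; apply: (Cinfty_sum _ Oo) => b; apply: (CinftyM Oo).
  exact: (smoothM_inv Oo gunit gs).
exact: ricci_smooth.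
Qed.

Lemma L_smooth : smoothM O (L_tau_inv_metric g).
Proof.
have Ss : smoothM O (splitting (christoffel g)).
  apply: smoothM_block; try exact: smoothM_cst.
  move=> a j; apply: (Cinfty_eq Oo _ (gam_smooth Oo Oh gs gunit a)) => v _; by rewrite mxE.
apply: (smoothM_mul Oo) => //; apply: (smoothM_mul Oo); first exact: smoothM_tr.
apply: smoothM_block; try exact: smoothM_cst; last exact: zeta_smooth.
move=> i j; apply: (@Cinfty_eq _ _ _ (fun u => n.+1%:R^-1 * n%:R^-1 *
    ((tau g u)^-1 * scalar_curvature g u))) => //.
  by move=> u _; rewrite -L_kappa_curvature; exact/esym/scalar_mx11E.
apply: (CinftyM Oo); first exact: Cinfty_cst.
by apply: (CinftyM Oo); [exact: tau_inv_smooth|exact: scalar_curvature_smooth].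
Qed.

Lemma L_sym u : O u -> (L_tau_inv_metric g u)^T = L_tau_inv_metric g u.
Proof.
move=> Ou; rewrite /L_tau_inv_metric /tractor_of_triple trmx0.
exact: block_congruence_sym (zeta_sym gsym Ou).
Qed.

End SmoothTensors.

(** * The sections over the interior and their extension at boundary points *)

Section Interior.
Variables (R : realType) (n : nat) (T : topologicalType) (I : Type).
Variable phi : I -> chart R n T.
Local Notation V := 'rV[R]_n.+1.
Local Notation cr i := (crd (phi i)).
Local Notation pr i := (par (phi i)).
Local Notation dm i := (dom (phi i)).
Local Notation H := (half_space (n := n)).
Hypothesis mfd : manifold_with_boundary phi.
Variable g : I -> V -> 'M[R]_n.+1.
Hypothesis g_metric : pseudo_riemannian_metric phi g.

Definition interior_img i : set V := cr i @` (interior_pts phi `&` dm i).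

Lemma interior_img_open i : open (interior_img i).
Proof.
have [D Do DE] := crd_img (phi i).
suff -> : interior_img i = upper D by exact: upper_open.
apply/seteqP; split=> [v [x [xint xi] <-]|v [Dv v0]].
  have [Dx _] : (D `&` H) (cr i x) by rewrite -DE; exists x.
  by split=> //; exact: (interior_chart mfd).
have [x xi xv] : (cr i @` dm i) v by rewrite DE; split=> //; exact: ltW.
by exists x => //; split=> //; exists i; rewrite ?xv.
Qed.

Lemma interior_img_half i : interior_img i `<=` H.
Proof. by move=> _ [x [_ xi] <-]; exact: crd_half. Qed.

Lemma metric_smooth i : smoothM (interior_img i) (g i).
Proof.
have [[_ _ ss] _] := g_metric => a b.
by apply: smooth_on_open; [exact: interior_img_open|exact: ss].
Qed.

Lemma metric_chart_sym i u : interior_img i u -> (g i u)^T = g i u.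
Proof. by have [[sf _ _] _] := g_metric => -[x [xint xi] <-]; exact: sf. Qed.

Lemma metric_unit i u : interior_img i u -> g i u \in unitmx.
Proof. by have [_ gu] := g_metric => -[x [xint xi] <-]; exact: gu. Qed.

Lemma metric_transition i j x : interior_pts phi x -> dm i x -> dm j x ->
  let u := cr i x in let F := transition phi i j in
  [/\ tau_inv_metric (g j) (cr j x) =
        density_factor (- 2) F u *: (Jac F u *m tau_inv_metric (g i) u *m (Jac F u)^T),
      L_tau_inv_metric (g j) (cr j x) =
        (jet_change F u)^T *m L_tau_inv_metric (g i) u *m jet_change F u &
      scalar_curvature (g j) (cr j x) = scalar_curvature (g i) u].
Proof.
move=> xint xi xj u tr; have [[_ sa _] _] := g_metric.
have Ax : interior_img j (cr j x) by exists x.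
have [D [F [[Do Du Fs FD] DE]]] := transition_jac mfd xi xj (@interior_img_open j) Ax.
(* Restricting to the interior image gives an open set contained in the half space, where [pd] and
   [der] agree. *)
pose O := D `&` interior_img i.
have Oo : open O by apply: openI => //; exact: interior_img_open.
have Ou : O u by split=> //; exists x.
have OH : O `<=` H by move=> v [_]; exact: interior_img_half.
have OI : O `<=` interior_img i by move=> v [].
have OD : O `<=` D by move=> v [].
have FsO : smoothM O F by move=> a b; exact: (Cinfty_sub OD (Fs a b)).
have Js := jacobian_mx_smooth Oo FsO.
have FO v : O v -> interior_img j (F v) by move=> [/FD[]].
have Ju v : O v -> jacobian_mx F v \in unitmx by move=> [/FD[]].
have JE k a v : O v -> jacobian_mx F v k a = der a (fun w => F w 0 k) v by move=> _; rewrite mxE.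
have gE v : O v -> g i v = (jacobian_mx F v)^T *m g j (F v) *m jacobian_mx F v.
  move=> Ov; have [Dv [y [yint yi] yv]] := Ov.
  have [[_ yj _ h4] JE' _ _] := DE v Dv (OH v Ov).
  have pv : pr i v = y by rewrite -yv crdK.
  rewrite pv in yj h4; have := sa i j y yint yi yj; rewrite /= h4 yv JE' => ->.
  set A := jacobian_mx F v; have Au : A \in unitmx by exact: Ju.
  rewrite !mulmxA -trmx_mul mulVmx // trmx1 mul1mx -mulmxA mulVmx // mulmx1 //.
have gs : smoothM O (g i) by move=> a b; exact: (Cinfty_sub OI (@metric_smooth i a b)).
have gsym v : O v -> (g i v)^T = g i v by move=> /OI; exact: metric_chart_sym.
have gun v : O v -> g i v \in unitmx by move=> /OI; exact: metric_unit.
have [[_ _ _ h4] JE' dE jE] := DE u Du (OH u Ou).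
have Fx : F u = cr j x by rewrite -h4 crdK.
have T1 := tau_inv_metric_transform FO Ju gun (@metric_unit j) gE Ou.
have T2 := L_transform Oo (@interior_img_open j) OH (@interior_img_half j) FsO FO Js Ju JE
  gs gsym gun (@metric_smooth j) (@metric_chart_sym j) (@metric_unit j) gE Ou.
have T3 := scalar_curvature_transform Oo (@interior_img_open j) OH (@interior_img_half j) FsO FO
  Js Ju JE gs gsym gun (@metric_smooth j) (@metric_chart_sym j) (@metric_unit j) gE Ou.
rewrite Fx in T1 T2 T3; split.
- by rewrite T1 JE' dE.
- rewrite jE; exact: T2.
- exact/esym/T3.
Qed.

Lemma smooth_on_img p q i (f : V -> 'M[R]_(p, q)) : smoothM (interior_img i) f ->
  smooth_mx_on (cr i @` (interior_pts phi `&` dm i)) f.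
Proof.
by move=> fs a b; apply: (Cinfty_smooth_on (@interior_img_open i)) => //; exact: fs.
Qed.

Lemma tau_inv_metric_section :
  smooth_section phi (sym2_tangent n (- 2)) (interior_pts phi) (fun i => tau_inv_metric (g i)).
Proof.
split.
- move=> i x xint xi; apply: (zeta_sym (@metric_chart_sym i)); by exists x.
- by move=> i j x xint xi xj; have [] := metric_transition xint xi xj.
- move=> i; apply: smooth_on_img; apply: zeta_smooth; first exact: interior_img_open.
    exact: metric_smooth.
  exact: metric_unit.
Qed.

Lemma L_section :
  smooth_section phi (sym2_tractor R n) (interior_pts phi) (fun i => L_tau_inv_metric (g i)).
Proof.
split.
- move=> i x xint xi; apply: (L_sym (@metric_chart_sym i)); by exists x.
- by move=> i j x xint xi xj; have [] := metric_transition xint xi xj.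
- move=> i; apply: smooth_on_img; apply: L_smooth; first exact: interior_img_open.
  + exact: interior_img_half.
  + exact: metric_smooth.
  + exact: metric_unit.
Qed.

Lemma scalar_curvature_section : smooth_section phi (scalar_bundle R n) (interior_pts phi)
  (fun i u => (scalar_curvature (g i) u)%:M).
Proof.
split; first by [].
- by move=> i j x xint xi xj; have [_ _ ->] := metric_transition xint xi xj.
- move=> i; apply: smooth_on_img => a b.
  apply: (Cinfty_eq (@interior_img_open i) _ (scalar_curvature_smooth (@interior_img_open i)
    (@interior_img_half i) (@metric_smooth i) (@metric_unit i))) => v _.
  exact/esym/scalar_mx11E.
Qed.

Lemma boundary_extension i x : (0 < n)%N ->
  projective_structure_extends phi (fun i => christoffel (g i)) ->
  boundary_pts phi x -> dm i x ->
  exists (O : set V) (hz : V -> 'M[R]_n.+1) (hQ : V -> 'M[R]_(1 + n.+1)) (hS : V -> R),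
  [/\ open O, O (cr i x), [/\ smoothM O hz, smoothM O hQ & Cinfty O hS] &
      forall u, upper O u -> [/\ tau_inv_metric (g i) u = hz u,
        L_tau_inv_metric (g i) u = hQ u & scalar_curvature (g i) u = hS u]].
Proof.
move=> n_gt0 proj xbd xi.
have [W [hatG [Ups [Wo Wu hs Wdm hE]]]] := extended_coefficients mfd proj xbd xi.
have WI : upper W `<=` interior_img i.
  move=> v [Wv v0]; have [h1 h2] := Wdm v Wv (ltW v0).
  by exists (pr i v) => //; split=> //; exists i; rewrite ?h2.
have gs : smoothM (upper W) (g i) by move=> a b; exact: (Cinfty_sub WI (@metric_smooth i a b)).
have gsym u : upper W u -> (g i u)^T = g i u by move=> /WI; exact: metric_chart_sym.
have gun u : upper W u -> g i u \in unitmx by move=> /WI; exact: metric_unit.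
have [ O [hz [hQ [hS [[ Oo Ou _] sm E]]]]] :=
  local_extension n_gt0 (boundary_chart mfd xbd xi) Wo Wu gs gsym gun hs hE.
exists O, hz, hQ, hS; split=> // u Ou'; by have [-> -> ->] := E u Ou'.
Qed.

End Interior.

Theorem proposition3 (R : realType) (n : nat) (n_gt0 : (0 < n)%N)
    (Mbar : topologicalType) (I : Type) (phi : I -> chart R n Mbar)
    (Mbar_mfd : manifold_with_boundary phi)
    (g : I -> 'rV[R]_n.+1 -> 'M[R]_n.+1)
    (g_metric : pseudo_riemannian_metric phi g)
    (g_proj : projective_structure_extends phi (fun i => christoffel (g i))) :
  [/\ extends_smoothly phi (sym2_tangent n (- 2)) setT
        (fun i => tau_inv_metric (g i)),
      extends_smoothly phi (sym2_tractor R n) setT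
        (fun i => L_tau_inv_metric (g i)) &
      function_extends_smoothly phi (fun i => scalar_curvature (g i))].
Proof.
have bd i x := @boundary_extension R n Mbar I phi Mbar_mfd g g_metric i x n_gt0 g_proj.
split.
- apply: (extends_by_limits Mbar_mfd); last first.
  + move=> i x xbd xi; have [W [hz [hQ [hS [Wo Wu [hzs _ _] E]]]]] := bd i x xbd xi.
    by exists W, hz; split=> // v /E[].
  + exact: (tau_inv_metric_section Mbar_mfd g_metric).
  + by move=> i j x f l; exact: (sym2_tangent_act_cvg Mbar_mfd).
  + exact: symmetric_closed.
- apply: (extends_by_limits Mbar_mfd); last first.
  + move=> i x xbd xi; have [W [hz [hQ [hS [Wo Wu [_ hQs _] E]]]]] := bd i x xbd xi.
    by exists W, hQ; split=> // v /E[].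
  + exact: (L_section Mbar_mfd g_metric).
  + by move=> i j x f l; exact: (sym2_tractor_act_cvg Mbar_mfd).
  + exact: symmetric_closed.
- apply: (function_extends Mbar_mfd); apply: (extends_by_limits Mbar_mfd) => //; last first.
  + move=> i x xbd xi; have [W [hz [hQ [hS [Wo Wu [_ _ hSs] E]]]]] := bd i x xbd xi.
    exists W, (fun v => (hS v)%:M); split=> //.
      move=> a b; apply: (Cinfty_eq Wo _ hSs) => v _; exact/esym/scalar_mx11E.
    by move=> v /E[_ _ ->].
  + exact: (scalar_curvature_section Mbar_mfd g_metric).
Qed.
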